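(* Let $n\ge 2$ and let $\mathcal C_{2n}$ be the circular ladder graph on $2n$ vertices. Then the following hold, where $k$ denotes the integer determined by $n$ in each case. (a) $$\operatorname{Ind}(\mathcal C_{2n})\simeq \begin{cases}\bigvee_3 \mathbb{S}^{2k-1} & \text{if } n=4k,\\ \mathbb{S}^{2k-1} & \text{if } n=4k+1,\\ \mathbb{S}^{2k} & \text{if } n=4k+2,\\ \mathbb{S}^{2k+1} & \text{if } n=4k+3.\end{cases}$$ (b) If $n=2k+1$, then $\mathcal M_p(\mathcal C_{2n})\simeq \ast$, that is, $\mathcal M_p(\mathcal C_{2n})$ is contractible. (c) $$\mathcal M_p(\mathcal C_{2n})\simeq \begin{cases}\mathbb{S}^{\frac{n-2}{2}}\vee \mathbb{S}^{\frac{n-2}{2}}\vee \bigvee_4 \mathbb{S}^{2k} & \text{if } n=3(2k),\\ \mathbb{S}^{\frac{n-2}{2}}\vee \mathbb{S}^{\frac{n-2}{2}}\vee \bigvee_2 \mathbb{S}^{2k+1} & \text{if } n=3(2k+1)\pm 1.\end{cases}$$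
   Context: The circular ladder graph $\mathcal C_{2n}$ is the graph with vertex set $\{v_1,\dots,v_{2n}\}$ and edge set $\{v_iv_{i+1} : 1\le i\le n-1\}\cup\{v_1v_n\}\cup\{v_jv_{j+1} : n+1\le j\le 2n-1\}\cup\{v_{n+1}v_{2n}\}\cup\{v_kv_{k+n} : 1\le k\le n\}$; it is described as the Cartesian product of the $n$-cycle and the path with one edge. For a finite simple graph $G$, the independence complex $\operatorname{Ind}(G)$ is the simplicial complex whose faces are the independent sets of $G$ (sets of pairwise non-adjacent vertices). The perfect matching complex $\mathcal M_p(G)$ is the simplicial complex, on the edges of $G$, whose faces are the matchings of $G$ that can be extended to (are contained in) a perfect matching of $G$. $\simeq$ denotes homotopy equivalence (of geometric realizations), $\mathbb S^d$ is the $d$-sphere, $\vee$ is the wedge, and $\bigvee_r X$ is the wedge of $r$ copies of $X$.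
   Formalization: In (c), second case, n = 2 is excluded: there C_4 is the 4-cycle, whose perfect matching complex is two disjoint segments (two components), whereas the asserted wedge S^0 ∨ S^0 ∨ S^1 ∨ S^1 has three components. *)

(* Defs.v *)
From HB Require Import structures.
From mathcomp Require Import all_boot all_order all_algebra.
From mathcomp Require Import all_classical all_reals.
From mathcomp Require Import topology normedtype wedge_sigT.

Set Implicit Arguments.
Unset Strict Implicit.
Unset Printing Implicit Defensive.

Import Order.TTheory GRing.Theory Num.Theory.
Import numFieldNormedType.Exports.

Local Open Scope nat_scope.

Record sgraph := SGraph {
  svertex :> finType;
  sadj : rel svertex;
  sadj_sym : symmetric sadj;
  sadj_irrefl : irreflexive sadj }.

Record scomplex (V : finType) := SComplex {
  faces : {set {set V}};
  faces_sub : forall A B : {set V}, B \subset A -> A \in faces -> B \in faces }.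

Section GraphComplexes.
Variable G : sgraph.

Definition edges : {set {set G}} :=
  [set e : {set G} | [exists x : G, exists y : G,
     sadj x y && (e == [set x; y]%SET)]]%SET.

Definition independent (A : {set G}) : bool :=
  [forall x in A, forall y in A, ~~ sadj x y].

Definition matching (M : {set {set G}}) : bool :=
  (M \subset edges) && finset.trivIset M.

Definition perfect_matching (M : {set {set G}}) : bool :=
  matching M && (finset.cover M == [set: G]%SET).

Lemma ind_faces_sub (A B : {set G}) : B \subset A ->
  A \in [set A | independent A]%SET -> B \in [set A | independent A]%SET.
Proof.
rewrite !inE => /fintype.subsetP sBA /forall_inP iA.
apply/forall_inP => x /sBA xA; apply/forall_inP => y /sBA yA.
by move/forall_inP: (iA x xA) => /(_ y yA).
Qed.

Definition Ind : scomplex G := SComplex ind_faces_sub.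

Definition pm_faces : {set {set {set G}}} :=
  [set M | matching M &&
     [exists P : {set {set G}}, perfect_matching P && (M \subset P)]]%SET.

Lemma pm_faces_sub (A B : {set {set G}}) : B \subset A ->
  A \in pm_faces -> B \in pm_faces.
Proof.
rewrite !inE => sBA /andP[/andP[AE tA] /existsP[P /andP[pP AP]]].
apply/andP; split; last first.
  by apply/existsP; exists P; rewrite pP (fintype.subset_trans sBA).
by rewrite /matching (fintype.subset_trans sBA AE) (finset.trivIsetS sBA).
Qed.

(* The ambient vertex type is all of {set G}; only members of [edges G] occur
   in faces. *)
Definition PM : scomplex {set G} := SComplex pm_faces_sub.

End GraphComplexes.

(* The edge list v_a v_b of the circular ladder, on the labels 1, ..., 2n. *)
Definition ladder_edge (n a b : nat) : bool :=
  [|| [&& 1 <= a, a <= n - 1 & b == a + 1],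
      (a == 1) && (b == n),
      [&& n + 1 <= a, a <= 2 * n - 1 & b == a + 1],
      (a == n + 1) && (b == 2 * n)
    | [&& 1 <= a, a <= n & b == a + n]].

(* The ordinal i stands for the vertex v_(i+1). The condition i != j only
   matters for n = 1, where the edge list has loops. *)
Definition ladder_adj (n : nat) : rel 'I_(2 * n) := fun i j =>
  (i != j) && (ladder_edge n i.+1 j.+1 || ladder_edge n j.+1 i.+1).

Lemma ladder_adj_sym n : symmetric (@ladder_adj n).
Proof. by move=> i j; rewrite /ladder_adj eq_sym orbC. Qed.

Lemma ladder_adj_irrefl n : irreflexive (@ladder_adj n).
Proof. by move=> i; rewrite /ladder_adj eqxx. Qed.

Definition circular_ladder (n : nat) : sgraph :=
  SGraph (@ladder_adj_sym n) (@ladder_adj_irrefl n).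

Local Open Scope classical_set_scope.
Local Open Scope ring_scope.

HB.instance Definition _ := hasNbhs.Build unit principal_filter.
HB.instance Definition _ := Discrete_ofNbhs.Build unit erefl.

Section Homotopy.
Variable R : realType.

Definition homotopic (X Y : topologicalType) (f g : X -> Y) : Prop :=
  exists H : R * X -> Y,
    [/\ {within `[0, 1]%classic `*` [set: X], continuous H},
        forall x, H (0, x) = f x
      & forall x, H (1, x) = g x].

Definition homotopy_equivalent (X Y : topologicalType) : Prop :=
  exists (f : X -> Y) (g : Y -> X),
    [/\ continuous f, continuous g,
        homotopic (g \o f) idfun & homotopic (f \o g) idfun].

Definition contractible (X : topologicalType) : Prop :=
  homotopy_equivalent X unit.

(* Barycentric coordinates. As V is finite, the subspace topology from the
   product R^V is the usual topology of the realization. *)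
Definition realization (V : finType) (K : scomplex V) : set {ptws V -> R} :=
  [set x | [/\ forall v, 0 <= x v, \sum_v x v = 1
             & [set v | x v != 0]%SET \in faces K]].

Definition geom (V : finType) (K : scomplex V) : topologicalType :=
  set_type (realization K).

Definition unit_sphere (d : nat) : set 'rV[R]_d.+1 :=
  [set x | \sum_i x 0 i ^+ 2 = 1].
Arguments unit_sphere d : clear implicits.

Definition sphere (d : nat) : topologicalType := set_type (unit_sphere d).

Lemma sphere_base_subproof d : delta_mx 0 0 \in unit_sphere d.
Proof.
apply/mem_set; rewrite /unit_sphere /= (bigD1 ord0) //= big1 ?addr0.
  by rewrite mxE !eqxx expr1n.
by move=> i /negPf i0; rewrite mxE i0 andbF expr0n.
Qed.

Definition sphere_base (d : nat) : sphere d :=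
  exist _ (delta_mx 0 0) (sphere_base_subproof d).

(* S^(d_1) v ... v S^(d_m) for ds = [:: d_1; ...; d_m]. *)
Definition sphere_wedge (ds : seq nat) : topologicalType :=
  @wedge 'I_(size ds) (fun i => sphere (nth 0%N ds i))
    (fun i => sphere_base (nth 0%N ds i)).

End Homotopy.

(* Main.v *)
Require Import Defs.
From mathcomp Require Import all_boot all_order all_algebra.
From mathcomp Require Import all_classical all_reals.
From mathcomp Require Import topology normedtype wedge_sigT.
From mathcomp Require Import ring lra zify.

(* Deleting a face t from a complex does not change the homotopy type when the
   link of t is a cone, and a contractible complex in which all the faces of an
   antichain ss of maximal faces have been deleted shows that the original
   complex is a wedge of spheres, one of dimension #|s| - 1 for each s in ss.
   For the complex of the faces of Ind G containing no member of a list ts, the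
   first step applies along a chain: if y_i is adjacent only to x_(i+1) and to
   vertices that cannot occur with B, x_0, ..., x_i, then B |: x_0 can be deleted,
   provided that the last set of the chain is forbidden or is kept aside as a
   critical cell.

   For (a) this is applied to the ladder itself. For M_p, two opposite row edges
   of a perfect matching occur together unless the matching is one of the two
   alternating ones, which exist for even n only. Coning off these two matchings
   by apices z_0, z_1 turns M_p into an independence complex in which opposite row
   edges are interchangeable, so one row can be dropped. What is left is a cycle of
   n row edges, the n rungs, and for even n the apices. The two spheres of dimension
   (n - 2) / 2 come from cells made of a rung and of every other row edge; the
   others from cells containing an apex and every third row edge, starting from
   column 0 in one of the two directions. *)

Set Implicit Arguments.
Unset Strict Implicit.
Unset Printing Implicit Defensive.

Import Order.TTheory GRing.Theory Num.Theory.
Import numFieldNormedType.Exports.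

Local Open Scope classical_set_scope.
Local Open Scope ring_scope.

(** * Homotopy *)

Section HomotopyRelation.
Variable R : realType.

(** All equivalences are realized by explicit maps in barycentric coordinates, and the wedge is
    reached by an explicit quotient map, whose homotopy inverse is continuous by compactness. The
    combinatorial obstacle is that deletions interact: adding [y_i] to a face may complete a set
    forbidden earlier, in particular a critical cell that was kept aside. Hence the recurring
    hypotheses that a forbidden set containing [y_i] also contains a vertex that cannot occur in the
    link at hand; they dictate the order of the deletions. Critical cells are what the chains leave
    over. A chain that comes back to a neighbour of its start deletes the start at no cost; a chain
    that goes round without meeting itself ends in a maximal face. Which of the two happens depends
    on [n] modulo 4 for the zigzags in the ladder, modulo 3 for row edges next to an apex, and
    modulo 2 for row edges next to rungs. This is the origin of the case distinctions. *)

Definition clamp (t : R) : R := Num.max 0 (Num.min 1 t).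

Lemma clamp_continuous : continuous clamp.
Proof.
move=> t; apply: continuous_max; first exact: cst_continuous.
by apply: continuous_min; [exact: cst_continuous|exact: id].
Qed.

Lemma clamp_itv t : 0 <= clamp t <= 1.
Proof. by rewrite /clamp le_max lexx /= ge_max ler01 ge_min lexx. Qed.

Lemma clamp_id t : 0 <= t <= 1 -> clamp t = t.
Proof. by case/andP=> t0 t1; rewrite /clamp (min_idPr t1) (max_idPr t0). Qed.

Lemma clamp0 : clamp 0 = 0. Proof. by rewrite clamp_id // lexx ler01. Qed.
Lemma clamp1 : clamp 1 = 1. Proof. by rewrite clamp_id // lexx ler01. Qed.

Lemma continuous_closedU (X Y : topologicalType) (A B : set X) (f : X -> Y) :
  closed A -> closed B -> A `|` B = setT ->
  {within A, continuous f} -> {within B, continuous f} -> continuous f.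
Proof.
move=> cA cB AB fA fB; apply/continuous_subspace_setT; rewrite -AB.
exact: withinU_continuous.
Qed.

(** The pasting lemma, for a boolean test that may choose either branch on the overlap, as [<=] on
    the reals does. *)
Lemma continuous_case (X Y : topologicalType) (A : set X) (f g : X -> Y)
    (b : X -> bool) (B : set X) : closed A -> closed B -> A `|` B = setT ->
  {within A, continuous f} -> {within B, continuous g} ->
  (forall x, A x -> B x -> f x = g x) ->
  (forall x, if b x then A x else B x) ->
  continuous (fun x => if b x then f x else g x).
Proof.
move=> cA cB AB cf cg fg bAB; apply: (continuous_closedU cA cB AB).
- apply: (@subspace_eq_continuous _ _ _ f) => //; move=> x /set_mem Ax; rewrite /from_subspace; move: (bAB x).
  by case: (b x) => // /fg->.
- apply: (@subspace_eq_continuous _ _ _ g) => //; move=> x /set_mem Bx; rewrite /from_subspace; move: (bAB x).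
  by case: (b x) => // /fg->.
Qed.

Lemma within_continuous_comp (X Y Z : topologicalType) (A : set Y)
    (f : X -> Y) (g : Y -> Z) : {within A, continuous g} -> continuous f ->
  (forall x, A (f x)) -> continuous (g \o f).
Proof.
move=> /subspace_continuousP cg cf Af x.
apply: (@cvg_comp _ _ _ f g (nbhs x) (within A (nbhs (f x)))); last exact: cg.
move=> U /= /cf; rewrite /nbhs /=; apply: filterS => y /=; exact.
Qed.

Lemma pair_continuous (X Y Z : topologicalType) (f : X -> Y) (g : X -> Z) :
  continuous f -> continuous g -> continuous (fun x => (f x, g x)).
Proof. by move=> cf cg x; apply: cvg_pair; [exact: cf|exact: cg]. Qed.

Lemma fst_continuous (X Y : topologicalType) : continuous (@fst X Y).
Proof. by move=> x; exact: cvg_fst. Qed.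

Lemma snd_continuous (X Y : topologicalType) : continuous (@snd X Y).
Proof. by move=> x; exact: cvg_snd. Qed.

Lemma comp_continuous (X Y Z : topologicalType) (f : X -> Y) (g : Y -> Z) :
  continuous f -> continuous g -> continuous (fun x => g (f x)).
Proof. by move=> cf cg x; apply: continuous_comp; [exact: cf|exact: cg]. Qed.

(* A homotopy is stationary outside [[0, 1]] without loss of generality. *)
Lemma homotopicP (X Y : topologicalType) (f g : X -> Y) :
  homotopic R f g <-> exists H : R * X -> Y, [/\ continuous H,
    forall (t : R) x, t <= 0 -> H (t, x) = f x & forall t x, 1 <= t -> H (t, x) = g x].
Proof.
split=> -[H [cH H0 H1]]; last first.
  by exists H; split => [|x|x];
    [exact: continuous_subspaceT|exact: H0|exact: H1].
exists (fun p => H (clamp p.1, p.2)); split => [|t x t0|t x t1] /=.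
- apply: (within_continuous_comp cH) => [|p].
    apply: pair_continuous; last exact: snd_continuous.
    exact: (comp_continuous (@fst_continuous _ _) clamp_continuous).
  by split => //=; rewrite in_itv /= clamp_itv.
- rewrite -H0 /clamp; congr (H (_, _)).
  by rewrite (min_idPr _) ?(le_trans t0) // (max_idPl _).
- rewrite -H1 /clamp; congr (H (_, _)).
  by rewrite (min_idPl _) // (max_idPr _).
Qed.

Lemma homotopic_refl (X Y : topologicalType) (f : X -> Y) :
  continuous f -> homotopic R f f.
Proof.
move=> cf; apply/homotopicP; exists (fun p => f p.2); split => //.
exact: (comp_continuous (@snd_continuous _ _) cf).
Qed.

Lemma homotopic_sym (X Y : topologicalType) (f g : X -> Y) :
  homotopic R f g -> homotopic R g f.
Proof.
move=> /homotopicP[H [cH H0 H1]]; apply/homotopicP.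
exists (fun p => H (1 - p.1, p.2)); split => [|t x t0|t x t1] /=.
- apply: comp_continuous cH; apply: pair_continuous; last exact: snd_continuous.
  by move=> p; apply: cvgB; [exact: cvg_cst|exact: fst_continuous].
- by rewrite H1 //; lra.
- by rewrite H0 //; lra.
Qed.

Lemma closed_le_fun (X : topologicalType) (f g : X -> R) :
  continuous f -> continuous g -> closed [set x | f x <= g x].
Proof.
move=> cf cg; rewrite (_ : [set x | _] = (fun x => g x - f x) @^-1` [set r | 0 <= r]).
  apply: preimage_closed; last exact: closed_ge.
  by move=> x _; apply: cvgB; [exact: cg|exact: cf].
by apply/seteqP; split => x /=; rewrite subr_ge0.
Qed.

Lemma homotopic_trans (X Y : topologicalType) (f g h : X -> Y) :
  homotopic R f g -> homotopic R g h -> homotopic R f h.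
Proof.
move=> /homotopicP[H [cH H0 H1]] /homotopicP[J [cJ J0 J1]]; apply/homotopicP.
have cdouble (c : R) : continuous (fun p : R * X => (p.1 *+ 2 - c, p.2)).
  apply: pair_continuous; last exact: snd_continuous.
  move=> p; apply: cvgB; last exact: cvg_cst.
  by apply: cvgMn; exact: fst_continuous.
(* The [- 0] makes both branches instances of [cdouble]. *)
exists (fun p => if p.1 *+ 2 <= 1 then H (p.1 *+ 2 - 0, p.2)
                 else J (p.1 *+ 2 - 1, p.2)).
have c2 : continuous (fun p : R * X => p.1 *+ 2).
  by move=> p; apply: cvgMn; exact: fst_continuous.
split => [|t x t0|t x t1] /=.
- apply: (@continuous_case _ _ [set p : R * X | p.1 *+ 2 <= 1] _ _ _
    [set p : R * X | 1 <= p.1 *+ 2]).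
  + by apply: closed_le_fun => //; exact: cst_continuous.
  + by apply: closed_le_fun => //; exact: cst_continuous.
  + rewrite -subTset => p _ /=; case: (leP (p.1 *+ 2) 1) => [|/ltW]; by [left|right].
  + by apply: continuous_subspaceT; exact: (comp_continuous (cdouble 0) cH).
  + by apply: continuous_subspaceT; exact: (comp_continuous (cdouble 1) cJ).
  + by move=> [t x] /= t1 t2; rewrite H1 ?J0 //; lra.
  + by move=> [t x] /=; case: leP => // /ltW.
- by rewrite ifT ?H0 //; lra.
- by rewrite ifF ?J1 //; lra.
Qed.

Lemma homotopic_compl (X Y Z : topologicalType) (f g : X -> Y) (h : Y -> Z) :
  continuous h -> homotopic R f g -> homotopic R (h \o f) (h \o g).
Proof.
move=> ch /homotopicP[H [cH H0 H1]]; apply/homotopicP; exists (h \o H).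
split=> [|t x t0|t x t1] /=; [exact: (comp_continuous cH ch)|by rewrite H0|].
by rewrite H1.
Qed.

Lemma homotopic_compr (X Y Z : topologicalType) (f g : Y -> Z) (h : X -> Y) :
  continuous h -> homotopic R f g -> homotopic R (f \o h) (g \o h).
Proof.
move=> ch /homotopicP[H [cH H0 H1]]; apply/homotopicP.
exists (fun p => H (p.1, h p.2)).
split=> [|t x t0|t x t1] /=; [|by rewrite H0|by rewrite H1].
apply: comp_continuous cH; apply: pair_continuous; first exact: fst_continuous.
exact: (comp_continuous (@snd_continuous _ _) ch).
Qed.

Local Notation "X ~~h Y" := (homotopy_equivalent R X Y) (at level 70).

Lemma homotopy_equivalent_refl X : X ~~h X.
Proof.
exists idfun, idfun; have cid : continuous (@idfun X) by move=> x; exact: cvg_id.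
by split => //; apply: homotopic_refl.
Qed.

Lemma homotopy_equivalent_sym X Y : X ~~h Y -> Y ~~h X.
Proof. by move=> [f [g [cf cg fg gf]]]; exists g, f. Qed.

Lemma homotopy_equivalent_trans X Y Z : X ~~h Y -> Y ~~h Z -> X ~~h Z.
Proof.
move=> [f [g [cf cg gf fg]]] [f' [g' [cf' cg' gf' fg']]].
exists (f' \o f), (g \o g'); split.
- exact: comp_continuous.
- exact: comp_continuous.
- apply: homotopic_trans gf.
  exact: (homotopic_compl cg (homotopic_compr cf gf')).
- apply: homotopic_trans fg'.
  exact: (homotopic_compl cf' (homotopic_compr cg' fg)).
Qed.

End HomotopyRelation.

(** * Realizations of simplicial complexes *)

Section Realization.
Variable R : realType.

Lemma set_type_continuous (X Y : topologicalType) (A : set Y) (f : X -> A) :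
  continuous (fun x => set_val (f x)) -> continuous f.
Proof.
move=> cf x U /= -[V [[W oW <-] Wfx] sWU].
apply: filterS sWU _; apply: cf; apply: open_nbhs_nbhs; split => //.
Qed.

Lemma set_val_continuous (Y : topologicalType) (A : set Y) :
  continuous (set_val : A -> Y).
Proof. exact: initial_continuous. Qed.

Lemma ptws_continuous (X : topologicalType) (V : finType)
    (f : X -> {ptws V -> R}) :
  (forall v, continuous (fun x => f x v)) -> continuous f.
Proof.
move=> cf x; apply/cvg_sup => v.
move=> U [W [[W' oW' <-] W'x] sWU]; apply: filterS sWU _.
by apply: (cf v x); apply: open_nbhs_nbhs; split.
Qed.

Lemma ptws_coord_continuous (V : finType) (v : V) :
  continuous (fun f : {ptws V -> R} => f v).
Proof. exact: (@proj_continuous V (fun=> R) v). Qed.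

Variable V : finType.
Implicit Types K L : scomplex V.

Definition bary K (v : V) (x : geom R K) : R := (set_val x : V -> R) v.
Arguments bary {K} v x.

Lemma bary_continuous K v : continuous (@bary K v).
Proof.
exact: (comp_continuous (@set_val_continuous _ _) (@ptws_coord_continuous _ v)).
Qed.

Lemma geom_continuous (X : topologicalType) K (f : X -> geom R K) :
  (forall v, continuous (fun x => bary v (f x))) -> continuous f.
Proof.
by move=> cf; apply/set_type_continuous/ptws_continuous.
Qed.

Lemma sum_continuous (X : topologicalType) (I : Type) (r : seq I) (P : pred I)
    (f : I -> X -> R) : (forall i, continuous (f i)) ->
  continuous (fun x => \sum_(i <- r | P i) f i x).
Proof.
move=> cf; elim: r => [|i r IHr].
  under eq_fun do rewrite big_nil; exact: cst_continuous.
under eq_fun do rewrite big_cons; case: (P i) => // x.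
by apply: cvgD; [exact: cf|exact: IHr].
Qed.

Lemma addf_continuous (X : topologicalType) (f g : X -> R) :
  continuous f -> continuous g -> continuous (fun x => f x + g x).
Proof. by move=> cf cg x; apply: cvgD; [exact: cf|exact: cg]. Qed.

Lemma subf_continuous (X : topologicalType) (f g : X -> R) :
  continuous f -> continuous g -> continuous (fun x => f x - g x).
Proof. by move=> cf cg x; apply: cvgB; [exact: cf|exact: cg]. Qed.

Lemma mulf_continuous (X : topologicalType) (f g : X -> R) :
  continuous f -> continuous g -> continuous (fun x => f x * g x).
Proof. by move=> cf cg x; apply: cvgM; [exact: cf|exact: cg]. Qed.

Lemma divf_continuous (X : topologicalType) (f g : X -> R) :
  continuous f -> continuous g -> (forall x, g x != 0) ->
  continuous (fun x => f x / g x).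
Proof.
by move=> cf cg g0 x; apply: cvgM; [exact: cf|apply: cvgV; [exact: g0|exact: cg]].
Qed.

Lemma min_continuous (X : topologicalType) (f g : X -> R) :
  continuous f -> continuous g -> continuous (fun x => Num.min (f x) (g x)).
Proof. by move=> cf cg x; apply: continuous_min; [exact: cf|exact: cg]. Qed.

Lemma bigmin_continuous (X : topologicalType) (I : Type) (r : seq I) (P : pred I)
    (c : R) (f : I -> X -> R) : (forall i, continuous (f i)) ->
  continuous (fun x => \big[Num.min/c]_(i <- r | P i) f i x).
Proof.
move=> cf; elim: r => [|i r IHr].
  under eq_fun do rewrite big_nil; exact: cst_continuous.
by under eq_fun do rewrite big_cons; case: (P i) => //; exact: min_continuous.
Qed.

Definition supp (x : V -> R) : {set V} := [set v | x v != 0]%SET.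

Definition geom_pt K (x : V -> R) (Kx : realization K x) : geom R K :=
  exist _ x (mem_set Kx).
Arguments geom_pt {K x} Kx.

Lemma baryE K x Kx v : bary v (@geom_pt K x Kx) = x v.
Proof. by []. Qed.

Lemma geomP {K} (x : geom R K) : realization K (fun v => bary v x).
Proof. exact: set_valP. Qed.

Lemma bary_ge0 {K} (x : geom R K) v : 0 <= bary v x.
Proof. by have [] := geomP x. Qed.

Lemma bary_sum {K} (x : geom R K) : \sum_v bary v x = 1.
Proof. by have [] := geomP x. Qed.

Lemma bary_faces {K} (x : geom R K) : supp (bary ^~ x) \in faces K.
Proof. by have [] := geomP x. Qed.

Lemma geom_inj {K} (x y : geom R K) : (forall v, bary v x = bary v y) -> x = y.
Proof. by move=> xy; apply: val_inj; apply/funext. Qed.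

Lemma bary_le1 {K} (x : geom R K) v : bary v x <= 1.
Proof.
rewrite -(bary_sum x) (bigD1 v) //= lerDl sumr_ge0 // => u _; exact: bary_ge0.
Qed.

Lemma realization_convex K (x y : V -> R) (t : R) (A : {set V}) :
  (forall v, 0 <= x v) -> (forall v, 0 <= y v) ->
  \sum_v x v = 1 -> \sum_v y v = 1 -> 0 <= t <= 1 ->
  A \in faces K -> supp x \subset A -> supp y \subset A ->
  realization K (fun v => (1 - t) * x v + t * y v).
Proof.
move=> x0 y0 x1 y1 /andP[t0 t1] KA xA yA; split.
- by move=> v; rewrite addr_ge0 // mulr_ge0 // subr_ge0.
- by rewrite big_split /= -!mulr_sumr x1 y1; ring.
- apply: faces_sub KA; apply/fintype.subsetP => v; rewrite inE; apply: contraR => vA.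
  have /eqP -> : x v == 0.
    by apply: contraR vA => xv; apply: (fintype.subsetP xA); rewrite inE.
  have /eqP -> : y v == 0.
    by apply: contraR vA => xv; apply: (fintype.subsetP yA); rewrite inE.
  by rewrite !mulr0 addr0.
Qed.

(** The straight-line homotopy works: at every time the point stays in the simplex [A] that contains
    both ends. *)
Lemma homotopic_contiguous (X : topologicalType) K (f g : X -> geom R K) :
  continuous f -> continuous g ->
  (forall x, exists2 A, A \in faces K &
     supp (bary ^~ (f x)) \subset A /\ supp (bary ^~ (g x)) \subset A) ->
  homotopic R f g.
Proof.
move=> cf cg fg.
have HP (p : R * X) : realization K (fun v =>
    (1 - clamp p.1) * bary v (f p.2) + clamp p.1 * bary v (g p.2)).
  have [A KA [fA gA]] := fg p.2; apply: realization_convex KA fA gA;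
    by [move=> v; exact: bary_ge0|exact: bary_sum|exact: clamp_itv].
exists (fun p => geom_pt (HP p)); split.
- apply: continuous_subspaceT; apply: geom_continuous => v.
  have c1 : continuous (fun p : R * X => clamp p.1).
    exact: (comp_continuous (@fst_continuous _ _) (@clamp_continuous _)).
  have c2 (h : X -> geom R K) : continuous h ->
      continuous (fun p : R * X => bary v (h p.2)).
    move=> ch; apply: comp_continuous (@bary_continuous K v).
    exact: (comp_continuous (@snd_continuous _ _) ch).
  move=> p; apply: cvgD; apply: cvgM; try exact: c1; try exact: c2.
  by apply: cvgB; [exact: cvg_cst|exact: c1].
- by move=> x; apply: geom_inj => v; rewrite baryE /= clamp0 subr0 mul1r mul0r addr0.
- by move=> x; apply: geom_inj => v; rewrite baryE /= clamp1 subrr mul1r mul0r add0r.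
Qed.

End Realization.
Arguments bary {R V K} v x.
Arguments geom_pt {R V K x} Kx.

(** * Deletion of a face whose link is a cone *)

Section Del.
Variable V : finType.
Implicit Type K : scomplex V.

Lemma del_faces_sub K (t A B : {set V}) : B \subset A ->
  A \in [set A in faces K | ~~ (t \subset A)]%SET ->
  B \in [set A in faces K | ~~ (t \subset A)]%SET.
Proof.
move=> BA; rewrite !inE => /andP[KA tA]; rewrite (faces_sub BA KA) /=.
by apply: contra tA => /fintype.subset_trans; apply.
Qed.

(** The whole open star of [t] is removed, not only [t]. *)
Definition del K (t : {set V}) : scomplex V := SComplex (@del_faces_sub K t).

Lemma in_del K t A : (A \in faces (del K t)) = (A \in faces K) && ~~ (t \subset A).
Proof. by rewrite inE. Qed.

End Del.

Section Collapse.
Variables (R : realType) (V : finType).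
Implicit Type K : scomplex V.

Lemma min_coord_ge0 (x : V -> R) (t : {set V}) : (forall v, 0 <= x v) ->
  0 <= \big[Num.min/1]_(v in t) x v.
Proof. by move=> x0; apply/le_bigmin; rewrite ?ler01 //; split. Qed.

Lemma min_coord_eq0 (x : V -> R) (t : {set V}) : (forall v, 0 <= x v) ->
  ~~ (t \subset supp x) -> \big[Num.min/1]_(v in t) x v = 0.
Proof.
move=> x0 /subsetPn[v vt]; rewrite inE negbK => /eqP xv.
apply/eqP; rewrite eq_le min_coord_ge0 // andbT -xv.
exact: bigmin_le_cond.
Qed.

Lemma min_coord_attained (x : V -> R) (t : {set V}) : (forall v, x v <= 1) ->
  t != finset.set0 -> exists2 v, v \in t & \big[Num.min/1]_(v in t) x v = x v.
Proof.
move=> x1 /finset.set0Pn[u ut].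
by have [v vt ->] := eq_bigmin u (fun v => v \in t) x ut (fun v _ => x1 v); exists v.
Qed.

Section Step.
Variables (K : scomplex V) (t : {set V}) (p : V).
Hypothesis t0 : t != finset.set0.
Hypothesis pt : p \notin t.
Hypothesis Kp : forall A, A \in faces K -> t \subset A -> p |: A \in faces K.

Let m (x : V -> R) : R := \big[Num.min/1]_(v in t) x v.

(** Mass slides from [t] to the apex [p]. The amount taken from each vertex of [t] is the least
    coordinate on [t], so that some vertex of [t] leaves the support; points outside the open star
    of [t] do not move. *)
Let push (x : V -> R) (v : V) : R :=
  x v - (v \in t)%:R * m x + (v == p)%:R * (#|t|%:R * m x).

Let push_id (x : V -> R) : m x = 0 -> push x = x.
Proof. by move=> mx; apply/funext => v; rewrite /push mx !mulr0 subr0 addr0. Qed.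

Let push_supp (x : geom R K) :
  supp (push (bary ^~ x)) \subset (if t \subset supp (bary ^~ x)
    then p |: supp (bary ^~ x) else supp (bary ^~ x)).
Proof.
case: ifPn => [tx|/(min_coord_eq0 (bary_ge0 x)) /push_id-> //].
apply/fintype.subsetP => v; rewrite !inE; apply: contraR; rewrite negb_or negbK.
case/andP=> vp /eqP xv; have vt : v \notin t.
  by apply: contraL (eqxx (0 : R)) => /(fintype.subsetP tx); rewrite inE xv.
by rewrite /push (negbTE vp) (negbTE vt) xv !mul0r subrr addr0.
Qed.

Let push_face (x : geom R K) : (if t \subset supp (bary ^~ x)
    then p |: supp (bary ^~ x) else supp (bary ^~ x)) \in faces K.
Proof. by case: ifP => [/(Kp (bary_faces x))|_] //; exact: bary_faces. Qed.

Let push_del (x : geom R K) : realization (del K t) (push (bary ^~ x)).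
Proof.
have m0 : 0 <= m (bary ^~ x) by apply: min_coord_ge0; exact: bary_ge0.
split.
- move=> v; rewrite /push addr_ge0 //; last by rewrite !mulr_ge0.
  rewrite subr_ge0; case vt : (v \in t); last by rewrite mul0r bary_ge0.
  by rewrite mul1r; exact: bigmin_le_cond.
- rewrite /push big_split /= sumrB bary_sum -!mulr_suml.
  rewrite -natr_sum (_ : (\sum_i (i \in t))%N = #|t|); last first.
    by rewrite -sum1_card [RHS]big_mkcond; apply: eq_bigr => i _; case: (i \in t).
  rewrite (bigD1 p) //= big1 ?addr0 ?eqxx; first by rewrite mul1r subrK.
  by move=> v /negbTE ->.
- rewrite in_del (faces_sub (push_supp x) (push_face x)) /=.
  apply/negP => /fintype.subsetP tp.
  have [v vt mv] := min_coord_attained (bary_le1 x) t0.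
  have := tp v vt; rewrite inE /push {1}/m mv vt mul1r subrr add0r.
  by rewrite (_ : v == p = false) ?mul0r ?eqxx //; apply: contraNF pt => /eqP <-.
Qed.

Let incl (x : geom R (del K t)) : realization K (bary ^~ x).
Proof.
split; [exact: bary_ge0|exact: bary_sum|].
by have := bary_faces x; rewrite in_del => /andP[].
Qed.

(** Pushing fixes the deletion pointwise, and a point and its image lie in a common face of [K] by
    [Kp]; hence the inclusion is a homotopy inverse of the push. *)
Lemma collapse_step : homotopy_equivalent R (geom R K) (geom R (del K t)).
Proof.
have cpush v : continuous (fun x : geom R K => push (bary ^~ x) v).
  have cm : continuous (fun x : geom R K => m (bary ^~ x)).
    by apply: bigmin_continuous => u; exact: bary_continuous.
  apply: addf_continuous.
    apply: subf_continuous; first exact: bary_continuous.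
    by apply: mulf_continuous; [exact: cst_continuous|exact: cm].
  apply: mulf_continuous; first exact: cst_continuous.
  by apply: mulf_continuous; [exact: cst_continuous|exact: cm].
have cf : continuous (fun x => geom_pt (push_del x)) by exact: geom_continuous.
have cg : continuous (fun x => geom_pt (incl x)).
  by apply: geom_continuous => v; exact: bary_continuous.
exists (fun x => geom_pt (push_del x)), (fun x => geom_pt (incl x)); split => //.
  apply: homotopic_contiguous; first exact: (comp_continuous cf cg).
    by move=> x; exact: cvg_id.
  move=> x; exists (if t \subset supp (bary ^~ x)
    then p |: supp (bary ^~ x) else supp (bary ^~ x)); first exact: push_face.
  split; first exact: push_supp.
  by case: ifP => // _; rewrite finset.subsetUr.
rewrite (_ : _ \o _ = idfun); first by apply: homotopic_refl => x; exact: cvg_id.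
apply/funext => x; apply: geom_inj => v; rewrite baryE push_id //.
apply: min_coord_eq0; first exact: bary_ge0.
by have := bary_faces x; rewrite in_del => /andP[].
Qed.

End Step.

(** The identity is contiguous to the constant map at [p]. The hypothesis on [finset.set0] excludes
    the void complex, whose realization is empty. *)
Lemma cone_contractible K (p : V) : finset.set0 \in faces K ->
  (forall A, A \in faces K -> p |: A \in faces K) -> contractible R (geom R K).
Proof.
move=> K0 Kp.
have HP : realization K (fun v => (v == p)%:R : R).
  split; first by move=> v; rewrite ler0n.
    by rewrite (bigD1 p) //= big1 ?addr0 ?eqxx // => v /negbTE ->.
  apply: faces_sub (Kp _ K0); apply/fintype.subsetP => v; rewrite !inE orbF.
  by case: (v == p); rewrite ?eqxx.
exists (fun=> tt), (fun=> geom_pt HP); split; try exact: cst_continuous; last first.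
  rewrite (_ : _ \o _ = idfun); last by apply/funext => -[].
  by apply: homotopic_refl => x; exact: cvg_id.
apply: homotopic_contiguous => [||x]; first exact: cst_continuous.
  by move=> x; exact: cvg_id.
exists (p |: supp (bary ^~ x)); first exact/Kp/bary_faces.
split; last exact: finset.subsetUr.
apply/fintype.subsetP => v; rewrite !inE baryE.
by case: (v == p); rewrite ?eqxx.
Qed.

End Collapse.

(** * Change of vertex labels *)

Section Relabel.
Variables (R : realType) (V W : finType) (f : V -> W) (K : scomplex V) (L : scomplex W).
Hypothesis f_inj : injective f.
Hypothesis fK : forall A, (A \in faces K) = (f @: A \in faces L)%SET.
Hypothesis fL : forall B, B \in faces L -> B \subset codom f.

Let pushf (x : V -> R) (w : W) : R := \sum_(v | f v == w) x v.

Let pushf_f x v : pushf x (f v) = x v.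
Proof.
rewrite /pushf (bigD1 v) //= big1 ?addr0 // => u /andP[/eqP /f_inj ->].
by rewrite eqxx.
Qed.

Let supp_pushf (x : V -> R) : supp (pushf x) = (f @: supp x)%SET.
Proof.
apply/setP => w; rewrite inE; apply/idP/imsetP => [|[v]]; last first.
  by rewrite inE => xv ->; rewrite pushf_f.
have [[v <-]|wf] := pselect (exists v, f v = w).
  by rewrite pushf_f => xv; exists v; rewrite ?inE.
rewrite /pushf big_pred0 ?eqxx // => v; apply/negP => /eqP fv.
by apply: wf; exists v.
Qed.

Let push_real (x : geom R K) : realization L (pushf (bary ^~ x)).
Proof.
split.
- by move=> w; apply: sumr_ge0 => v _; exact: bary_ge0.
- rewrite /pushf (exchange_big_dep xpredT) //= -[RHS](bary_sum x).
  by apply: eq_bigr => v _; rewrite (big_pred1 (f v)) // => w; rewrite eq_sym.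
- by have := bary_faces x; rewrite fK -supp_pushf.
Qed.

Let pull_supp (y : geom R L) :
  supp (bary ^~ y) = (f @: supp (fun v => bary (f v) y))%SET.
Proof.
apply/setP => w; rewrite inE; apply/idP/imsetP => [|[v]]; last by rewrite inE => ? ->.
move=> yw; have := fintype.subsetP (fL (bary_faces y)) w.
by rewrite inE => /(_ yw)/codomP[v wv]; exists v; rewrite ?inE -?wv.
Qed.

Let pull_real (y : geom R L) : realization K (fun v => bary (f v) y).
Proof.
split.
- by move=> w; exact: bary_ge0.
- rewrite -[RHS](bary_sum y) [RHS](bigID (fun w => w \in (f @: [set: V])%SET)) /=.
  rewrite [X in _ + X]big1 ?addr0; last first.
    move=> w; apply: contraNeq => yw.
    have := fintype.subsetP (fL (bary_faces y)) w; rewrite inE => /(_ yw).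
    by move=> /codomP[v ->]; apply: imset_f; rewrite inE.
  rewrite big_imset /=; last by move=> u v _ _; exact: f_inj.
  by apply: eq_bigl => v; rewrite inE.
- by rewrite fK -pull_supp bary_faces.
Qed.

(** The type [W] may have elements that occur in no face of [L], such as the sets of vertices that
    are not edges in the case of [PM]; pushing masses forward along [f] is nevertheless a
    homeomorphism, because every face lies in the image. *)
Lemma relabel_equivalent : homotopy_equivalent R (geom R K) (geom R L).
Proof.
exists (fun x => geom_pt (push_real x)), (fun y => geom_pt (pull_real y)); split.
- by apply: geom_continuous => w; apply: sum_continuous => v; exact: bary_continuous.
- by apply: geom_continuous => v; exact: bary_continuous.
- rewrite (_ : _ \o _ = idfun); first by apply: homotopic_refl => x; exact: cvg_id.
  by apply/funext => x; apply: geom_inj => v; rewrite !baryE pushf_f.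
- rewrite (_ : _ \o _ = idfun); first by apply: homotopic_refl => x; exact: cvg_id.
  apply/funext => y; apply: geom_inj => w; rewrite !baryE /=.
  have [wf|wf] := boolP (w \in codom f).
    by have /codomP[v ->] := wf; rewrite pushf_f.
  rewrite /pushf big_pred0.
    apply/esym/eqP; apply: contraNT wf => yw.
    by apply: (fintype.subsetP (fL (bary_faces y))); rewrite inE.
  by move=> v; apply: contraNF wf => /eqP <-; exact: codom_f.
Qed.

End Relabel.

(** * Quotients by contractible subcomplexes *)

Section Quotient.
Variable R : realType.

(** A continuous map from a compact set to a Hausdorff space is closed, so the image of [A] carries
    the quotient topology. *)
Lemma compact_quotient_continuous (X Y Z : topologicalType) (A : set X)
    (q : X -> Y) (h : Y -> Z) : compact A -> hausdorff_space Y ->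
  continuous q -> continuous (h \o q) -> {within q @` A, continuous h}.
Proof.
move=> cA hY cq chq; apply/continuousP => U oU.
apply/open_subspaceP.
exists (~` (q @` (A `&` ~` ((h \o q) @^-1` U)))).
  apply: closed_openC; apply: (compact_closed hY).
  apply: continuous_compact; first exact: continuous_subspaceT.
  apply: compact_closedI => //; apply: open_closedC.
  by apply: open_comp => // x _; exact: chq.
apply/seteqP; split => y [].
  move=> nUy [x Ax qx]; rewrite -qx in nUy *; split; last by exists x.
  by apply: contrapT => nU; apply: nUy; exists x; split.
move=> Uy [x Ax qx]; split; last by exists x.
by case=> x' [Ax' /=] + qx'; rewrite /= qx'.
Qed.

Lemma injective_hausdorff (X Y : topologicalType) (f : X -> Y) :
  continuous f -> injective f -> hausdorff_space Y -> hausdorff_space X.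
Proof.
move=> cf fi hY p q cl; apply/fi/hY => A B /cf pA /cf qB.
by have [x [Ax Bx]] := cl _ _ pA qB; exists (f x).
Qed.

Lemma hausdorff_prod (X Y : topologicalType) :
  hausdorff_space X -> hausdorff_space Y -> hausdorff_space (X * Y)%type.
Proof.
move=> hX hY [p1 p2] [q1 q2] cl; congr (_, _).
- apply: hX => A B pA qB.
  have [x [Ax Bx]] := cl _ _ (@fst_continuous X Y (p1, p2) _ pA)
    (@fst_continuous X Y (q1, q2) _ qB).
  by exists x.1.
- apply: hY => A B pA qB.
  have [x [Ax Bx]] := cl _ _ (@snd_continuous X Y (p1, p2) _ pA)
    (@snd_continuous X Y (q1, q2) _ qB).
  by exists x.2.
Qed.

(** The argument by which collapsing a contractible subspace with the homotopy extension property
    preserves the homotopy type: [G] extends a contraction of the subspace, its end map factors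
    through [q] and gives the inverse, and [q] after [G] descends to a homotopy on [Y]. *)
Lemma collapse_contractible_equivalent (X Y : topologicalType) (q : X -> Y) (G : R * X -> X) :
  compact [set: X] -> hausdorff_space Y -> continuous q ->
  (forall y, exists x, q x = y) -> continuous G -> (forall x, G (0, x) = x) ->
  (forall t x x', 0 <= t <= 1 -> q x = q x' -> q (G (t, x)) = q (G (t, x'))) ->
  (forall x x', q x = q x' -> G (1, x) = G (1, x')) ->
  homotopy_equivalent R X Y.
Proof.
move=> cX hY cq /choice[s qs] cG G0 qG G1.
have cG1 : continuous (fun x => G (1, x)).
  apply: (comp_continuous _ cG).
  by apply: pair_continuous; [exact: cst_continuous|move=> x; exact: cvg_id].
pose g y := G (1, s y).
have gq x : g (q x) = G (1, x) by apply: G1; rewrite qs.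
have cg : continuous g.
  apply/continuous_subspace_setT.
  rewrite (_ : setT = q @` setT); last first.
    by apply/esym; rewrite -subTset => y _; exists (s y).
  apply: compact_quotient_continuous => //.
  by rewrite (_ : g \o q = (fun x => G (1, x))) //; apply/funext.
exists q, g; split => //.
  apply: (@homotopic_sym R); exists G; split => //.
    exact: continuous_subspaceT.
  by move=> x; rewrite -gq.
apply: (@homotopic_sym R).
exists (fun p => q (G (clamp p.1, s p.2))); split; last 2 first.
- by move=> y; rewrite /= clamp0 G0 qs.
- by move=> y; rewrite /= clamp1.
(* Continuity on the cylinder over [Y] is again a matter of quotients: [Q] is defined on a compact
   set once time is restricted to the unit interval. *)
pose Q (p : R * X) := (p.1, q p.2).
rewrite (_ : _ `*` _ = Q @` (`[0, 1]%classic `*` setT)); last first.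
  apply/seteqP; split => [[t y] [/= t01 _]|_ [[t x] [/= t01 _] <-]] //.
  by exists (t, s y) => //; rewrite /Q /= qs.
apply: compact_quotient_continuous.
- by apply: compact_setX => //; exact: segment_compact.
- by apply: hausdorff_prod => //; exact: Rhausdorff.
- apply: pair_continuous; first exact: fst_continuous.
  exact: (comp_continuous (@snd_continuous _ _) cq).
rewrite (_ : _ \o Q = q \o (fun p => G (clamp p.1, p.2))).
  apply: (comp_continuous _ cq); apply: (comp_continuous _ cG).
  apply: pair_continuous; last exact: snd_continuous.
  exact: (comp_continuous (@fst_continuous _ _) (@clamp_continuous R)).
by apply/funext => -[t x] /=; apply: qG; rewrite ?qs ?clamp_itv.
Qed.

Lemma compact_geom (V : finType) (K : scomplex V) : compact [set: geom R K].
Proof.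
have cA : @compact {ptws V -> R} (@realization R V K).
  apply: (@subclosed_compact {ptws V -> R} _ [set f : {ptws V -> R} |
      forall v, `[0 : R, 1]%classic (f v)]); last 2 first.
  - exact: (@tychonoff V (fun=> R) (fun=> `[0 : R, 1]%classic) (fun=> @segment_compact _ _ _)).
  - move=> x Kx v /=; rewrite in_itv /=.
    exact/andP/(conj (bary_ge0 (geom_pt Kx) v) (bary_le1 (geom_pt Kx) v)).
  (* The condition that the support be a face is not visibly closed; vanishing off a fixed face [A]
     is, and there are finitely many faces. *)
  pose P (f : {ptws V -> R}) (A : {set V}) :=
    [/\ forall v, 0 <= f v, \sum_v f v = 1 & forall v, v \notin A -> f v = 0].
  rewrite (_ : realization K = \bigcup_(A in [set` faces K]) [set f | P f A]).
    apply: closed_bigcup => // A _.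
    rewrite (_ : [set f | P f A] = (\bigcap_v [set f | 0 <= f v]) `&`
       [set f | \sum_v f v = 1] `&` \bigcap_(v in [set v | v \notin A]) [set f | f v = 0]).
      have cl (h : {ptws V -> R} -> R) (C : set R) :
          continuous h -> closed C -> closed (h @^-1` C).
        by move=> ch cC; apply: preimage_closed => // x _; exact: ch.
      apply: closedI; first apply: closedI.
      - apply: closed_bigI => v _.
        apply: (cl (fun f => f v) [set r | 0 <= r]); last exact: closed_ge.
        exact: ptws_coord_continuous.
      - apply: (cl (fun f => \sum_v f v) [set r | r = 1]); last exact: closed_eq.
        by apply: sum_continuous => v; exact: ptws_coord_continuous.
      - apply: closed_bigI => v _.
        apply: (cl (fun f => f v) [set r | r = 0]); last exact: closed_eq.
        exact: ptws_coord_continuous.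
    apply/seteqP; split => f.
      by case=> f0 f1 fA; split => //; split => // v _; exact: f0.
    by case=> -[f0 f1] fA; split => [v||v]; [exact: f0|exact: f1|exact: fA].
  apply/seteqP; split => [f [f0 f1 fK]|f [A KA [f0 f1 fA]]].
    exists (supp f) => //; split => // v; rewrite inE negbK; exact: eqP.
  split => //; apply: faces_sub KA; apply/fintype.subsetP => v.
  by rewrite inE; apply: contraR => /fA ->.
move=> F FF _; pose F' := set_val @ F.
have FK : F' (realization K).
  by apply: (@filterS _ F _ setT); [move=> x _; exact: set_valP|exact: filterT].
have [p [Kp clp]] := cA F' _ FK.
exists (geom_pt Kp); split => // A B FA [_ [[W oW <-] Wp] sWB].
have [|_ [[x Ax <-] Wx]] := clp (set_val @` A) W _ (open_nbhs_nbhs (conj oW Wp)).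
  by apply: (@filterS _ F _ A _ _ FA) => x Ax; exists x.
by exists x; split => //; exact: sWB.
Qed.

End Quotient.

(** * Bouquets of spheres *)

Section Height.
Variables (R : realType) (V : finType).
Implicit Types (x : V -> R) (s : {set V}).

(** For nonempty [s], normalized to be 1 at the barycentre of [s] and 0 on the boundary. In the
    simplex [s], a point of height [h] is [h] times the barycentre plus [1 - h] times a boundary
    point. *)
Definition height s x : R := #|s|%:R * \big[Num.min/1]_(v in s) x v.

Lemma height_ge0 s x : (forall v, 0 <= x v) -> 0 <= height s x.
Proof. by move=> x0; rewrite mulr_ge0 // min_coord_ge0. Qed.

Lemma height_eq0 s x : (forall v, 0 <= x v) -> ~~ (s \subset supp x) ->
  height s x = 0.
Proof. by move=> x0 /(min_coord_eq0 x0) sx; rewrite /height sx mulr0. Qed.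

Lemma height_le s x v : v \in s -> height s x <= #|s|%:R * x v.
Proof. by move=> vs; rewrite ler_wpM2l // bigmin_le_cond. Qed.

Lemma height_attained s x : (forall v, x v <= 1) -> s != finset.set0 ->
  exists2 v, v \in s & height s x = #|s|%:R * x v.
Proof.
by move=> x1 /(min_coord_attained x1)[v vs xv]; exists v => //; rewrite /height xv.
Qed.

Lemma height_gt0 s x : (forall v, 0 <= x v) -> (forall v, x v <= 1) ->
  s != finset.set0 -> (0 < height s x) = (s \subset supp x).
Proof.
move=> x0 x1 s0; apply/idP/idP => [|/fintype.subsetP sx].
  by apply: contraTT => /(height_eq0 x0) ->; rewrite ltxx.
have [v vs ->] := height_attained x1 s0.
rewrite mulr_gt0 ?ltr0n ?card_gt0 // lt_neqAle x0 eq_sym andbT.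
by have := sx v vs; rewrite inE.
Qed.

Lemma height_le_sum s x : height s x <= \sum_(v in s) x v.
Proof.
rewrite /height mulr_natl -sumr_const; apply: ler_sum => v vs.
exact: bigmin_le_cond.
Qed.

Lemma height_continuous s (K : scomplex V) :
  continuous (fun x : geom R K => height s (bary ^~ x)).
Proof.
apply: mulf_continuous; first exact: cst_continuous.
by apply: bigmin_continuous => v; exact: bary_continuous.
Qed.

End Height.

(** * Spherical coordinates on a single cell *)

Section Cell.
Variables (R : realType) (V : finType) (s : {set V}) (d : nat).
Hypothesis sd : #|s| = d.+1.
Implicit Types (x : V -> R).

Definition cell_vertex (j : 'I_d.+1) : V := enum_val (cast_ord (esym sd) j).

Lemma cell_vertex_in j : cell_vertex j \in s.
Proof. exact: enum_valP. Qed.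

Lemma cell_vertex_inj : injective cell_vertex.
Proof. by move=> i j /enum_val_inj /cast_ord_inj. Qed.

Lemma cell_vertexP v : v \in s -> exists j, v = cell_vertex j.
Proof.
move=> vs; exists (cast_ord sd (enum_rank_in vs v)).
by rewrite /cell_vertex cast_ordK enum_rankK_in.
Qed.

Lemma sum_cell_vertex x : \sum_(v in s) x v = \sum_j x (cell_vertex j).
Proof.
rewrite big_enum_val (reindex (cast_ord (esym sd))) //=.
by exists (cast_ord sd) => i _; rewrite ?cast_ordK ?cast_ordKV.
Qed.

Let s_neq0 : s != finset.set0.
Proof. by rewrite -card_gt0 sd. Qed.

(* [x] is sent to the inverse stereographic projection of
   [(x (cell_vertex j) - x (cell_vertex 0))_j / height s x];
   the mass [1 - \sum_(v in s) x v] outside [s] only serves to keep the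
   denominator positive off the simplex, where the height vanishes. *)
Definition cell_offset x (j : 'I_d.+1) : R := x (cell_vertex j) - x (cell_vertex 0).

Definition cell_denom x : R :=
  \sum_j cell_offset x j ^+ 2 + (1 - \sum_(v in s) x v) + height s x ^+ 2.

Definition cell_row x : 'rV[R]_d.+1 := \row_j
  ((if j == 0 then \sum_j cell_offset x j ^+ 2 + (1 - \sum_(v in s) x v) - height s x ^+ 2
    else (height s x * cell_offset x j) *+ 2) / cell_denom x).

Lemma cell_offset0 x : cell_offset x 0 = 0.
Proof. by rewrite /cell_offset subrr. Qed.

(** Points of a realization in which [s] is a maximal face: wherever the height is positive, all the
    mass sits on [s]. *)
Definition cell_domain x := [/\ forall v, 0 <= x v, \sum_v x v = 1
  & height s x = 0 \/ \sum_(v in s) x v = 1].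

Lemma cell_domain_le1 x : cell_domain x -> forall v, x v <= 1.
Proof.
case=> x0 x1 _ v; rewrite -x1 (bigD1 v) //= lerDl sumr_ge0 //.
Qed.

Lemma cell_domain_outside x : cell_domain x -> 0 <= 1 - \sum_(v in s) x v.
Proof.
case=> x0 x1 _; rewrite subr_ge0 -x1 [leRHS](bigID (mem s)) /= lerDl.
exact: sumr_ge0.
Qed.

(** If the three nonnegative terms vanish, [x] is constant on [s] and of height 0, hence zero on
    [s], whereas the middle term forces total mass 1 on [s]. *)
Lemma cell_denom_gt0 x : cell_domain x -> 0 < cell_denom x.
Proof.
move=> dx; have [x0 x1 _] := dx; have c0 := cell_domain_outside dx.
have P0 : 0 <= \sum_j cell_offset x j ^+ 2 by apply: sumr_ge0 => j _; exact: sqr_ge0.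
have h0 : 0 <= height s x ^+ 2 by exact: sqr_ge0.
have den_ge0 : 0 <= cell_denom x := addr_ge0 (addr_ge0 P0 c0) h0.
rewrite lt_neqAle den_ge0 andbT; apply/eqP => /esym den0.
have Pz : \sum_j cell_offset x j ^+ 2 = 0.
  by apply/eqP; rewrite eq_le P0 andbT; move: den0; rewrite /cell_denom; lra.
have cz : \sum_(v in s) x v = 1 by move: den0; rewrite /cell_denom; lra.
have hz : height s x = 0.
  by apply/eqP; rewrite -sqrf_eq0; apply/eqP; move: den0; rewrite /cell_denom; lra.
have xv j : x (cell_vertex j) = x (cell_vertex 0).
  apply/eqP; rewrite -subr_eq0 -sqrf_eq0; apply/eqP.
  by apply: (psumr_eq0P _ Pz) => // i _; exact: sqr_ge0.
have [v /cell_vertexP[j ->]] := height_attained (cell_domain_le1 dx) s_neq0.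
rewrite hz xv => /esym /eqP; rewrite mulf_eq0 pnatr_eq0 sd /= => /eqP v0.
move: cz; rewrite sum_cell_vertex big1 => [/esym/eqP|i _]; last by rewrite xv.
by rewrite oner_eq0.
Qed.

Lemma cell_row_sphere x : cell_domain x -> @unit_sphere R d (cell_row x).
Proof.
move=> dx; have den := cell_denom_gt0 dx; rewrite /unit_sphere /=.
rewrite big_ord_recl /= mxE eqxx.
have -> : \sum_(i < d) cell_row x 0 (lift ord0 i) ^+ 2 =
    4 * height s x ^+ 2 * (\sum_j cell_offset x j ^+ 2) / cell_denom x ^+ 2.
  rewrite big_ord_recl cell_offset0 expr0n add0r mulr_sumr mulr_suml.
  apply: eq_bigr => i _; rewrite mxE /= -mulr_natl; field.
  by rewrite gt_eqF.
rewrite expr_div_n -mulrDl.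
rewrite [X in X / _ = _](_ : _ = cell_denom x ^+ 2) ?divff ?expf_neq0 ?gt_eqF //.
(* The two sides differ by a multiple of [height s x ^+ 2] times the mass outside [s], and the
   domain condition makes one of these factors zero. *)
by rewrite /cell_denom; have [_ _ [->|->]] := dx; ring.
Qed.

Lemma cell_row_base x : cell_domain x -> height s x = 0 ->
  cell_row x = delta_mx 0 0.
Proof.
move=> dx hz; have den := cell_denom_gt0 dx; apply/rowP => j; rewrite !mxE eqxx /=.
case: (j == 0); last by rewrite hz mul0r mul0rn mul0r.
by rewrite /cell_denom hz expr0n subr0 addr0 divff //;
  move: den; rewrite /cell_denom hz expr0n addr0 => /lt0r_neq0.
Qed.

Lemma cell_row_first x : cell_domain x ->
  1 - cell_row x 0 0 = (height s x ^+ 2) *+ 2 / cell_denom x.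
Proof.
move=> dx; have den := cell_denom_gt0 dx; rewrite mxE eqxx.
rewrite -[X in X - _](divff (lt0r_neq0 den)) -mulrBl; congr (_ / _).
by rewrite {1}/cell_denom mulr2n; ring.
Qed.

Lemma cell_row_neq_base x : cell_domain x -> 0 < height s x ->
  cell_row x <> delta_mx 0 0.
Proof.
move=> dx h0 /(congr1 (fun A : 'rV_d.+1 => 1 - A 0 0)).
rewrite cell_row_first // mxE !eqxx subrr => /eqP; rewrite gt_eqF //.
by rewrite divr_gt0 ?cell_denom_gt0 // pmulrn_lgt0 // exprn_gt0.
Qed.

(** These are the stereographic coordinates of [cell_row x] seen from the base point. *)
Lemma cell_row_ratio x j : cell_domain x -> 0 < height s x -> j != 0 ->
  cell_row x 0 j / (1 - cell_row x 0 0) = cell_offset x j / height s x.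
Proof.
move=> dx h0 j0; rewrite cell_row_first // mxE (negbTE j0).
have den := cell_denom_gt0 dx; rewrite !mulr2n; field.
apply/and3P; split; apply: lt0r_neq0 => //; exact: addr_gt0 (exprn_gt0 2 h0) (exprn_gt0 2 h0).
Qed.

(** Equal stereographic coordinates say that [x / height] and [y / height] differ by a constant [e]
    on [s]. Both have minimum [1 / #|s|], so [e = 0]; the sums over [s], which are the inverse
    heights, then agree as well. *)
Lemma cell_row_inj x y : cell_domain x -> cell_domain y ->
  0 < height s x -> 0 < height s y ->
  cell_row x = cell_row y -> {in s, x =1 y}.
Proof.
move=> dx dy hx hy xy.
have w j : cell_offset x j / height s x = cell_offset y j / height s y.
  have [->|j0] := eqVneq j 0; first by rewrite !cell_offset0 !mul0r.
  by rewrite -!cell_row_ratio // xy.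
pose e := x (cell_vertex 0) / height s x - y (cell_vertex 0) / height s y.
have xe j : x (cell_vertex j) / height s x = y (cell_vertex j) / height s y + e.
  by have := w j; rewrite /cell_offset !mulrBl /e; lra.
have bound z v : cell_domain z -> 0 < height s z -> v \in s ->
    #|s|%:R^-1 <= z v / height s z.
  move=> dz hz vs; rewrite ler_pdivlMr // ler_pdivrMl ?height_le //.
  by rewrite ltr0n sd.
have attained z : cell_domain z -> 0 < height s z ->
    exists j, z (cell_vertex j) / height s z = #|s|%:R^-1.
  move=> dz hz.
  have [v /cell_vertexP[j ->] hv] := height_attained (cell_domain_le1 dz) s_neq0.
  exists j; rewrite hv; field; rewrite sd pnatr_eq0 /=.
  by move: hz; rewrite hv; apply: contraTneq => ->; rewrite mulr0 ltxx.
have e0 : e = 0.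
  apply/eqP; rewrite eq_le; apply/andP; split.
    have [j jx] := attained x dx hx.
    have := bound y _ dy hy (cell_vertex_in j); have := xe j; lra.
  have [j jy] := attained y dy hy.
  have := bound x _ dx hx (cell_vertex_in j); have := xe j; lra.
have sum1 z : cell_domain z -> 0 < height s z ->
    \sum_j z (cell_vertex j) / height s z = (height s z)^-1.
  case=> _ _ [->|sz] hz; first by rewrite ltxx in hz.
  by rewrite -mulr_suml -sum_cell_vertex sz mul1r.
have hh : height s x = height s y.
  apply: invr_inj; rewrite -(sum1 x) // -(sum1 y) //; apply: eq_bigr => j _.
  by rewrite xe e0 addr0.
move=> v /cell_vertexP[j ->]; have := xe j; rewrite e0 addr0 hh.
by move/(mulIf (invr_neq0 (lt0r_neq0 hy))).
Qed.

(** The stereographic coordinates of [a] determine the offsets up to scale; shifting fixes the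
    minimum and dividing by the total fixes the scale. *)
Lemma cell_row_surj (a : 'rV[R]_d.+1) : @unit_sphere R d a -> a <> delta_mx 0 0 ->
  exists x, [/\ cell_domain x, supp x = s, 0 < height s x & cell_row x = a].
Proof.
rewrite /unit_sphere /= => a1 aNbase.
have tail : \sum_(j < d) a 0 (lift ord0 j) ^+ 2 = 1 - a 0 0 ^+ 2.
  by rewrite -a1 big_ord_recl /=; ring.
have tail0 : 0 <= \sum_(j < d) a 0 (lift ord0 j) ^+ 2.
  by apply: sumr_ge0 => j _; exact: sqr_ge0.
have a01 : a 0 0 < 1.
  rewrite lt_neqAle; apply/andP; split; last first.
    rewrite leNgt; apply/negP => a0; move: tail0; rewrite tail.
    by rewrite leNgt subr_lt0 exprn_egt1 ?(ltW a0) // => /negP.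
  apply/eqP => a0; apply: aNbase; apply/rowP => j; rewrite mxE eqxx /=.
  case: (unliftP ord0 j) => [i ->|->]; last by rewrite eqxx a0.
  move: tail; rewrite a0 expr1n subrr => tz.
  have /eqP : a 0 (lift ord0 i) ^+ 2 = 0.
    by apply: (psumr_eq0P _ tz) => // k _; exact: sqr_ge0.
  by rewrite sqrf_eq0 => /eqP ->.
have b0 : 0 < 1 - a 0 0 by rewrite subr_gt0.
pose w (j : 'I_d.+1) : R := if j == 0 then 0 else a 0 j / (1 - a 0 0).
pose k := \big[Num.min/0]_j w j.
have kw j : k <= w j by exact: bigmin_le_cond.
(* The default [0] of the minimum is a genuine value, namely [w 0]. *)
have [j0 wj0] : exists j, w j = k.
  have w0 : w 0 = 0 by rewrite /w eqxx.
  rewrite /k; elim/big_ind: _ => [|u v [i ui] [j vj]|j _]; first by exists 0.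
    by case: (leP u v) => _; [exists i|exists j].
  by exists j.
(* The shift makes the least value [1 / #|s|], so that [rho] has height 1 before normalization by
   [T], and height [1 / T] after it. *)
pose rho j : R := w j - k + d.+1%:R^-1.
have rho_gt0 j : 0 < rho j by rewrite ltr_wpDl ?invr_gt0 ?ltr0n // subr_ge0.
pose T := \sum_j rho j.
have T0 : 0 < T.
  rewrite /T (bigD1 0) //= ltr_wpDr //; apply: sumr_ge0 => j _; exact: ltW.
pose x (v : V) : R := \sum_(j | cell_vertex j == v) rho j / T.
have xE j : x (cell_vertex j) = rho j / T.
  rewrite /x (big_pred1 j) // => i; exact: (inj_eq cell_vertex_inj).
have xout v : v \notin s -> x v = 0.
  move=> vs; rewrite /x big_pred0 // => j; apply: contraNF vs => /eqP <-.
  exact: cell_vertex_in.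
have x_ge0 v : 0 <= x v by apply: sumr_ge0 => j _; rewrite ltW // divr_gt0.
have xs : \sum_(v in s) x v = 1.
  rewrite sum_cell_vertex; under eq_bigr do rewrite xE.
  by rewrite -mulr_suml divff ?gt_eqF.
have x1 : \sum_v x v = 1.
  rewrite (bigID (mem s)) /= xs big1 ?addr0 // => v; exact: xout.
have dx : cell_domain x by split => //; right.
have sx : supp x = s.
  apply/setP => v; rewrite inE; have [/cell_vertexP[j ->]|/xout ->] := boolP (v \in s).
    by rewrite xE lt0r_neq0 // divr_gt0.
  by rewrite eqxx.
have hx : height s x = T^-1.
  apply/eqP; rewrite eq_le; apply/andP; split.
    apply: le_trans (height_le x (cell_vertex_in j0)) _.
    rewrite xE /rho wj0 subrr add0r sd mulrA divff ?mul1r //.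
    by rewrite pnatr_eq0.
  have [v /cell_vertexP[j ->] ->] := height_attained (cell_domain_le1 dx) s_neq0.
  rewrite xE mulrA ler_peMl ?invr_ge0 ?(ltW T0) // sd /rho mulrDr divff ?pnatr_eq0 //.
  by rewrite lerDr mulr_ge0 // subr_ge0.
exists x; split => //; first by rewrite hx invr_gt0.
have off j : cell_offset x j = w j / T.
  by rewrite /cell_offset !xE -mulrBl /rho {2}/w eqxx; congr (_ / _); ring.
have sumw : \sum_j w j ^+ 2 = (1 + a 0 0) / (1 - a 0 0).
  rewrite big_ord_recl {1}/w eqxx expr0n add0r.
  under eq_bigr do rewrite /w /= expr_div_n.
  rewrite -mulr_suml tail; field; exact: lt0r_neq0.
have sumoff : \sum_j cell_offset x j ^+ 2 = (1 + a 0 0) / (1 - a 0 0) / T ^+ 2.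
  under eq_bigr do rewrite off expr_div_n.
  by rewrite -mulr_suml sumw.
have den : cell_denom x = 2 / (1 - a 0 0) / T ^+ 2.
  rewrite /cell_denom sumoff xs hx; field.
  by rewrite !lt0r_neq0.
apply/rowP => j; rewrite mxE den sumoff xs hx off /w.
have [->|j_neq0] := eqVneq j 0.
  by field; rewrite !lt0r_neq0.
by rewrite mulr2n; field; rewrite !lt0r_neq0.
Qed.

End Cell.

Lemma matrix_continuous (R : realType) (X : topologicalType) (m n : nat)
    (f : X -> 'M[R]_(m, n)) :
  (forall i j, continuous (fun x => f x i j)) -> continuous f.
Proof.
move=> cf x A [P fxP sPA].
have : \forall y \near x, forall i j, P i j (f y i j).
  by apply: filter_forall => i; apply: filter_forall => j; exact: (cf i j x _ (fxP i j)).
by apply: filterS => y Py; exact: sPA.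
Qed.

Lemma sqrf_continuous (R : realType) (X : topologicalType) (f : X -> R) :
  continuous f -> continuous (fun x => f x ^+ 2).
Proof. by move=> cf; under eq_fun do rewrite expr2; exact: mulf_continuous. Qed.

(** * Collapsing the complement of the open critical cells *)

Section Bouquet.
Variables (R : realType) (V : finType) (K D : scomplex V) (ss : seq {set V}).
Hypothesis ss_uniq : uniq ss.
Hypothesis ss_faces : forall s, s \in ss -> s \in faces K.
Hypothesis ss_max : forall s A, s \in ss -> A \in faces K -> s \subset A -> A = s.
Hypothesis ss_neq0 : forall s, s \in ss -> s != finset.set0.
Hypothesis D_faces : forall A, (A \in faces D) = (A \in faces K) && (A \notin ss).
Hypothesis D_contr : contractible R (geom R D).

Let ht s (x : geom R K) : R := height s (bary ^~ x).

Let ht_ge0 s x : 0 <= ht s x.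
Proof. exact/height_ge0/bary_ge0. Qed.

Let ht_supp s x : s \in ss -> ht s x != 0 -> supp (bary ^~ x) = s.
Proof.
move=> sss hx; apply: (ss_max sss (bary_faces x)); apply: contraR hx => ns.
by rewrite /ht height_eq0 //; exact: bary_ge0.
Qed.

Let ht_supp_neq0 s x : s \in ss -> supp (bary ^~ x) = s -> 0 < ht s x.
Proof.
move=> sss sx; rewrite /ht height_gt0 ?sx ?ss_neq0 //.
- exact: bary_ge0.
- exact: bary_le1.
Qed.

Let ht_le1 s x : ht s x <= 1.
Proof.
apply: le_trans (height_le_sum _ _) _; rewrite -[leRHS](bary_sum x).
rewrite [leRHS](bigID (mem s)) /= lerDl; apply: sumr_ge0 => v _; exact: bary_ge0.
Qed.

Let ht_unique s s' x : s \in ss -> s' \in ss -> ht s x != 0 -> s' != s -> ht s' x = 0.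
Proof.
move=> sss ss' hx; apply: contraNeq => /(ht_supp ss') <-.
by rewrite (ht_supp sss hx).
Qed.

Let ht_continuous s : continuous (ht s).
Proof. exact: height_continuous. Qed.

(** The cells of [ss] have disjoint interiors, so at most one term is nonzero, and [M] vanishes
    exactly on [D]. *)
Let M x : R := \sum_(s <- ss) ht s x.

Let M_continuous : continuous M.
Proof. by apply: sum_continuous => s; exact: ht_continuous. Qed.

Variant M_spec x : R -> Prop :=
| M_zero of (forall s, s \in ss -> ht s x = 0) : M_spec x 0
| M_pos s of s \in ss & supp (bary ^~ x) = s & 0 < ht s x
   & (forall s', s' \in ss -> s' != s -> ht s' x = 0) : M_spec x (ht s x).

Let MP x : M_spec x (M x).
Proof.
have [/hasP[s sss hx]|/hasPn h0] := boolP (has (fun s => ht s x != 0) ss).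
  have hu s' : s' \in ss -> s' != s -> ht s' x = 0.
    by move=> ss'; exact: ht_unique sss ss' hx.
  rewrite /M (bigD1_seq s) //= big_seq_cond big1 ?addr0.
    by apply: M_pos => //; [exact: ht_supp|rewrite lt_neqAle eq_sym hx ht_ge0].
  by move=> s' /andP[]; exact: hu.
have hz s : s \in ss -> ht s x = 0 by move/h0; rewrite negbK => /eqP.
by rewrite /M big_seq big1 //; apply: M_zero.
Qed.

Let M_ge0 x : 0 <= M x.
Proof. by apply: sumr_ge0 => s _; exact: ht_ge0. Qed.

(* [shrink (t, _)] pushes radially, away from the barycentres of the cells of
   [ss], all points of height at most [t / 2] into [D]. *)
Let cut (t : R) : R := clamp t / 2.

Let cut_itv t : 0 <= cut t <= 2^-1.
Proof. by have := clamp_itv t; rewrite /cut; lra. Qed.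

Let shrink (p : R * geom R K) (v : V) : R :=
  (bary v p.2 - \sum_(s <- ss) Num.min (ht s p.2) (cut p.1) * ((v \in s)%:R / #|s|%:R))
  / (1 - Num.min (M p.2) (cut p.1)).

(** This is why [cut] stops at one half: at a barycentre [M] equals 1 and the radial direction is
    undefined. *)
Let denom_gt0 t x : 0 < 1 - Num.min (M x) (cut t).
Proof. by rewrite subr_gt0 gt_min; have := cut_itv t; lra. Qed.

Let shrink_zero t x v : (forall s, s \in ss -> ht s x = 0) -> shrink (t, x) v = bary v x.
Proof.
move=> hz; rewrite /shrink /=.
have -> : M x = 0 by rewrite /M big_seq big1.
have /andP[c0 _] := cut_itv t; rewrite (min_idPl c0) subr0 divr1 big_seq big1 ?subr0 //.
by move=> s /hz ->; rewrite (min_idPl c0) mul0r.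
Qed.

Let shrink_pos t x v s : s \in ss -> M x = ht s x ->
  (forall s', s' \in ss -> s' != s -> ht s' x = 0) ->
  shrink (t, x) v = (bary v x - Num.min (ht s x) (cut t) * ((v \in s)%:R / #|s|%:R))
    / (1 - Num.min (ht s x) (cut t)).
Proof.
move=> sss Mx hu; rewrite /shrink /= Mx (bigD1_seq s) //= big_seq_cond big1 ?addr0 //.
move=> s' /andP[ss' s's]; have /andP[c0 _] := cut_itv t.
by rewrite hu // (min_idPl c0) mul0r.
Qed.

Let shrink_supp t x : supp (shrink (t, x)) \subset supp (bary ^~ x).
Proof.
have := erefl (M x); rewrite {2}/M -/(M x); case: {2}_ / (MP x) => [hz|s sss sx h0 hu] Mx.
  by apply/fintype.subsetP => v; rewrite !inE shrink_zero.
apply/fintype.subsetP => v; rewrite !inE (shrink_pos _ _ sss Mx hu).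
apply: contraNneq => xv; have -> : v \in s = false.
  by rewrite -sx inE xv eqxx.
by rewrite xv !mul0r mulr0 subrr mul0r.
Qed.

Let M_case x : ((forall s, s \in ss -> ht s x = 0) /\ M x = 0) \/
  exists s, [/\ s \in ss, supp (bary ^~ x) = s, 0 < ht s x,
    forall s', s' \in ss -> s' != s -> ht s' x = 0 & M x = ht s x].
Proof.
have := erefl (M x); rewrite {2}/M -/(M x); case: {2}_ / (MP x) => [hz|s sss sx h0 hu] Mx.
  by left.
by right; exists s.
Qed.

Let shrink_real p : realization K (shrink p).
Proof.
case: p => t x; split; last by exact: faces_sub (shrink_supp t x) (bary_faces x).
  move=> v; have [[hz _]|[s [sss sx h0 hu Mx]]] := M_case x.
    by rewrite shrink_zero // bary_ge0.
  rewrite (shrink_pos _ _ sss Mx hu); apply: divr_ge0; last first.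
    by have := denom_gt0 t x; rewrite Mx => /ltW.
  rewrite subr_ge0; case vs : (v \in s); last by rewrite mul0r mulr0 bary_ge0.
  rewrite mul1r ler_pdivrMr ?ltr0n ?card_gt0 ?ss_neq0 // mulrC.
  by apply: le_trans (height_le _ vs); rewrite ge_min lexx.
have [[hz _]|[s [sss sx h0 hu Mx]]] := M_case x.
  by under eq_bigr do rewrite shrink_zero //; exact: bary_sum.
under eq_bigr do rewrite (shrink_pos _ _ sss Mx hu).
rewrite -mulr_suml sumrB bary_sum -mulr_sumr -mulr_suml -natr_sum.
rewrite (_ : (\sum_i (i \in s))%N = #|s|); last first.
  by rewrite -sum1_card [RHS]big_mkcond; apply: eq_bigr => i _; case: (i \in s).
rewrite divff ?pnatr_eq0 -?lt0n ?card_gt0 ?ss_neq0 // mulr1 divff //.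
by have := denom_gt0 t x; rewrite Mx => /lt0r_neq0.
Qed.

(** When the height is at most [cut t] all of it is subtracted, so a vertex of [s] with least
    coordinate leaves the support. What is left is a proper face of [s], which cannot be in [ss]
    because members of [ss] are maximal. *)
Let shrink_D t x : M x <= cut t -> realization D (shrink (t, x)).
Proof.
move=> Mc; have [y0 y1 yK] := shrink_real (t, x); split => //.
rewrite D_faces yK /=; have [[hz _]|[s [sss sx h0 hu Mx]]] := M_case x.
  apply/negP; rewrite (_ : [set v | _]%SET = supp (bary ^~ x)); last first.
    by apply/setP => v; rewrite !inE shrink_zero.
  by move=> sss; have := ht_supp_neq0 sss erefl; rewrite hz // ltxx.
apply/negP => yss; have [v vs hv] := height_attained (bary_le1 x) (ss_neq0 sss).
have ys : s = supp (shrink (t, x)).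
  by apply: (ss_max yss (ss_faces sss)); rewrite -sx; exact: shrink_supp.
have := vs; rewrite ys inE (shrink_pos _ _ sss Mx hu) vs -Mx (min_idPl Mc) Mx.
rewrite /ht hv mul1r mulrAC divff ?pnatr_eq0 -?lt0n ?card_gt0 ?ss_neq0 //.
by rewrite mul1r subrr mul0r eqxx.
Qed.

Let cut_continuous : continuous cut.
Proof.
apply: mulf_continuous; [exact: clamp_continuous|exact: cst_continuous].
Qed.

Let cut1_continuous : continuous (fun p : R * geom R K => cut p.1).
Proof. exact: (comp_continuous (@fst_continuous _ _) cut_continuous). Qed.

Let comp2_continuous (f : geom R K -> R) : continuous f ->
  continuous (fun p : R * geom R K => f p.2).
Proof. by move=> cf; exact: (comp_continuous (@snd_continuous _ _) cf). Qed.

Let shrink_continuous v : continuous (shrink ^~ v).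
Proof.
apply: divf_continuous => [||[t x]]; last exact/lt0r_neq0/denom_gt0.
  apply: subf_continuous; first exact/comp2_continuous/bary_continuous.
  apply: sum_continuous => s; apply: mulf_continuous; last exact: cst_continuous.
  by apply: min_continuous; [exact/comp2_continuous/ht_continuous|exact: cut1_continuous].
apply: subf_continuous; first exact: cst_continuous.
by apply: min_continuous; [exact/comp2_continuous/M_continuous|exact: cut1_continuous].
Qed.

Let inclD_real (x : geom R D) : realization K (bary ^~ x).
Proof.
split; [exact: bary_ge0|exact: bary_sum|].
by have := bary_faces x; rewrite D_faces => /andP[].
Qed.

Let inclD x : geom R K := geom_pt (inclD_real x).

Let inclD_continuous : continuous inclD.
Proof. by apply: geom_continuous => v; exact: bary_continuous. Qed.

Let ht_inclD s x : s \in ss -> ht s (inclD x) = 0.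
Proof.
move=> sss; apply/eqP; apply/negP => /negP /(ht_supp sss) sx.
by have := bary_faces x; rewrite D_faces /= => /andP[_]; rewrite -{1}sx in sss; rewrite sss.
Qed.

(** The homotopy extension property of [D] in [K], applied to a contraction of [D]. *)
Lemma bouquet_homotopy : exists G : R * geom R K -> geom R K,
  [/\ continuous G, forall x, G (0, x) = x,
    forall t x, M x = 0 -> forall s, s \in ss -> ht s (G (t, x)) = 0 &
    forall x y, M x = 0 -> M y = 0 -> G (1, x) = G (1, y)].
Proof.
have [f [g [cf cg /homotopic_sym /homotopicP[H [cH H0 H1]] _]]] := D_contr.
pose d0 := g tt.
have {}H1 t x : 1 <= t -> H (t, x) = d0 by move=> /H1 ->; rewrite /= /d0; case: (f x).
(* The value [d0] is a placeholder: [Sd] matters only where [M <= cut], and there the shrunk point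
   lies in [D]. *)
pose Sd p : geom R D :=
  if pselect (realization D (shrink p)) is left Dp then geom_pt Dp else d0.
have SdE t x v : M x <= cut t -> bary v (Sd (t, x)) = shrink (t, x) v.
  by move=> /shrink_D Dp; rewrite /Sd; case: pselect.
have cut0 : cut 0 = 0 by rewrite /cut clamp0 mul0r.
have cut1 : cut 1 = 2^-1 by rewrite /cut clamp1 mul1r.
(* A point shrinks until [cut] reaches its height; it is then in [D] and starts the contraction [H]
   at time 0, so the branches agree. Points of [D] start at once, and the factor 2 brings them to
   the end of [H] when [cut] is one half. *)
exists (fun p => if M p.2 <= cut p.1
  then inclD (H ((cut p.1 - M p.2) *+ 2, Sd p)) else geom_pt (shrink_real p)).
split.
- apply: (@continuous_case _ _ [set p : R * geom R K | M p.2 <= cut p.1] _ _ _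
    [set p : R * geom R K | cut p.1 <= M p.2]).
  + apply: closed_le_fun; [exact/comp2_continuous/M_continuous|exact: cut1_continuous].
  + apply: closed_le_fun; [exact: cut1_continuous|exact/comp2_continuous/M_continuous].
  + by rewrite -subTset => p _ /=; case: leP => [|/ltW]; [left|right].
  + have cd : continuous (fun p : R * geom R K => (cut p.1 - M p.2) *+ 2).
      move=> p; apply: cvgMn; apply: cvgB; first exact: cut1_continuous.
      exact: (comp2_continuous M_continuous).
    have cS : {within [set p : R * geom R K | M p.2 <= cut p.1], continuous Sd}.
      apply: geom_continuous => v.
      apply: (@subspace_eq_continuous _ _ _ (shrink ^~ v)).
        by move=> [t x] /set_mem /= Mt; rewrite /from_subspace SdE.
      exact/continuous_subspaceT/shrink_continuous.
    apply: (@comp_continuous (subspace _) _ _ _ inclD) => //.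
    apply: (@comp_continuous (subspace _) _ _ _ H) => //.
    by apply: (@pair_continuous (subspace _)) => //; exact: continuous_subspaceT.
  + apply/continuous_subspaceT/geom_continuous => v; exact: shrink_continuous.
  + move=> [t x] /= le1 le2.
    have -> : cut t = M x by apply/eqP; rewrite eq_le le1 le2.
    rewrite subrr mul0rn H0 //; apply: geom_inj => v.
    by rewrite !baryE SdE.
  + by move=> p /=; case: leP => // /ltW.
- move=> x; apply: geom_inj => v; have S0 : shrink (0, x) v = bary v x.
    rewrite /shrink /= cut0 (min_idPr (M_ge0 x)) subr0 divr1 big1 ?subr0 // => s _.
    by rewrite (min_idPr (ht_ge0 s x)) mul0r.
  case: ifP => [|_]; last by rewrite baryE.
  rewrite /= cut0 => Mle.
  have -> : M x = 0 by apply/eqP; rewrite eq_le Mle M_ge0.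
  by rewrite subr0 mul0rn H0 // baryE SdE ?cut0.
- move=> t x Mx s sss; rewrite /= Mx; have /andP[-> _] := cut_itv t.
  exact: ht_inclD.
- move=> x y Mx My; rewrite /= Mx My cut1 invr_ge0 ler0n; congr inclD.
  by rewrite !H1 //; lra.
Qed.

Variable ds : seq nat.
Hypothesis ds_size : size ds = size ss.
Hypothesis ds_card : forall i, (i < size ss)%N ->
  #|nth finset.set0 ss i| = (nth 0%N ds i).+1.
Hypothesis ss_gt0 : (0 < size ss)%N.

Let I := 'I_(size ds).
Let cell_set (i : I) : {set V} := nth finset.set0 ss i.

Let ltI (i : I) : (i < size ss)%N.
Proof. by rewrite -ds_size. Qed.

Let cell_in (i : I) : cell_set i \in ss.
Proof. exact: mem_nth. Qed.

Let cell_eq (i j : I) : cell_set i = cell_set j -> i = j.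
Proof. by move/eqP; rewrite nth_uniq // => /eqP/val_inj. Qed.

Let cellP s : s \in ss -> exists i : I, cell_set i = s.
Proof.
move=> sss; have si : (index s ss < size ds)%N by rewrite ds_size index_mem.
by exists (Ordinal si); rewrite /cell_set /= nth_index.
Qed.

Let cell_card (i : I) : #|cell_set i| = (nth 0%N ds i).+1 := ds_card (ltI i).

Let dom s (x : geom R K) : s \in ss -> cell_domain s (bary ^~ x).
Proof.
move=> sss; split; [exact: bary_ge0|exact: bary_sum|].
have [hz|hx] := eqVneq (ht s x) 0; [by left|right].
rewrite -[RHS](bary_sum x) [RHS](bigID (mem s)) /= [X in _ + X]big1 ?addr0 //.
by move=> v; rewrite -{1}(ht_supp sss hx) inE negbK => /eqP.
Qed.

Let row (i : I) (x : geom R K) : 'rV[R]_(nth 0%N ds i).+1 := cell_row (cell_card i) (bary ^~ x).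

Let row_sphere (i : I) x : @unit_sphere R (nth 0%N ds i) (row i x).
Proof. exact/cell_row_sphere/dom/cell_in. Qed.

Let cell_pt (i : I) x : sphere R (nth 0%N ds i) := exist _ (row i x) (mem_set (row_sphere i x)).

Let cell_pt_continuous (i : I) : continuous (cell_pt i).
Proof.
apply: set_type_continuous; apply: matrix_continuous => k j.
rewrite (_ : (fun x => _) = (fun x => row i x 0 j)); last first.
  by apply/funext => x; rewrite (ord1 k).
under eq_fun do rewrite /row mxE.
have coff l : continuous (fun x : geom R K => cell_offset (cell_card i) (bary ^~ x) l).
  by apply: subf_continuous; exact: bary_continuous.
have csum : continuous (fun x : geom R K =>
    \sum_l cell_offset (cell_card i) (bary ^~ x) l ^+ 2 +
    (1 - \sum_(v in cell_set i) bary v x)).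
  apply: addf_continuous.
    by apply: sum_continuous => l; apply: sqrf_continuous; exact: coff.
  apply: subf_continuous; first exact: cst_continuous.
  by apply: sum_continuous => v; exact: bary_continuous.
have ch2 : continuous (fun x : geom R K => height (cell_set i) (bary ^~ x) ^+ 2).
  by apply: sqrf_continuous; exact: height_continuous.
apply: divf_continuous => [||x]; last 1 first.
- exact/lt0r_neq0/cell_denom_gt0/dom/cell_in.
- case: (j == 0); first exact: subf_continuous.
  under eq_fun do rewrite mulr2n.
  by apply: addf_continuous; apply: mulf_continuous;
    [exact: height_continuous|exact: coff|exact: height_continuous|exact: coff].
exact: addf_continuous.
Qed.

Let W := sphere_wedge R ds.
Let lift (i : I) (a : sphere R (nth 0%N ds i)) : W :=
  @wedge_lift _ (fun i : I => sphere R (nth 0%N ds i))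
    (fun i => sphere_base R (nth 0%N ds i)) i a.
Let base (i : I) : sphere R (nth 0%N ds i) := sphere_base R (nth 0%N ds i).

Let lift_base i j : lift (base i) = lift (base j).
Proof. exact: wedge_liftE. Qed.

Let prod_lift (i : I) (a : sphere R (nth 0%N ds i)) :
  wedge_prod (lift a) = dfwith base i a.
Proof. rewrite /wedge_prod wedge_lift_funE //; exact: wedge_prod_pointE. Qed.

Let lift_inj (i : I) (a b : sphere R (nth 0%N ds i)) : lift a = lift b -> a = b.
Proof.
move=> /(congr1 (fun w => wedge_prod w i)); rewrite !prod_lift.
by rewrite !dfwithin.
Qed.

Let lift_base_inj (i j : I) (a : sphere R (nth 0%N ds i)) (b : sphere R (nth 0%N ds j)) :
  i != j -> lift a = lift b -> a = base i.
Proof.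
move=> ij /(congr1 (fun w => wedge_prod w i)); rewrite !prod_lift.
by rewrite dfwithin dfwithout // eq_sym.
Qed.

Let i0 : I := Ordinal (eq_ind_r (fun n => 0 < n)%N ss_gt0 ds_size).

(** All of [D] goes to the base point, and each open cell goes bijectively onto its own sphere minus
    the base point. *)
Let q x : W := if [pick i : I | ht (cell_set i) x != 0] is Some i
  then lift (cell_pt i x) else lift (base i0).

Let q_cell (i : I) x : (forall j : I, j != i -> ht (cell_set j) x = 0) ->
  q x = lift (cell_pt i x).
Proof.
move=> hj; rewrite /q; case: pickP => [j hx|hz].
  by have [->//|/hj hz] := eqVneq j i; rewrite hz eqxx in hx.
rewrite (lift_base _ i); congr lift; apply: val_inj => /=.
apply/esym/cell_row_base; first exact/dom/cell_in.
by apply/eqP; have := hz i; case: eqP.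
Qed.

Let q_zero x : M x = 0 -> q x = lift (base i0).
Proof.
move=> Mx; rewrite /q; case: pickP => // j; have [[hz _]|[s [_ _ h0 _ Ms]]] := M_case x.
  by rewrite hz ?eqxx //; exact: cell_in.
by move: h0; rewrite -Ms Mx ltxx.
Qed.

Let q_pos x : M x <> 0 -> exists i : I, [/\ supp (bary ^~ x) = cell_set i,
  0 < ht (cell_set i) x & q x = lift (cell_pt i x)].
Proof.
have [[_ ->]//|[s [sss sx h0 hu _]] _] := M_case x.
have [i si] := cellP sss; exists i; rewrite si; split => //; apply: q_cell => j ji.
by apply: hu; [exact: cell_in|rewrite -si; apply: contraNneq ji => /cell_eq ->].
Qed.

Let pt_neq_base (i : I) x : 0 < ht (cell_set i) x -> cell_pt i x <> base i.
Proof.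
move=> h0 /(congr1 val) /=; apply: cell_row_neq_base => //.
exact/dom/cell_in.
Qed.

Let q_inj x y : q x = q y -> x = y \/ (M x = 0 /\ M y = 0).
Proof.
have zp u w : M u = 0 -> M w <> 0 -> q u <> q w.
  move=> /q_zero -> /q_pos[i [_ h0 ->]]; rewrite (lift_base _ i) => /lift_inj.
  by move=> /esym; exact: pt_neq_base.
have [Mx|/eqP Mx] := eqVneq (M x) 0; have [My|/eqP My] := eqVneq (M y) 0.
- by right.
- by move/(zp _ _ Mx My).
- by move/esym/(zp _ _ My Mx).
have [i [sx hx ->]] := q_pos Mx; have [j [sy hy ->]] := q_pos My.
have [ij|ij] := eqVneq i j; last by move=> /(lift_base_inj ij) /(pt_neq_base hx).
rewrite -{}ij in sy hy *; move=> /lift_inj /(congr1 val) /= xy; left.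
apply: geom_inj => v; have [vs|vs] := boolP (v \in cell_set i).
  apply: (cell_row_inj _ _ _ _ xy) => //; exact/dom/cell_in.
have out z : supp (bary ^~ z) = cell_set i -> bary v z = 0.
  by move=> sz; move: vs; rewrite -sz inE negbK => /eqP.
by rewrite !out.
Qed.

Let q_surj w : exists x, q x = w.
Proof.
have [f [g [_ _ _ _]]] := D_contr.
have : [set: W] w by []; rewrite -wedgeTE => -[i _ [a _ <-]].
have [->|/eqP ab] := eqVneq a (base i).
  exists (inclD (g tt)); rewrite -/(lift (base i)) (lift_base i i0); apply: q_zero.
  by rewrite /M big_seq big1 // => s; exact: ht_inclD.
have aS : @unit_sphere R (nth 0%N ds i) (val a) by exact: set_valP.
have [|x [dx sx h0 xa]] := cell_row_surj (cell_card i) aS.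
  by move=> ab'; apply: ab; exact: val_inj.
have Kx : realization K x.
  by case: dx => x0 x1 _; split => //; rewrite -/(supp x) sx ss_faces ?cell_in.
exists (geom_pt Kx); rewrite (@q_cell i).
  by congr lift; apply: val_inj.
move=> j ji; apply: (@ht_unique (cell_set i)); rewrite ?cell_in //.
  exact: lt0r_neq0.
by apply: contraNneq ji => /cell_eq ->.
Qed.

Let q_continuous : continuous q.
Proof.
(* A finite closed cover: on [F i] all cells except the one of index [i] have height zero, so [q] is
   given there by the single formula [lift (cell_pt i x)]. *)
pose F (i : I) := [set x | forall j : I, j != i -> ht (cell_set j) x = 0].
have cF i : closed (F i).
  rewrite (_ : F i = \bigcap_(j in [set j : I | j != i])
      ((fun x => ht (cell_set j) x) @^-1` [set r | r = 0])).
    apply: closed_bigI => j _; apply: preimage_closed; last exact: closed_eq.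
    by move=> x _; exact: ht_continuous.
  by apply/seteqP; split => x Fx j; exact: Fx.
have clift i : continuous (fun x => lift (cell_pt i x)).
  exact: (comp_continuous (@cell_pt_continuous i) (@wedge_lift_continuous _ _ _ i)).
apply/continuous_closedP => C cC.
rewrite (_ : q @^-1` C = \bigcup_(i in [set: I])
    (F i `&` (fun x => lift (cell_pt i x)) @^-1` C)).
  apply: closed_bigcup => [|i _]; first exact: finite_finset.
  by apply: closedI => //; apply: preimage_closed => // x _; exact: clift.
apply/seteqP; split => [x /= Cx|x [i _ [Fx /=]]]; last by rewrite /preimage /= (q_cell Fx).
have [Mx|/eqP Mx] := eqVneq (M x) 0.
  have F0 : F i0 x.
    move=> j _; have [[hz _]|[s [_ _ h0 _ Ms]]] := M_case x; first exact/hz/cell_in.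
    by move: h0; rewrite -Ms Mx ltxx.
  by exists i0 => //; split => //=; rewrite -(q_cell F0).
have [i [sx h0 qx]] := q_pos Mx; exists i => //; split => /=; last by rewrite -qx.
move=> j ji; apply: (@ht_unique (cell_set i)); rewrite ?cell_in //.
  exact: lt0r_neq0.
by apply: contraNneq ji => /cell_eq ->.
Qed.

Lemma bouquet_equivalent : homotopy_equivalent R (geom R K) (sphere_wedge R ds).
Proof.
have [G [cG G0 GD G1]] := bouquet_homotopy.
have MG t x : M x = 0 -> M (G (t, x)) = 0.
  by move=> Mx; rewrite /M big_seq big1 // => s; exact: GD.
apply: (@collapse_contractible_equivalent R _ _ q G) => //.
- exact: compact_geom.
- apply: wedge_hausdorff => i; apply: (@injective_hausdorff _ _ set_val).
  + exact: set_val_continuous.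
  + exact: val_inj.
  + exact: norm_hausdorff.
- by move=> t x y _ /q_inj[->//|[Mx My]]; rewrite !q_zero ?MG.
- by move=> x y /q_inj[->//|[Mx My]]; exact: G1.
Qed.

End Bouquet.

Lemma sphere_wedge1 (R : realType) (d : nat) :
  homotopy_equivalent R (sphere_wedge R [:: d]) (sphere R d).
Proof.
pose X (i : 'I_1) := sphere R (nth 0%N [:: d] i).
pose b (i : 'I_1) : X i := sphere_base R (nth 0%N [:: d] i).
pose f (w : wedge b) : X ord0 := wedge_prod w ord0.
pose g (a : X ord0) : wedge b := wedge_lift b a.
have fg a : f (g a) = a.
  rewrite /f /g /wedge_prod wedge_lift_funE ?dfwithin //.
  exact: wedge_prod_pointE.
have gf w : g (f w) = w.
  have : [set: wedge b] w by []; rewrite -wedgeTE => -[i _ [a _ <-]].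
  by rewrite (ord1 i) in a *; rewrite -/(g a) fg.
have cf : continuous f.
  exact: (comp_continuous (@wedge_prod_continuous _ _ b) (@proj_continuous _ X ord0)).
have cg : continuous g by exact: wedge_lift_continuous.
exists f, g; split => //.
  rewrite (_ : g \o f = idfun); last exact/funext.
  by apply: homotopic_refl => x; exact: cvg_id.
rewrite (_ : f \o g = idfun); last exact/funext.
by apply: homotopic_refl => x; exact: cvg_id.
Qed.

Local Close Scope ring_scope.
Local Close Scope classical_set_scope.
Local Open Scope nat_scope.

(** * Collapses of independence complexes *)

Section Deletions.
Variable V : finType.
Implicit Types (K L : scomplex V) (A B t : {set V}) (ts : seq {set V}).

Lemma scomplex_eq K L : faces K = faces L -> K = L.
Proof.
case: K L => [F FP] [G GP] /= FG; rewrite -{}FG in GP *.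
by congr SComplex; exact: Prop_irrelevance.
Qed.

Lemma dels_sub K ts A B : B \subset A ->
  A \in [set A in faces K | all (fun t => ~~ (t \subset A)) ts]%SET ->
  B \in [set A in faces K | all (fun t => ~~ (t \subset A)) ts]%SET.
Proof.
move=> BA; rewrite !inE => /andP[KA /allP tA]; rewrite (faces_sub BA KA) /=.
apply/allP => t /tA; apply: contra => tB; exact: fintype.subset_trans tB BA.
Qed.

Definition dels K ts : scomplex V := SComplex (@dels_sub K ts).

Lemma in_dels K ts A :
  (A \in faces (dels K ts)) = (A \in faces K) && all (fun t => ~~ (t \subset A)) ts.
Proof. by rewrite inE. Qed.

Lemma dels_cons K t ts : dels K (t :: ts) = del (dels K ts) t.
Proof.
apply/scomplex_eq/setP => A; rewrite in_del !in_dels /=.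
by rewrite [RHS]andbAC -!andbA.
Qed.

Lemma dels0 K : dels K [::] = K.
Proof. by apply/scomplex_eq/setP => A; rewrite in_dels andbT. Qed.

Lemma dels_perm K ts ts' : ts =i ts' -> dels K ts = dels K ts'.
Proof.
move=> tt'; apply/scomplex_eq/setP => A; rewrite !in_dels; congr (_ && _).
exact: eq_all_r.
Qed.

Lemma dels_cat K ts ts' : dels (dels K ts) ts' = dels K (ts' ++ ts).
Proof.
by apply/scomplex_eq/setP => A; rewrite !in_dels all_cat -andbA [in RHS](andbC (all _ ts')).
Qed.

Variable R : realType.
Local Notation "K ~~h L" := (homotopy_equivalent R (geom R K) (geom R L)) (at level 70).

(** One deletion per index, with [p i] as the apex of the link of [t i]. The last hypothesis says
    that adding [p i] completes no other [t j], so the links remain cones after the previous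
    deletions. *)
Lemma family_collapse K (I : eqType) (r : seq I) (t : I -> {set V}) (p : I -> V) :
  (forall i, i \in r -> t i != finset.set0) ->
  (forall i, i \in r -> p i \notin t i) ->
  (forall i A, i \in r -> A \in faces K -> t i \subset A -> p i |: A \in faces K) ->
  (forall i j A, i \in r -> j \in r -> A \in faces K -> t i \subset A ->
     p i \in t j -> t j \subset p i |: A -> t j \subset A) ->
  K ~~h dels K (map t r).
Proof.
elim: r => [|i r IHr] t0 pt Kp Kt /=.
  by rewrite dels0; exact: homotopy_equivalent_refl.
apply: homotopy_equivalent_trans (IHr _ _ _ _) _.
- by move=> j jr; apply: t0; rewrite inE jr orbT.
- by move=> j jr; apply: pt; rewrite inE jr orbT.
- by move=> j A jr; apply: Kp; rewrite inE jr orbT.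
- by move=> j k A jr kr; apply: Kt; rewrite inE ?jr ?kr orbT.
have ir : i \in i :: r by rewrite mem_head.
rewrite dels_cons; apply: (@collapse_step _ _ _ _ (p i)); [exact: t0|exact: pt|].
move=> A; rewrite !in_dels => /andP[KA /allP rA] tA; rewrite Kp //=.
apply/allP => _ /mapP[j jr ->]; have := rA _ (map_f t jr); apply: contra => tj.
have jr' : j \in i :: r by rewrite inE jr orbT.
have [pj|pj] := boolP (p i \in t j); first exact: (Kt i j A).
apply/fintype.subsetP => v vj; have := fintype.subsetP tj v vj.
by rewrite !inE => /predU1P[vp|//]; rewrite -vp vj in pj.
Qed.

Definition prefix_set (x : nat -> V) (l : nat) : {set V} := [set x i | i : 'I_l]%SET.

Lemma prefix_setP x l v :
  reflect (exists2 i, i < l & v = x i) (v \in prefix_set x l).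
Proof.
apply: (iffP imsetP) => [[i _ ->]|[i il ->]]; first by exists i.
by exists (Ordinal il).
Qed.

Lemma prefix_setS x l : prefix_set x l.+1 = x l |: prefix_set x l.
Proof.
apply/setP => v; rewrite !inE; apply/prefix_setP/predU1P => [[i]|[->|]].
- rewrite ltnS leq_eqVlt => /predU1P[->|il] ->; first by left.
  by right; apply/prefix_setP; exists i.
- by exists l.
- by case/prefix_setP => i il ->; exists i => //; exact: ltnW.
Qed.

Lemma prefix_set_sub x l l' : l <= l' -> prefix_set x l \subset prefix_set x l'.
Proof.
move=> ll'; apply/fintype.subsetP => v /prefix_setP[i il ->].
by apply/prefix_setP; exists i => //; exact: leq_trans ll'.
Qed.

(** The sets made of [B] and an initial segment of [x] are deleted from the longest to the shortest:
    once the longer one is gone, [x i.+1] no longer occurs in the link of the shorter one, and [y i]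
    becomes an apex of that link. *)
Lemma chain_collapse K ts B (x y : nat -> V) (l : nat) :
  (forall i, i <= l -> y i \notin B :|: prefix_set x i.+1) ->
  (forall i, i < l -> y i != x i.+1) ->
  (forall i A, i <= l -> A \in faces (dels K ts) -> B :|: prefix_set x i.+1 \subset A ->
     (i < l -> x i.+1 \notin A) -> y i |: A \in faces (dels K ts)) ->
  dels K ts ~~h dels K ((x 0 |: B) :: ts).
Proof.
move=> yB yx Ky; pose T i := B :|: prefix_set x i.+1.
have T0 i : T i != finset.set0.
  apply/finset.set0Pn; exists (x i); rewrite inE; apply/orP; right.
  by apply/prefix_setP; exists i.
suff main k : k <= l -> dels K ts ~~h dels K (T (l - k) :: ts).
  have := main l (leqnn l); rewrite subnn (_ : T 0 = x 0 |: B) //.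
  by rewrite /T prefix_setS finset.setUC (_ : prefix_set x 0 = finset.set0) ?finset.setU0 //;
    apply/setP => v; rewrite inE; apply/prefix_setP => -[].
elim: k => [_|k IHk kl].
  rewrite subn0 dels_cons; apply: (@collapse_step _ _ _ _ (y l)) => //; first exact: yB.
  by move=> A KA TA; apply: Ky; rewrite ?ltnn.
apply: homotopy_equivalent_trans (IHk (ltnW kl)) _.
set i := l - k.+1; have -> : l - k = i.+1 by rewrite /i; lia.
have il : i < l by rewrite /i; lia.
have TT : T i \subset T i.+1 by apply: finset.setUS; exact: prefix_set_sub.
(* Forbidding [T i] makes its superset [T i.+1] redundant, so the list keeps a single set of the
   chain. *)
rewrite [X in _ ~~h X](_ : _ = dels K (T i :: T i.+1 :: ts)); last first.
  apply/scomplex_eq/setP => A; rewrite !in_dels /=; congr (_ && _).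
  case tA : (T i \subset A) => //=; suff -> : T i.+1 \subset A = false by [].
  by apply: contraFF tA => /(fintype.subset_trans TT).
rewrite [X in _ ~~h X]dels_cons.
apply: (@collapse_step _ _ _ _ (y i)) => //; first exact/yB/ltnW.
move=> A; rewrite dels_cons in_del => /andP[KA TA1] TA.
have xA : x i.+1 \notin A.
  by apply: contra TA1 => xA; rewrite /T prefix_setS finset.setUCA finset.subUset finset.sub1set xA.
rewrite in_del Ky ?(ltnW il) //=; apply: contra xA => /fintype.subsetP/(_ (x i.+1)).
rewrite !inE [x i.+1 == y i]eq_sym (negbTE (yx _ il)) /=; apply.
by apply/orP; right; apply/prefix_setP; exists i.+1.
Qed.

End Deletions.

(** * Collapses and critical cells in terms of adjacency *)

Section IndependenceMoves.
Variables (R : realType) (G : sgraph).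
Implicit Types (A B C s t : {set G}) (ts ss : seq {set G}) (u v w : G).
Local Notation "K ~~h L" := (homotopy_equivalent R (geom R K) (geom R L)) (at level 70).

Lemma independentP A :
  reflect (forall u v, u \in A -> v \in A -> ~~ sadj u v) (independent A).
Proof.
apply: (iffP forall_inP) => [iA u v uA vA|iA u uA].
  by have /forall_inP := iA u uA; apply.
by apply/forall_inP => v vA; exact: iA.
Qed.

Lemma in_Ind A : (A \in faces (Ind G)) = independent A.
Proof. by rewrite inE. Qed.

Lemma independent_add A u : independent A -> (forall v, sadj u v -> v \notin A) ->
  independent (u |: A).
Proof.
move=> /independentP iA uA; apply/independentP => v w; rewrite !inE.
case/predU1P=> [->|vA] /predU1P[->|wA]; first by rewrite sadj_irrefl.
- by apply: contraL wA => /uA.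
- by rewrite sadj_sym; apply: contraL vA => /uA.
- exact: iA.
Qed.

(** Two local certificates that no face containing [C] contains [u]. *)
Definition excluded ts C u :=
  (exists2 t, t \in ts & t \subset u |: C) \/ exists2 w, w \in C & sadj w u.

Lemma excludedP ts C u A : excluded ts C u -> A \in faces (dels (Ind G) ts) ->
  C \subset A -> u \notin A.
Proof.
case=> [[t tts tu]|[w wC wu]]; rewrite in_dels in_Ind => /andP[iA /allP tA] CA.
  apply: contra (tA t tts) => uA; apply: fintype.subset_trans tu _.
  by rewrite finset.subUset finset.sub1set uA.
apply: contraL wu => uA; move/independentP: iA; apply => //.
exact: (fintype.subsetP CA).
Qed.

Lemma excluded_sub ts C C' u : C \subset C' -> excluded ts C u -> excluded ts C' u.
Proof.
move=> CC' [[t tts tu]|[w wC wu]]; [left; exists t => //|right; exists w => //].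
  exact/(fintype.subset_trans tu)/finset.setUS.
exact: (fintype.subsetP CC').
Qed.

Lemma excluded1 ts C u : [set u]%SET \in ts -> excluded ts C u.
Proof. by move=> uts; left; exists [set u]%SET => //; exact: finset.subsetUl. Qed.

(** Neighbours of [y i] are absent from the link, so independence survives the addition of [y i].
    The last hypothesis guards the forbidden sets through [y i]: each has another vertex that is
    absent too, and is therefore not completed. The end of the chain, [x l.+1], has to be excluded
    by other means. *)
Lemma graph_chain ts B (x y : nat -> G) (l : nat) :
  (forall i, i <= l -> y i \notin B :|: prefix_set x i.+1) ->
  (forall i, i <= l -> y i != x i.+1) ->
  (forall i u, i <= l -> sadj (y i) u ->
     u = x i.+1 \/ excluded ts (B :|: prefix_set x i.+1) u) ->
  excluded ts (B :|: prefix_set x l.+1) (x l.+1) ->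
  (forall i t, i <= l -> t \in ts -> y i \in t -> exists2 u, u \in t &
     u != y i /\ (u = x i.+1 \/ excluded ts (B :|: prefix_set x i.+1) u)) ->
  dels (Ind G) ts ~~h dels (Ind G) ((x 0 |: B) :: ts).
Proof.
move=> yB yx yN xl yT; apply: (@chain_collapse _ _ _ _ _ x y l) => //.
  by move=> i /ltnW; exact: yx.
move=> i A il KA TA xA.
have {}xA : x i.+1 \notin A.
  move: il; rewrite leq_eqVlt => /predU1P[il|/xA//]; rewrite {}il in TA *.
  exact: excludedP xl KA TA.
have notA u : u = x i.+1 \/ excluded ts (B :|: prefix_set x i.+1) u -> u \notin A.
  by case=> [->//|ex]; exact: excludedP ex KA TA.
move: (KA); rewrite !in_dels !in_Ind => /andP[iA /allP tA]; apply/andP; split.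
  by apply: independent_add => // u /(yN _ _ il)/notA.
apply/allP => t tts; have [yt|yt] := boolP (y i \in t).
  have [u ut [uy /notA uA]] := yT i t il tts yt.
  by apply: contra uA => /fintype.subsetP/(_ u ut); rewrite !inE (negbTE uy).
apply: contra (tA t tts) => /fintype.subsetP ty; apply/fintype.subsetP => u ut.
by have := ty u ut; rewrite !inE => /predU1P[uy|//]; rewrite -uy ut in yt.
Qed.

Lemma graph_cone ts p :
  (forall t, t \in ts -> t != finset.set0) ->
  (forall u, sadj p u -> [set u]%SET \in ts) ->
  (forall t, t \in ts -> p \in t -> exists2 u, u \in t & u != p /\ [set u]%SET \in ts) ->
  contractible R (geom R (dels (Ind G) ts)).
Proof.
move=> t0 pN pT; apply: (@cone_contractible _ _ _ p).
  rewrite in_dels in_Ind; apply/andP; split.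
    by apply/independentP => u v; rewrite inE.
  by apply/allP => t /t0; rewrite finset.subset0.
move=> A KA; have notA u : [set u]%SET \in ts -> u \notin A.
  by move=> uts; apply: (@excludedP ts finset.set0); rewrite ?finset.sub0set //; exact: excluded1.
move: (KA); rewrite !in_dels !in_Ind => /andP[iA /allP tA]; apply/andP; split.
  by apply: independent_add => // u /pN/notA.
apply/allP => t tts; have [yt|yt] := boolP (p \in t).
  have [u ut [uy /notA uA]] := pT t tts yt.
  by apply: contra uA => /fintype.subsetP/(_ u ut); rewrite !inE (negbTE uy).
apply: contra (tA t tts) => /fintype.subsetP ty; apply/fintype.subsetP => u ut.
by have := ty u ut; rewrite !inE => /predU1P[uy|//]; rewrite -uy ut in yt.
Qed.

(** A nonempty maximal face of [dels (Ind G) ts]; the last clause records, for each outside vertex,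
    why it cannot be added. *)
Definition critical ts s := [/\ s != finset.set0, independent s,
  forall t, t \in ts -> ~~ (t \subset s) &
  forall u, u \notin s -> (exists2 w, w \in s & sadj w u) \/
    (exists2 t, t \in ts & t \subset u |: s)].

Lemma critical_max ts s A : critical ts s -> A \in faces (dels (Ind G) ts) ->
  s \subset A -> A = s.
Proof.
case=> _ _ _ smax; rewrite in_dels in_Ind => /andP[iA /allP tA] sA.
apply/eqP; rewrite finset.eqEsubset sA andbT; apply/fintype.subsetP => u uA.
apply: contraT => /smax[[w ws wu]|[t tts tu]].
  have /independentP/(_ w u) := iA; rewrite wu; apply => //.
  exact: (fintype.subsetP sA).
have := tA t tts; rewrite (fintype.subset_trans tu) //.
by rewrite finset.subUset finset.sub1set uA.
Qed.

(** Forbidding a maximal face removes that face alone, so the list [ss ++ ts] describes the complex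
    with the open cells of [ss] taken out. *)
Lemma graph_bouquet ts ss (ds : seq nat) : uniq ss -> (0 < size ss) ->
  (forall s, s \in ss -> critical ts s) ->
  [seq #|s| | s : {set G} <- ss] = [seq d.+1 | d <- ds] ->
  contractible R (geom R (dels (Ind G) (ss ++ ts))) ->
  homotopy_equivalent R (geom R (dels (Ind G) ts)) (sphere_wedge R ds).
Proof.
move=> ssu ss0 crit card cD.
have size_ds : size ds = size ss by rewrite -(size_map S) -card size_map.
apply: (@bouquet_equivalent _ _ _ (dels (Ind G) (ss ++ ts)) ss) => //.
- move=> s /crit[_ si st _]; rewrite in_dels in_Ind si.
  by apply/allP => t; exact: st.
- by move=> s A /crit sc; exact: critical_max sc.
- by move=> s /crit[].
- move=> A; rewrite !in_dels all_cat //=.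
  case: (boolP (A \in faces (dels (Ind G) ts))) => [KA|]; last first.
    by rewrite in_dels negb_and; case: (A \in faces _); case: (all _ ts) => //=; rewrite !andbF.
  move: (KA); rewrite in_dels => /andP[-> ->] /=; rewrite andbT.
  apply/allP/idP => [sA|As s sss].
    by apply/negP => /sA; rewrite fintype.subxx.
  by apply: contra As => /(critical_max (crit s sss) KA) ->.
- move=> i iss; have := congr1 (fun r => nth 0 r i) card.
  by rewrite (nth_map finset.set0) // (nth_map 0) ?size_ds.
Qed.

End IndependenceMoves.

(** * The independence complex of the ladder *)

Section Prism.
Variables (R : realType) (n : nat).
Hypothesis n_ge2 : 2 <= n.
Let G := circular_ladder n.

Let vx_subproof (b : bool) c : c %% n + b * n < 2 * n.
Proof. by have := @ltn_pmod c n; case: b; lia. Qed.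

Definition vx (b : bool) (c : nat) : G := Ordinal (vx_subproof b c).

(* Row [b], with the columns read in the direction given by [d], starting from
   the column [0] in both cases. *)
Definition wv (d b : bool) (c : nat) : G := if d then vx b c else vx b (n - c).

Lemma wv_val d b c : c <= n -> nat_of_ord (wv d b c) =
  (if d then (if c == n then 0 else c) else (if c == 0 then 0 else n - c)) + b * n.
Proof.
move=> cn; rewrite /wv; case: d => /=.
  by case: eqP => [->|cNn]; rewrite ?modnn ?modn_small //; lia.
by case: eqP => [->|cN0]; rewrite ?subn0 ?modnn ?modn_small //; lia.
Qed.

Lemma wv_inj d b b' c c' : c <= n -> c' <= n -> wv d b c = wv d b' c' ->
  b = b' /\ (c = c' \/ (c = 0 /\ c' = n) \/ (c = n /\ c' = 0)).
Proof.
move=> cn cn' /(congr1 (@nat_of_ord _)); rewrite !wv_val //.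
case: d; case: b; case: b'; rewrite ?mul1n ?mul0n; do !case: eqP;
  move=> *; (split=> //; lia) || (exfalso; lia).
Qed.

Lemma wv_n d b : wv d b n = wv d b 0.
Proof.
by apply: val_inj; rewrite /= !wv_val // !eqxx subnn !if_same; case: d.
Qed.

Lemma wv_flip d b c : c <= n -> wv d b c = wv (~~ d) b (n - c).
Proof.
by move=> cn; rewrite /wv; case: d => //=; rewrite subKn.
Qed.

Lemma wv_surj d (u : G) : exists b c, c < n /\ u = wv d b c.
Proof.
have un : u < 2 * n := ltn_ord u.
exists (n <= u); exists (if d then u - (n <= u) * n else
   if u == (n <= u) * n :> nat then 0 else n - (u - (n <= u) * n)).
split; first by case: d; case: leqP; do ?case: eqP; lia.
apply: val_inj; rewrite /= wv_val; last by case: d; case: leqP; do ?case: eqP; lia.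
by case: d; case: leqP; do ?case: eqP; lia.
Qed.

Lemma ladder_edge_row e c c' : c < n -> c' < n ->
  ladder_edge n (c + nat_of_bool e * n).+1 (c' + nat_of_bool e * n).+1 =
  (c' == c.+1) || (c == 0) && (c' == n.-1).
Proof.
move=> cn cn'; rewrite /ladder_edge; case: e; rewrite ?mul1n ?mul0n ?addn0.
  have -> : ((c + n).+1 <= n - 1) = false by lia.
  have -> : ((c + n).+1 == 1) = false by lia.
  have -> : ((c + n).+1 <= n) = false by lia.
  have -> : (n + 1 <= (c + n).+1) = true by lia.
  rewrite /= ?andbF ?orbF /=.
  have -> : ((c' + n).+1 == (c + n).+1 + 1) = (c' == c.+1) by lia.
  have -> : ((c + n).+1 == n + 1) = (c == 0) by lia.
  have -> : ((c' + n).+1 == 2 * n) = (c' == n.-1) by lia.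
  case: (c' =P c.+1) => [cc|]; last by rewrite andbF.
  by rewrite andbT (_ : _ <= _) //; lia.
have -> : (n + 1 <= c.+1) = false by lia.
have -> : (c.+1 == n + 1) = false by lia.
have -> : (c'.+1 == c.+1 + n) = false by lia.
have -> : (c'.+1 == c.+1 + 1) = (c' == c.+1) by lia.
have -> : (c'.+1 == n) = (c' == n.-1) by lia.
rewrite /= ?andbF ?orbF.
case: (c' =P c.+1) => [cc|]; last by rewrite andbF.
by rewrite andbT (_ : _ <= _) //; lia.
Qed.

Lemma ladder_edge_rung e c c' : c < n -> c' < n ->
  ladder_edge n (c + nat_of_bool e * n).+1 (c' + nat_of_bool (~~ e) * n).+1 =
  ~~ e && (c == c').
Proof.
move=> cn cn'; rewrite /ladder_edge; case: e => /=; rewrite ?mul1n ?mul0n ?addn0.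
  have -> : ((c + n).+1 <= n - 1) = false by lia.
  have -> : ((c + n).+1 == 1) = false by lia.
  have -> : ((c + n).+1 <= n) = false by lia.
  have -> : (c'.+1 == (c + n).+1 + 1) = false by lia.
  have -> : (c'.+1 == 2 * n) = false by lia.
  by rewrite /= ?andbF.
have -> : (n + 1 <= c.+1) = false by lia.
have -> : (c.+1 == n + 1) = false by lia.
have -> : ((c' + n).+1 == n) = false by lia.
have -> : ((c' + n).+1 == c.+1 + n) = (c == c') by lia.
have -> : c.+1 <= n by [].
rewrite /= ?andbF /=; case: (_ == c.+1 + 1) / eqP => [cc|]; last by rewrite andbF.
by rewrite (_ : (c.+1 <= n - 1) = false) //; lia.
Qed.

Lemma sadj_vx b b' c c' : c < n -> c' < n -> @sadj G (vx b c) (vx b' c') =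
  if b == b' then [|| c' == c.+1, c == c'.+1, (c == 0) && (c' == n.-1) |
     (c' == 0) && (c == n.-1)] else c == c'.
Proof.
move=> cn cn'; rewrite /= /ladder_adj -val_eqE /= !modn_small //.
case: (b =P b') => [<-|bb'].
  rewrite !ladder_edge_row // eqn_add2r.
  case: (c =P c') => [<-|cc']; first by lia.
  by rewrite /= -!orbA; congr (_ || _); rewrite orbCA.
have -> : b' = ~~ b by case: b b' bb' => -[].
rewrite ladder_edge_rung //; have := ladder_edge_rung (~~ b) cn' cn; rewrite !negbK => ->.
rewrite (eq_sym c'); case: (c =P c') => [->|]; last by rewrite !andbF ?orbF ?andbF.
rewrite !andbT orNb andbT eqn_add2l eqn_pmul2r; last by lia.
by case: b {bb'}.
Qed.

(** Columns [0] and [n] name the same vertices; the differences [n.-1] and [n] account for the edges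
    that close the two cycles and for rungs read at both ends. *)
Lemma wv_sadj d b b' c c' : c <= c' -> c' <= n ->
  @sadj G (wv d b c) (wv d b' c') =
  ((b == b') && ((c' == c.+1) || (c' - c == n.-1))) ||
  ((b != b') && ((c == c') || (c' - c == n))).
Proof.
move=> cc' cn'; have cn := leq_trans cc' cn'.
have wm d' e k : k <= n -> exists2 l, l < n & wv d' e k = vx e l /\
    (if d' then l = (if k == n then 0 else k) else l = (if k == 0 then 0 else n - k)).
  move=> kn; exists (if d' then if k == n then 0 else k else if k == 0 then 0 else n - k).
    by case: d'; case: eqP; lia.
  split; last by case: d'.
  apply: val_inj; rewrite /= wv_val // modn_small //.
  by case: d'; case: eqP; lia.
have [l ln [-> hl]] := wm d b c cn; have [l' ln' [-> hl']] := wm d b' c' cn'.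
rewrite sadj_vx //; case: (b == b') => /=.
  rewrite orbF; case: d hl hl'; (case: eqP => ? ->); (case: eqP => ? ->);
    apply/idP/idP; lia.
by case: d hl hl'; (case: eqP => ? ->); (case: eqP => ? ->); lia.
Qed.

Lemma wv_next d b c : c < n -> @sadj G (wv d b c) (wv d b c.+1).
Proof. by move=> cn; rewrite wv_sadj // !eqxx. Qed.

Lemma wv_prev d b c : c < n -> @sadj G (wv d b c.+1) (wv d b c).
Proof. by move=> cn; rewrite sadj_sym; exact: wv_next. Qed.

Lemma wv_rung d b c : c <= n -> @sadj G (wv d b c) (wv d (~~ b) c).
Proof. by move=> cn; rewrite wv_sadj // eqxx; case: b. Qed.

Lemma wv_nbr d b c u : c.+2 <= n -> @sadj G (wv d b c.+1) u ->
  [\/ u = wv d b c, u = wv d b c.+2 | u = wv d (~~ b) c.+1].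
Proof.
move=> cn; have [b' [c' [cn' ->]]] := wv_surj d u.
have [cc|cc] := leqP c' c.+1.
  rewrite sadj_sym wv_sadj; [|by []|by lia].
  case/orP=> [/andP[/eqP -> /orP[/eqP[<-]|c1]]|/andP[bb /orP[/eqP ->|c1]]].
  - by constructor 1.
  - constructor 2; have -> : c' = 0 by lia.
    by rewrite -wv_n; congr wv; lia.
  - by constructor 3; congr wv; case: b b' bb => -[].
  - by exfalso; lia.
rewrite wv_sadj; [|by lia|by lia].
case/orP=> [/andP[/eqP <- /orP[/eqP ->|c1]]|/andP[bb /orP[/eqP c1|c1]]].
- by constructor 2.
- by exfalso; lia.
- by exfalso; lia.
- by exfalso; lia.
Qed.

(** A zigzag through every other column, in alternating rows. The vertex [ly d b s i] lies in the
    column after [lx d b s i] and in the other row: two of its three neighbours are adjacent to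
    [lx d b s i], and the third is [lx d b s i.+1]. *)
Definition lx d b s (i : nat) : G := wv d (b (+) odd i) (s + i.*2).
Definition ly d b s (i : nat) : G := wv d (~~ (b (+) odd i)) (s + i.*2).+1.

Lemma lxS d b s i : lx d b s i.+1 = wv d (~~ (b (+) odd i)) (s + i.*2).+2.
Proof. by rewrite /lx /= addbN doubleS !addnS. Qed.

Lemma ly_nbr d b s i u : s + i.*2.+2 <= n -> @sadj G (ly d b s i) u ->
  u = lx d b s i.+1 \/ @sadj G (lx d b s i) u.
Proof.
move=> sn /wv_nbr[]; first by lia.
- by move=> ->; right; rewrite /lx; apply: wv_rung; lia.
- by move=> ->; left; rewrite lxS.
- by move=> ->; right; rewrite negbK; apply: wv_next; lia.
Qed.

Lemma lx_inj d b s i j : s + i.*2 <= n -> s + j.*2 <= n -> i.*2 < n -> j.*2 < n ->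
  lx d b s i = lx d b s j -> i = j.
Proof. by move=> si sj il jl /wv_inj[//|//|_]; lia. Qed.

Local Notation "K ~~h L" := (homotopy_equivalent R (geom R K) (geom R L)) (at level 70).

(** The zigzag may end in two ways: the set prolonged by one more vertex is forbidden, as a critical
    cell kept aside, or the next vertex cannot occur anyway. Every other forbidden set must avoid
    the [ly], or contain some other vertex excluded by the start of the zigzag alone. *)
Lemma ladder_chain d b s l (ts : seq {set G}) : s + l.*2.+2 <= n ->
  (prefix_set (lx d b s) l.+2 \in ts \/
   excluded ts (prefix_set (lx d b s) l.+1) (lx d b s l.+1)) ->
  (forall t, t \in ts -> [\/ forall i, i <= l -> ly d b s i \notin t,
     exists2 u, u \in t & excluded ts [set lx d b s 0]%SET u /\
       forall i, i <= l -> ly d b s i != u |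
     t = prefix_set (lx d b s) l.+2]) ->
  dels (Ind G) ts ~~h dels (Ind G) ([set lx d b s 0]%SET :: ts).
Proof.
move=> sn xl tT; rewrite -[[set _]%SET]finset.setU0.
have xy i : i <= l -> ly d b s i != lx d b s i.+1.
  by move=> il; rewrite lxS /ly; apply/eqP => /wv_inj[||_]; lia.
apply: (@graph_chain _ _ _ _ _ (ly d b s) l).
- move=> i il; rewrite finset.set0U; apply/prefix_setP => -[j ji].
  by rewrite /ly /lx => /wv_inj[||_]; lia.
- exact: xy.
- move=> i u il /ly_nbr[|->|xu]; [by lia|by left|right; right].
  exists (lx d b s i) => //; rewrite finset.set0U.
  by apply/prefix_setP; exists i.
- rewrite finset.set0U; case: xl => [xl|//]; left.
  by exists (prefix_set (lx d b s) l.+2); rewrite // (prefix_setS _ l.+1).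
- move=> i t il tts yt; have [/(_ _ il)|[u ut [uex uy]]|tE] := tT t tts.
  + by rewrite yt.
  + exists u => //; split; first by rewrite eq_sym uy.
    right; apply: excluded_sub uex; rewrite finset.set0U finset.sub1set.
    by apply/prefix_setP; exists 0.
  + exists (lx d b s i.+1); first by rewrite tE; apply/prefix_setP; exists i.+1.
    by split; [rewrite eq_sym xy|left].
Qed.

Lemma card_lx d b s m : s + m.-1.*2 <= n -> m.-1.*2 < n ->
  #|prefix_set (lx d b s) m| = m.
Proof.
move=> sm mn; rewrite card_imset ?card_ord // => i j.
have il : i <= m.-1 by have := ltn_ord i; lia.
have jl : j <= m.-1 by have := ltn_ord j; lia.
by move=> /lx_inj xij; apply: val_inj; apply: xij; lia.
Qed.

(** The zigzag dominates all vertices except possibly two corners: the one opposite its last row in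
    column [n.-1], if it stops in column [n - 2], and the one opposite its first row in column 0, if
    it starts in column 1. If it occupies both columns 0 and [n.-1], the parity hypothesis puts its
    ends in different rows. *)
Lemma ladder_critical d b s m (ts : seq {set G}) : 0 < m -> s <= 1 ->
  n <= s + m.*2 -> s + m.-1.*2 < n -> (m.-1.*2 = n.-1 -> odd m.-1) ->
  (forall t, t \in ts -> exists r, t = [set r]%SET /\
     forall i, i < m -> lx d b s i != r) ->
  (s + m.*2 = n -> excluded ts (prefix_set (lx d b s) m)
     (wv d (~~ (b (+) odd m.-1)) n.-1)) ->
  (s = 1 -> excluded ts (prefix_set (lx d b s) m) (wv d (~~ b) 0)) ->
  critical ts (prefix_set (lx d b s) m).
Proof.
move=> m0 s1 nsm smn mn tr corner0 corner1.
have xin i : i < m -> lx d b s i \in prefix_set (lx d b s) m.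
  by move=> im; apply/prefix_setP; exists i.
split.
- by apply/finset.set0Pn; exists (lx d b s 0); exact: xin.
- suff indep : forall i j, i < m -> j < m -> i <= j -> ~~ @sadj G (lx d b s i) (lx d b s j).
    apply/independentP => u v /prefix_setP[i im ->] /prefix_setP[j jm ->].
    by case/orP: (leq_total i j) => ij; [|rewrite sadj_sym]; exact: indep.
  move=> i j im jm ij; rewrite /lx wv_sadj; [|by lia|by lia].
  apply/negP => /orP[/andP[/eqP bb /orP[/eqP|/eqP ijn]]|/andP[bb /orP[/eqP ij'|/eqP]]];
    try lia.
- move=> t /tr[r [-> rx]]; rewrite finset.sub1set; apply/prefix_setP => -[i im ri].
  by have := rx i im; rewrite ri eqxx.
move=> u us; suff : excluded ts (prefix_set (lx d b s) m) u.
  by case=> [|?]; [right|left].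
have adj i : i < m -> @sadj G (lx d b s i) u -> excluded ts (prefix_set (lx d b s) m) u.
  by move=> im xu; right; exists (lx d b s i) => //; exact: xin.
have [b' [c [cn uE]]] := wv_surj d u.
have [cs|sc] := ltnP c s.
  have c0 : c = 0 by lia.
  have s1' : s = 1 by lia.
  case: (b' =P b) => [bb|/eqP bb].
    by apply: (adj 0) => //; rewrite uE bb c0 /lx s1' addbF; apply: wv_prev; lia.
  by rewrite uE c0 (_ : b' = ~~ b); [exact: corner1|case: (b') (b) bb => -[]].
pose i := (c - s)./2; have im : i < m by rewrite /i; lia.
have [codd|ceven] := boolP (odd (c - s)); last first.
  have cE : c = s + i.*2 by rewrite /i; lia.
  case: (b' =P b (+) odd i) => [bb|/eqP bb].
    by move: us; rewrite uE bb cE xin.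
  apply: (adj i) => //; rewrite uE cE (_ : b' = ~~ (b (+) odd i)).
    by apply: wv_rung; lia.
  by case: (b') (b (+) odd i) bb => -[].
have cE : c = (s + i.*2).+1 by rewrite /i; lia.
case: (b' =P b (+) odd i) => [bb|/eqP bb].
  by apply: (adj i) => //; rewrite uE bb cE; apply: wv_next; lia.
have {}bb : b' = ~~ (b (+) odd i) by case: (b') (b (+) odd i) bb => -[].
have [im'|im'] := ltnP i.+1 m.
  by apply: (adj i.+1) => //; rewrite uE bb cE lxS; apply: wv_prev; lia.
have iE : i = m.-1 by lia.
rewrite uE bb iE (_ : c = n.-1); last by lia.
by apply: corner0; lia.
Qed.

Lemma wv_dir b : wv false b 0 = wv true b 0.
Proof. by rewrite wv_flip // subn0 wv_n. Qed.

(** The apex is [wv true false 0], whose neighbours are the three forbidden vertices; for [n = 2]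
    its two row neighbours coincide. *)
Lemma ladder_cone (ts : seq {set G}) :
  (forall t, t \in ts -> t != finset.set0) ->
  [set wv true false 1]%SET \in ts -> [set wv false false 1]%SET \in ts ->
  [set wv true true 0]%SET \in ts ->
  (forall t, t \in ts -> [|| wv true false 1 \in t, wv false false 1 \in t
     | wv true true 0 \in t]) ->
  contractible R (geom R (dels (Ind G) ts)).
Proof.
move=> t0 u1 um w0 tT; apply: (@graph_cone _ _ _ (wv true false 0)) => //.
  move=> u; have [b [c [cn ->]]] := wv_surj true u.
  rewrite wv_sadj //; last by lia.
  case/orP=> /andP[/eqP bb /orP[/eqP cc|/eqP cc]].
  - by rewrite -bb cc.
  - rewrite -bb (_ : c = n - 1) ?(@wv_flip true) ?subKn //; lia.
  - by rewrite -cc; case: b bb.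
  - by exfalso; lia.
move=> t /tT/or3P[] ut _.
- exists (wv true false 1) => //; split => //; apply/eqP => /wv_inj[||_]; lia.
- exists (wv false false 1) => //; split => //; apply/eqP; rewrite -wv_dir => /wv_inj[||_]; lia.
- by exists (wv true true 0) => //; split => //; apply/eqP => /wv_inj[].
Qed.

(** The candidate critical cells: the zigzags that start at the three neighbours of the final cone
    apex [wv true false 0]. *)
Let C1 m := prefix_set (lx true true 0) m.
Let C2 m := prefix_set (lx true false 1) m.
Let C3 m := prefix_set (lx false false 1) m.

Let in_C d b s m i u : i < m -> u = lx d b s i -> u \in prefix_set (lx d b s) m.
Proof. by move=> im ->; apply/prefix_setP; exists i. Qed.

Let C_neq0 d b s m : 0 < m -> prefix_set (lx d b s) m != finset.set0.
Proof.
by move=> m0; apply/finset.set0Pn; exists (lx d b s 0); exact: (@in_C _ _ _ _ 0).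
Qed.

Let w0C1 m : 0 < m -> wv true true 0 \in C1 m.
Proof. by move=> m0; exact: (@in_C _ _ _ _ 0). Qed.

Let u1C2 m : 0 < m -> wv true false 1 \in C2 m.
Proof. by move=> m0; exact: (@in_C _ _ _ _ 0). Qed.

Let umC3 m : 0 < m -> wv false false 1 \in C3 m.
Proof. by move=> m0; exact: (@in_C _ _ _ _ 0). Qed.

Let u1E : wv true false 1 = wv false false n.-1.
Proof. by rewrite wv_flip; [congr wv; lia|lia]. Qed.

Let set1_neq0 (u : G) : [set u]%SET != finset.set0.
Proof. by apply/finset.set0Pn; exists u; rewrite inE. Qed.

Let notin1 (u v : G) : u <> v -> u \notin [set v]%SET.
Proof. by move=> uv; rewrite inE; apply/eqP. Qed.

Let exc1 (ts : seq {set G}) C u : [set u]%SET \in ts -> excluded ts C u.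
Proof. exact: excluded1. Qed.

(** The zigzags of [C1] and [C2] come back to a neighbour of their start, so these two starts are
    deleted for free. Their absence makes the third zigzag maximal. *)
Lemma ladder_4k1 k : n = 4 * k + 1 ->
  homotopy_equivalent R (geom R (Ind G)) (sphere R (2 * k - 1)).
Proof.
move=> nk; have k0 : 0 < k by lia.
rewrite -(dels0 (Ind G)).
apply: homotopy_equivalent_trans (@ladder_chain true true 0 (2 * k - 1) [::] _ _ _) _ => //.
- by lia.
- right; right; exists (lx true true 0 0); first exact: (@in_C _ _ _ _ 0).
  rewrite /lx wv_sadj; [|by lia|by lia].
  by apply/orP; left; lia.
apply: homotopy_equivalent_trans (@ladder_chain true false 1 (2 * k - 1) _ _ _ _) _.
- by lia.
- right; right; exists (lx true false 1 0); first exact: (@in_C _ _ _ _ 0).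
  rewrite lxS (_ : (1 + _).+2 = n); last by lia.
  rewrite wv_n sadj_sym (_ : ~~ _ = false); last by lia.
  by apply: wv_next; lia.
- move=> t; rewrite !inE => /eqP ->; constructor 1 => i il.
  by apply: notin1 => /wv_inj[||_]; lia.
apply: homotopy_equivalent_trans (sphere_wedge1 R (2 * k - 1)).
set ts := (X in dels _ X).
apply: (@graph_bouquet _ _ ts [:: C3 (2 * k)]) => //.
- move=> s; rewrite inE => /eqP ->; apply: ladder_critical; try lia.
  + move=> t; rewrite !inE => /orP[] /eqP ->.
      exists (wv true false 1); split => // i im; apply/eqP.
      by rewrite u1E => /wv_inj[||_]; lia.
    exists (wv true true 0); split => // i im; apply/eqP.
    by rewrite -wv_dir => /wv_inj[||_]; lia.
  + move=> _; apply: exc1; rewrite (_ : ~~ _ = false); last by lia.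
    by rewrite -u1E !inE eqxx.
  + by move=> _; apply: exc1; rewrite (wv_dir (~~ false)) !inE eqxx orbT.
- rewrite /C3 /= card_lx; try lia; congr (_ :: _); lia.
rewrite /=.
pose ts' := [set wv false false 1]%SET :: C3 (2 * k) :: ts.
apply: (homotopy_equivalent_trans (Y := geom R (dels (Ind G) ts'))).
  apply: (@ladder_chain false false 1 (2 * k - 2)).
  - by lia.
  - by left; rewrite (_ : (2 * k - 2).+2 = 2 * k) ?mem_head //; lia.
  - move=> t; rewrite !inE => /or3P[] /eqP ->.
    + by constructor 3; rewrite (_ : (2 * k - 2).+2 = 2 * k) //; lia.
    + constructor 1 => i il; apply: (@notin1 _ (wv true false 1)); rewrite u1E => /wv_inj[||_]; lia.
    + constructor 1 => i il; apply: (@notin1 _ (wv true true 0)); rewrite -wv_dir => /wv_inj[||_]; lia.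
apply: ladder_cone; rewrite ?inE ?eqxx ?orbT //.
- move=> t; rewrite !inE => /or4P[] /eqP ->; rewrite ?set1_neq0 ?C_neq0 //; lia.
- move=> t; rewrite !inE => /or4P[] /eqP ->; rewrite ?inE ?eqxx ?orbT // umC3 ?orbT //; lia.
Qed.

(** The zigzag from column 0 arrives in column [n.-1] in the other row, so it is independent and
    maximal. With its start deleted, the two other zigzags run into the missing vertex
    [wv true true 0]. *)
Lemma ladder_4k3 k : n = 4 * k + 3 ->
  homotopy_equivalent R (geom R (Ind G)) (sphere R (2 * k + 1)).
Proof.
move=> nk; rewrite -(dels0 (Ind G)).
apply: homotopy_equivalent_trans (sphere_wedge1 R (2 * k + 1)).
apply: (@graph_bouquet _ _ [::] [:: C1 (2 * k + 2)]) => //.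
- move=> s; rewrite inE => /eqP ->; apply: ladder_critical => //; lia.
- rewrite /C1 /= card_lx; try lia; congr (_ :: _); lia.
rewrite cats0.
pose ts1 := [set wv true true 0]%SET :: [:: C1 (2 * k + 2)].
apply: (homotopy_equivalent_trans (Y := geom R (dels (Ind G) ts1))).
  apply: (@ladder_chain true true 0 (2 * k)).
  - by lia.
  - by left; rewrite (_ : (2 * k).+2 = 2 * k + 2) ?mem_head //; lia.
  - by move=> t; rewrite inE => /eqP ->; constructor 3; congr prefix_set; lia.
pose ts2 := [set wv true false 1]%SET :: ts1.
apply: (homotopy_equivalent_trans (Y := geom R (dels (Ind G) ts2))).
  apply: (@ladder_chain true false 1 (2 * k)).
  - by lia.
  - right; apply: exc1; rewrite lxS (_ : (1 + _).+2 = n); last by lia.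
    have -> : ~~ (false (+) odd (2 * k)) = true by lia.
    by rewrite wv_n mem_head.
  - move=> t; rewrite !inE => /orP[] /eqP ->.
      constructor 1 => i il; apply: (@notin1 _ (wv true true 0)).
      by move=> /wv_inj[||?]; lia.
    constructor 2; exists (wv true true 0); first by apply: w0C1; lia.
    split; first by apply: exc1; rewrite mem_head.
    by move=> i il; apply/eqP => /wv_inj[||?]; lia.
pose ts3 := [set wv false false 1]%SET :: ts2.
apply: (homotopy_equivalent_trans (Y := geom R (dels (Ind G) ts3))).
  apply: (@ladder_chain false false 1 (2 * k)).
  - by lia.
  - right; apply: exc1; rewrite lxS (_ : (1 + _).+2 = n); last by lia.
    have -> : ~~ (false (+) odd (2 * k)) = true by lia.
    by rewrite wv_n wv_dir !inE eqxx orbT.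
  - move=> t; rewrite !inE => /or3P[] /eqP ->.
    + constructor 1 => i il; apply: (@notin1 _ (wv true false 1)).
      by rewrite u1E => /wv_inj[||?]; lia.
    + constructor 1 => i il; apply: (@notin1 _ (wv true true 0)).
      by rewrite -wv_dir => /wv_inj[||?]; lia.
    + constructor 2; exists (wv true true 0); first by apply: w0C1; lia.
      split; first by apply: exc1; rewrite !inE eqxx orbT.
      by move=> i il; apply/eqP; rewrite -wv_dir => /wv_inj[||?]; lia.
apply: ladder_cone; rewrite ?inE ?eqxx ?orbT //.
- move=> t; rewrite !inE => /or4P[] /eqP ->; rewrite ?set1_neq0 ?C_neq0 //; lia.
- move=> t; rewrite !inE => /or4P[] /eqP ->; rewrite ?inE ?eqxx ?orbT // w0C1 ?orbT //; lia.
Qed.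

(** The zigzag from column 0 returns to column 0 in the other row, at the far end of the rung of its
    start, so this start goes for free. Then [C2] is maximal, and the zigzag of [C3] ends at the
    deleted start of [C2]. *)
Lemma ladder_4k2 k : n = 4 * k + 2 ->
  homotopy_equivalent R (geom R (Ind G)) (sphere R (2 * k)).
Proof.
move=> nk; rewrite -(dels0 (Ind G)).
pose ts1 := [:: [set wv true true 0]%SET].
apply: (homotopy_equivalent_trans (Y := geom R (dels (Ind G) ts1))).
  apply: (@ladder_chain true true 0 (2 * k) [::]) => //.
  - by lia.
  - right; right; exists (lx true true 0 0); first exact: (@in_C _ _ _ _ 0).
    rewrite lxS (_ : (0 + _).+2 = n); last by lia.
    have -> : ~~ (true (+) odd (2 * k)) = ~~ true by lia.
    by rewrite wv_n; exact: wv_rung.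
apply: homotopy_equivalent_trans (sphere_wedge1 R (2 * k)).
apply: (@graph_bouquet _ _ ts1 [:: C2 (2 * k + 1)]) => //.
- move=> s; rewrite inE => /eqP ->; apply: ladder_critical; try lia.
  + move=> t; rewrite !inE => /eqP ->.
    by exists (wv true true 0); split => // i im; apply/eqP => /wv_inj[||?]; lia.
  + by move=> _; apply: exc1; rewrite mem_head.
- rewrite /C2 /= card_lx; try lia; congr (_ :: _); lia.
(* For [k = 0] the critical cell is a single vertex, which is at once both row neighbours of the
   apex, and no chain is left to run. *)
rewrite cat1s; have [k0|k0] := posnP k.
  have C2E : C2 (2 * k + 1) = [set wv true false 1]%SET.
    apply/setP => v; rewrite inE k0; apply/prefix_setP/eqP => [[[|i] //]|->].
    by exists 0.
  have um : wv false false 1 = wv true false 1 by rewrite wv_flip; [congr wv; lia|lia].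
  apply: ladder_cone; rewrite ?um ?C2E ?inE ?eqxx ?orbT //.
  - by move=> t; rewrite !inE => /orP[] /eqP ->; exact: set1_neq0.
  - by move=> t; rewrite !inE => /orP[] /eqP ->; rewrite !inE eqxx ?orbT.
pose ts2 := [set wv true false 1]%SET :: C2 (2 * k + 1) :: ts1.
apply: (homotopy_equivalent_trans (Y := geom R (dels (Ind G) ts2))).
  apply: (@ladder_chain true false 1 (2 * k - 1)).
  - by lia.
  - by left; rewrite (_ : (2 * k - 1).+2 = 2 * k + 1) ?mem_head //; lia.
  - move=> t; rewrite !inE => /orP[] /eqP ->.
      by constructor 3; congr prefix_set; lia.
    constructor 1 => i il; apply: (@notin1 _ (wv true true 0)).
    by move=> /wv_inj[||?]; lia.
pose ts3 := [set wv false false 1]%SET :: ts2.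
apply: (homotopy_equivalent_trans (Y := geom R (dels (Ind G) ts3))).
  apply: (@ladder_chain false false 1 (2 * k - 1)).
  - by lia.
  - right; apply: exc1; rewrite lxS (_ : (1 + _).+2 = n.-1); last by lia.
    have -> : ~~ (false (+) odd (2 * k - 1)) = false by lia.
    by rewrite -u1E mem_head.
  - move=> t; rewrite !inE => /or3P[] /eqP ->.
    + constructor 1 => i il; apply: (@notin1 _ (wv true false 1)).
      by rewrite u1E => /wv_inj[||?]; lia.
    + constructor 2; exists (wv true false 1); first by apply: u1C2; lia.
      split; first by apply: exc1; rewrite mem_head.
      by move=> i il; apply/eqP; rewrite u1E => /wv_inj[||?]; lia.
    + constructor 1 => i il; apply: (@notin1 _ (wv true true 0)).
      by rewrite -wv_dir => /wv_inj[||?]; lia.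
apply: ladder_cone; rewrite ?inE ?eqxx ?orbT //.
- move=> t; rewrite !inE => /or4P[] /eqP ->; rewrite ?set1_neq0 ?C_neq0 //; lia.
- move=> t; rewrite !inE => /or4P[] /eqP ->; rewrite ?inE ?eqxx ?orbT // u1C2 ?orbT //; lia.
Qed.

(** All three zigzags are maximal without any previous deletion: the corner left free at one end is
    adjacent to the other end. *)
Lemma ladder_4k k : n = 4 * k ->
  homotopy_equivalent R (geom R (Ind G)) (sphere_wedge R (nseq 3 (2 * k - 1))).
Proof.
move=> nk; rewrite -(dels0 (Ind G)).
(* The last vertices of [C2] and [C3] are the two row neighbours of [wv true true 0]. They prevent
   the chain from that vertex from completing either of these kept cells. *)
have w1C3 : wv false true n.-1 \in C3 (2 * k).
  apply: (@in_C _ _ _ _ (2 * k - 1)); first by lia.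
  by rewrite /lx; congr wv; lia.
have wmC2 : wv true true n.-1 \in C2 (2 * k).
  apply: (@in_C _ _ _ _ (2 * k - 1)); first by lia.
  by rewrite /lx; congr wv; lia.
have w1E : wv false true n.-1 = wv true true 1 by rewrite wv_flip; [congr wv; lia|lia].
have C12 : C1 (2 * k) != C2 (2 * k).
  apply/eqP => CC; have := w0C1 (_ : 0 < 2 * k); rewrite CC => /(_ ltac:(lia)).
  by move=> /prefix_setP[i ik /wv_inj[||?]]; lia.
have C13 : C1 (2 * k) != C3 (2 * k).
  apply/eqP => CC; have := w0C1 (_ : 0 < 2 * k); rewrite CC => /(_ ltac:(lia)).
  by rewrite -wv_dir => /prefix_setP[i ik /wv_inj[||?]]; lia.
have C23 : C2 (2 * k) != C3 (2 * k).
  apply/eqP => CC; have := w1C3; rewrite -CC w1E.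
  by move=> /prefix_setP[i ik /wv_inj[||?]]; lia.
have crit d m b s : s <= 1 -> m = 2 * k -> critical [::] (prefix_set (lx d b s) m).
  move=> s1 mE; apply: ladder_critical => //; try lia.
    move=> sm; right; exists (lx d b s 0); first by apply: (@in_C _ _ _ _ 0); [lia|].
    have -> : s = 0 by lia.
    have -> : odd m.-1 = true by lia.
    rewrite /lx wv_sadj; [|by lia|by lia]; rewrite addbT negbK addbF eqxx /=.
    by apply/orP; left; lia.
  move=> s1'; right; exists (lx d b s (2 * k - 1)).
    by apply: (@in_C _ _ _ _ (2 * k - 1)); [lia|].
  have o2k : odd (2 * k - 1) = true by lia.
  rewrite sadj_sym /lx wv_sadj; [|by lia|by lia]; rewrite o2k addbT eqxx /=.
  by apply/orP; left; lia.
apply: (@graph_bouquet _ _ [::] [:: C1 (2 * k); C2 (2 * k); C3 (2 * k)]) => //.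
- by rewrite /= !inE negb_or C12 C13 C23.
- by move=> s; rewrite !inE => /or3P[] /eqP ->; apply: crit.
- by rewrite /C1 /C2 /C3 /= !card_lx; try lia; congr [:: _; _; _]; lia.
rewrite cats0; set ts0 := [:: _; _; _].
pose ts1 := [set wv true true 0]%SET :: ts0.
apply: (homotopy_equivalent_trans (Y := geom R (dels (Ind G) ts1))).
  apply: (@ladder_chain true true 0 (2 * k - 2)).
  - by lia.
  - by left; rewrite (_ : (2 * k - 2).+2 = 2 * k) ?mem_head //; lia.
  - move=> t; rewrite !inE => /or3P[] /eqP ->.
    + by constructor 3; congr prefix_set; lia.
    + constructor 2; exists (wv true true n.-1) => //; split.
        right; exists (wv true true 0); first by rewrite inE.
        by rewrite wv_sadj; [apply/orP; left; lia|by lia|by lia].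
      by move=> i il; apply/eqP => /wv_inj[||?]; lia.
    + constructor 2; exists (wv false true n.-1) => //; rewrite w1E; split.
        by right; exists (wv true true 0); [rewrite inE|apply: wv_next; lia].
      by move=> i il; apply/eqP => /wv_inj[||?]; lia.
pose ts2 := [set wv true false 1]%SET :: ts1.
apply: (homotopy_equivalent_trans (Y := geom R (dels (Ind G) ts2))).
  apply: (@ladder_chain true false 1 (2 * k - 2)).
  - by lia.
  - by left; rewrite (_ : (2 * k - 2).+2 = 2 * k) ?inE ?eqxx ?orbT //; lia.
  - move=> t; rewrite !inE => /or4P[] /eqP ->.
    + constructor 1 => i il; apply: (@notin1 _ (wv true true 0)).
      by move=> /wv_inj[||?]; lia.
    + constructor 2; exists (wv true true 0); first by apply: w0C1; lia.
      split; first by apply: exc1; rewrite mem_head.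
      by move=> i il; apply/eqP => /wv_inj[||?]; lia.
    + by constructor 3; congr prefix_set; lia.
    + constructor 2; exists (wv false true n.-1) => //; rewrite w1E; split.
        by right; exists (wv true false 1); [rewrite inE|apply: (@wv_rung true false); lia].
      by move=> i il; apply/eqP => /wv_inj[||?]; lia.
pose ts3 := [set wv false false 1]%SET :: ts2.
apply: (homotopy_equivalent_trans (Y := geom R (dels (Ind G) ts3))).
  apply: (@ladder_chain false false 1 (2 * k - 2)).
  - by lia.
  - by left; rewrite (_ : (2 * k - 2).+2 = 2 * k) ?inE ?eqxx ?orbT //; lia.
  - move=> t; rewrite inE => /predU1P[->|].
      constructor 1 => i il; apply: (@notin1 _ (wv true false 1)).
      by rewrite u1E => /wv_inj[||?]; lia.
    rewrite !inE => /or4P[] /eqP ->.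
    + constructor 1 => i il; apply: (@notin1 _ (wv true true 0)).
      by rewrite -wv_dir => /wv_inj[||?]; lia.
    + constructor 2; exists (wv true true 0); first by apply: w0C1; lia.
      split; first by apply: exc1; rewrite !inE eqxx orbT.
      by move=> i il; apply/eqP; rewrite -wv_dir => /wv_inj[||?]; lia.
    + constructor 2; exists (wv true false 1); first by apply: u1C2; lia.
      split; first by apply: exc1; rewrite !inE eqxx.
      by move=> i il; apply/eqP; rewrite u1E => /wv_inj[||?]; lia.
    + by constructor 3; congr prefix_set; lia.
have k20 : 0 < 2 * k by lia.
apply: ladder_cone; rewrite ?inE ?eqxx ?orbT //.
- move=> t; rewrite inE => /predU1P[->|]; first exact: set1_neq0.
  rewrite inE => /predU1P[->|]; first exact: set1_neq0.
  by rewrite !inE => /or4P[] /eqP ->; rewrite ?set1_neq0 ?C_neq0.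
- move=> t; rewrite inE => /predU1P[->|]; first by rewrite !inE eqxx orbT.
  rewrite inE => /predU1P[->|]; first by rewrite !inE eqxx.
  rewrite !inE => /or4P[] /eqP ->; rewrite ?inE ?eqxx ?orbT //.
  + by rewrite w0C1 ?orbT.
  + by rewrite u1C2.
  + by rewrite umC3 ?orbT.
Qed.

End Prism.

(** * Perfect matchings of the ladder *)

Section Labels.
Variable n : nat.
Hypothesis n_gt2 : 2 < n.
Let G := circular_ladder n.
Let n_ge2 : 2 <= n := ltnW n_gt2.
Local Notation vx := (vx n_ge2).

(* [inl (i, b)] is the edge of row [b] from column [i] to column [i + 1];
   [inr i] is the rung of column [i]. *)
Definition label : finType := (('I_n * bool) + 'I_n)%type.

Definition edge_of (x : label) : {set G} := match x with
  | inl (i, b) => [set vx b i; vx b (ordS i)]%SET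
  | inr i => [set vx false i; vx true i]%SET
  end.

Lemma ordS_val (i : 'I_n) : ordS i = (if i.+1 == n then 0 else i.+1) :> nat.
Proof.
have il := ltn_ord i; rewrite /=; case: eqP => [->|ni]; first by rewrite modnn.
by rewrite modn_small //; lia.
Qed.

Lemma ordS_neq (i : 'I_n) : ordS i != i.
Proof. by apply/eqP => /(congr1 (@nat_of_ord n)); rewrite ordS_val; case: eqP; lia. Qed.

Lemma ordS2_neq (i : 'I_n) : ordS (ordS i) != i.
Proof.
apply/eqP => /(congr1 (@nat_of_ord n)); rewrite !ordS_val.
by case: (i.+1 =P n) => ?; case: eqP; lia.
Qed.

Lemma vx_surj (v : G) : exists b (i : 'I_n), v = vx b i.
Proof.
have [b [c [cn ->]]] := wv_surj n_ge2 true v.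
by exists b, (Ordinal cn).
Qed.

Lemma vx_eq b b' (i j : 'I_n) : (vx b i == vx b' j) = (b == b') && (i == j).
Proof.
apply/eqP/andP => [/(@wv_inj _ n_ge2 true)|[/eqP-> /eqP->] //].
have il := ltn_ord i; have jl := ltn_ord j.
case=> [||-> ij]; [lia|lia|split => //]; apply/eqP/val_inj => /=; lia.
Qed.

Lemma sadj_vxE b b' (i j : 'I_n) : @sadj G (vx b i) (vx b' j) =
  if b == b' then (j == ordS i) || (i == ordS j) else i == j.
Proof.
have il := ltn_ord i; have jl := ltn_ord j.
rewrite sadj_vx //; case: (b == b') => //; rewrite -!(inj_eq (@ord_inj n)) !ordS_val.
by case: (i.+1 =P n); case: (j.+1 =P n); lia.
Qed.

Lemma mem_edge_row b b' (i j : 'I_n) :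
  (vx b' j \in edge_of (inl (i, b))) = (b' == b) && ((j == i) || (j == ordS i)).
Proof. by rewrite !inE !vx_eq -andb_orr. Qed.

Lemma mem_edge_rung b' (i j : 'I_n) : (vx b' j \in edge_of (inr i)) = (j == i).
Proof. by rewrite !inE !vx_eq -andb_orl; case: b'. Qed.

(** This is where [2 < n] matters: for [n = 2] the two labels of a row denote the same edge. *)
Lemma edge_of_inj : injective edge_of.
Proof.
move=> [[i b]|i] [[j b']|j] E.
- have := mem_edge_row b b i i; rewrite E mem_edge_row !eqxx /=.
  case/andP=> /eqP bb; rewrite -{}bb in E *; case/orP=> [/eqP->//|/eqP ij].
  have := mem_edge_row b b j j; rewrite -E mem_edge_row !eqxx /=.
  by rewrite ij eq_sym (negbTE (ordS_neq _)) /= eq_sym (negbTE (ordS2_neq _)).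
- have := mem_edge_rung (~~ b) j j; rewrite -E mem_edge_row eqxx.
  by case: b {E}.
- have := mem_edge_rung (~~ b') i i; rewrite E mem_edge_row eqxx.
  by case: b' {E}.
- by have := mem_edge_rung true i i; rewrite E mem_edge_rung eqxx => /eqP ->.
Qed.

Lemma edgesP (e : {set G}) : reflect (exists x, e = edge_of x) (e \in edges G).
Proof.
rewrite inE; apply: (iffP existsP) => [[u /existsP[v /andP[uv /eqP ->]]]|[x ->]].
  have [b [i uE]] := vx_surj u; have [b' [j vE]] := vx_surj v.
  move: uv; rewrite uE vE sadj_vxE; case: (b =P b') => [<-|bb].
    by case/orP=> /eqP ->; [exists (inl (i, b))|exists (inl (j, b)); rewrite finset.setUC].
  move/eqP=> <-; exists (inr i); case: b b' bb {uE vE} => -[] //= _.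
  by rewrite finset.setUC.
case: x => [[i b]|i].
  exists (vx b i); apply/existsP; exists (vx b (ordS i)).
  by rewrite eqxx andbT sadj_vxE !eqxx.
exists (vx false i); apply/existsP; exists (vx true i).
by rewrite eqxx andbT sadj_vxE eqxx.
Qed.

Lemma matchingP (A : {set label}) : reflect
  (forall x y v, x \in A -> y \in A -> v \in edge_of x -> v \in edge_of y -> x = y)
  (matching (edge_of @: A)%SET).
Proof.
have sub : (edge_of @: A)%SET \subset edges G.
  by apply/fintype.subsetP => _ /imsetP[x _ ->]; apply/edgesP; exists x.
rewrite /matching sub /=; apply: (iffP finset.trivIsetP) => [tA x y v xA yA vx' vy|tA].
  apply: contraTeq vx' => xy; apply/negP => vx'.
  have := tA _ _ (imset_f edge_of xA) (imset_f edge_of yA).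
  rewrite (inj_eq edge_of_inj) => /(_ xy)/pred0P/(_ v) /=.
  by rewrite vx' vy.
move=> _ _ /imsetP[x xA ->] /imsetP[y yA ->] xy; apply/pred0P => v /=.
apply: contraNF xy => /andP[vx' vy]; apply/eqP; congr edge_of.
exact: tA vx' vy.
Qed.

(* Row edges of consecutive columns are adjacent even when they lie in different
   rows, and are then disjoint: the perfect matchings that contain such a pair are
   the [alternating] ones. The two extra vertices cone these off. *)
Definition rung_adj (u v : label + bool) : bool := match u, v with
  | inl (inl (i, _)), inl (inl (j, _)) => (j == ordS i) || (i == ordS j)
  | inl (inl (i, _)), inl (inr j) => (j == i) || (j == ordS i)
  | inl (inr j), inl (inl (i, _)) => (j == i) || (j == ordS i)
  | inl (inr _), inr _ => true
  | inr _, inl (inr _) => true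
  | inr x, inr y => x != y
  | _, _ => false
  end.

Lemma rung_adj_sym : symmetric rung_adj.
Proof. by move=> [[[i b]|i]|x] [[[j b']|j]|y] //=; [rewrite orbC|rewrite eq_sym]. Qed.

Lemma rung_adj_irrefl : irreflexive rung_adj.
Proof.
move=> [[[i b]|i]|x] //=; last by rewrite eqxx.
by rewrite eq_sym (negbTE (ordS_neq i)).
Qed.

Definition rung_graph : sgraph := SGraph rung_adj_sym rung_adj_irrefl.

(* The two perfect matchings in which the edges of the rows alternate; they
   exist for even [n] only. *)
Definition alternating (p : bool) : {set label} :=
  [set x : label | if x is inl (i, b) then b == odd i (+) p else false]%SET.

Lemma alternating_row p (i : 'I_n) b : (inl (i, b) \in alternating p) = (b == odd i (+) p).
Proof. by rewrite inE. Qed.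

Lemma alternating_rung p (i : 'I_n) : (inr i \in alternating p) = false.
Proof. by rewrite inE. Qed.

Definition compatible (A : {set label}) : bool :=
  @independent rung_graph (inl @: A)%SET.

Lemma compatibleP (A : {set label}) :
  reflect (forall x y, x \in A -> y \in A -> ~~ rung_adj (inl x) (inl y)) (compatible A).
Proof.
apply: (iffP (independentP _)) => [iA x y xA yA|iA _ _ /imsetP[x xA ->] /imsetP[y yA ->]].
  by apply: (iA (inl x) (inl y)); exact: imset_f.
exact: iA.
Qed.

Lemma compatible_matching (A : {set label}) : compatible A -> matching (edge_of @: A)%SET.
Proof.
move=> /compatibleP iA; apply/matchingP => x y v xA yA.
have := iA x y xA yA; have [b0 [k ->]] := vx_surj v; case: x xA => [[i b]|i] xA.
  rewrite mem_edge_row; case: y yA => [[j b']|j] yA; last first.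
    rewrite mem_edge_rung /= => + /andP[_] + /eqP kj; rewrite kj.
    by move=> /negbTE ->.
  rewrite mem_edge_row /= negb_or => /andP[ji ij] /andP[/eqP <- ki] /andP[/eqP <- kj].
  case/orP: ki => /eqP ki; case/orP: kj => /eqP kj.
  - by rewrite -ki -kj.
  - by move: ij; rewrite -ki kj eqxx.
  - by move: ji; rewrite -kj ki eqxx.
  - by rewrite (can_inj (@ordSK n) (etrans (esym ki) kj)).
rewrite mem_edge_rung; case: y yA => [[j b']|j] yA.
  rewrite mem_edge_row /= => + /eqP ki /andP[_]; rewrite ki.
  by move=> /negbTE ->.
by rewrite mem_edge_rung => _ /eqP <- /eqP <-.
Qed.

(** Completing the set: both row edges are taken wherever one of them is present, and the rung is
    taken in every column left uncovered. *)
Lemma pm_faces_compatible (A : {set label}) : compatible A ->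
  (edge_of @: A)%SET \in pm_faces G.
Proof.
move=> cA; rewrite inE compatible_matching //=; apply/existsP.
pose used i := (inl (i, false) \in A) || (inl (i, true) \in A).
pose B : {set label} := [set x : label | match x with
  | inl (i, _) => used i
  | inr i => ~~ used i && [forall j, (ordS j == i) ==> ~~ used j] end]%SET.
have usedP i : reflect (exists b, inl (i, b) \in A) (used i).
  by apply: (iffP orP) => [[]|[[] ->]]; [exists false|exists true|right|left].
have iA := compatibleP _ cA.
have AB : A \subset B.
  apply/fintype.subsetP => -[[i b]|i] xA; rewrite inE; first by apply/usedP; exists b.
  apply/andP; split.
    by apply/usedP => -[b bA]; have := iA _ _ bA xA; rewrite /= eqxx.
  apply/forallP => j; apply/implyP => /eqP ji; apply/usedP => -[b bA].
  by have := iA _ _ bA xA; rewrite /= ji eqxx orbT.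
have cB : compatible B.
  apply/compatibleP => -[[i b]|i] [[j b']|j]; rewrite !inE //=.
  - move=> /usedP[c ic] /usedP[c' jc]; exact: iA _ _ ic jc.
  - move=> ui /andP[nj /forallP nj']; rewrite negb_or; apply/andP; split.
      by apply: contra nj => /eqP ->.
    by apply: contraL ui => /eqP ji; have := nj' i; rewrite ji eqxx.
  - move=> /andP[nj /forallP nj'] ui; rewrite negb_or; apply/andP; split.
      by apply: contra nj => /eqP ->.
    by apply: contraL ui => /eqP ji; have := nj' j; rewrite ji eqxx.
exists (edge_of @: B)%SET; rewrite finset.imsetS // andbT /perfect_matching.
rewrite compatible_matching //=; apply/eqP/setP => v; rewrite [RHS]inE.
have [b [i ->]] := vx_surj v; apply/bigcupP.
have [ui|nui] := boolP (used i).
  by exists (edge_of (inl (i, b))); [rewrite imset_f ?inE|rewrite mem_edge_row !eqxx].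
have [uj|nuj] := boolP (used (ord_pred i)).
  exists (edge_of (inl (ord_pred i, b))); first by rewrite imset_f ?inE.
  by rewrite mem_edge_row eqxx ord_predK eqxx orbT.
exists (edge_of (inr i)); last by rewrite mem_edge_rung.
rewrite imset_f // inE nui; apply/forallP => j; apply/implyP => /eqP ji.
by rewrite -ji ordSK in nuj.
Qed.

Lemma odd_ordS (i : 'I_n) : ~~ odd n -> odd (ordS i) = ~~ odd i.
Proof.
by move=> n_even; have il := ltn_ord i; rewrite ordS_val; case: eqP => ?; lia.
Qed.

Lemma iter_ordS (i : 'I_n) k : iter k (@ordS n) i = (i + k) %% n :> nat.
Proof.
elim: k => [|k IHk]; first by rewrite addn0 modn_small.
by rewrite iterS /= IHk -addn1 modnDml addn1 addnS.
Qed.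

Lemma iter_ordS_surj (i j : 'I_n) : exists k, j = iter k (@ordS n) i.
Proof.
exists (j + n - i); apply: ord_inj; rewrite iter_ordS.
have il := ltn_ord i; have -> : i + (j + n - i) = j + n by lia.
by rewrite modnDr modn_small.
Qed.

Lemma pm_faces_alternating p : ~~ odd n -> (edge_of @: alternating p)%SET \in pm_faces G.
Proof.
move=> n_even; have mA : matching (edge_of @: alternating p)%SET.
  apply/matchingP => -[[i b]|i] [[j b']|j] v; rewrite ?alternating_rung //.
  rewrite !alternating_row => /eqP bE /eqP bE'; have [c [k ->]] := vx_surj v.
  have odd_neq (l l' : 'I_n) : odd l (+) p = odd l' (+) p -> l <> ordS l'.
    by move=> /addIb E L; move: E; rewrite L odd_ordS //; case: (odd l').
  rewrite !mem_edge_row.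
  move=> /andP[/eqP cb /orP[]/eqP ki] /andP[/eqP cb' /orP[]/eqP kj];
    have bb : odd i (+) p = odd j (+) p by rewrite -bE -bE' -cb -cb'.
  - by rewrite -ki -kj -cb -cb'.
  - by case: (odd_neq _ _ bb); rewrite -ki -kj.
  - by case: (odd_neq _ _ (esym bb)); rewrite -ki -kj.
  - by rewrite (can_inj (@ordSK n) (etrans (esym ki) kj)) -cb -cb'.
rewrite inE mA /=; apply/existsP; exists (edge_of @: alternating p)%SET.
rewrite fintype.subxx andbT /perfect_matching mA /=; apply/eqP/setP => v.
rewrite [RHS]inE; have [b [i ->]] := vx_surj v; apply/bigcupP.
have [bE|bE] := eqVneq b (odd i (+) p).
  exists (edge_of (inl (i, b))); first by rewrite imset_f // alternating_row bE.
  by rewrite mem_edge_row !eqxx.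
exists (edge_of (inl (ord_pred i, b))).
  rewrite imset_f // alternating_row; have := odd_ordS (ord_pred i) n_even.
  rewrite ord_predK => oi; move: bE; rewrite oi; clear mA.
  by case: b; case: (odd _); case: p.
by rewrite mem_edge_row eqxx ord_predK eqxx orbT.
Qed.

(** If a perfect matching takes row edges only in opposite pairs, no two of its labels are adjacent.
    Otherwise one unpaired row edge forces the next one in the other row, and so on around the
    ladder. *)
Lemma pm_faces_cases (A : {set label}) : (edge_of @: A)%SET \in pm_faces G ->
  compatible A \/ (~~ odd n /\ exists p, A \subset alternating p).
Proof.
rewrite inE => /andP[_ /existsP[P /andP[/andP[mP /eqP cP] AP]]].
pose B : {set label} := [set x | edge_of x \in P]%SET.
have AB : A \subset B.
  by apply/fintype.subsetP => x xA; rewrite inE (fintype.subsetP AP) // imset_f.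
have PB : P = (edge_of @: B)%SET.
  apply/setP => e; apply/idP/imsetP => [eP|[x]]; last by rewrite inE => ? ->.
  have /edgesP[x eE] : e \in edges G.
    by move: mP => /andP[/fintype.subsetP PE _]; exact: PE.
  by exists x; rewrite // inE -eE.
have mB := matchingP B _; rewrite -PB in mB; have {mP}mB := mB mP.
have cB v : exists2 x, x \in B & v \in edge_of x.
  have : v \in finset.cover P by rewrite cP inE.
  by rewrite PB => /bigcupP[_ /imsetP[x xB ->] vx']; exists x.
(* The vertex of row [~~ b] in the next column must be covered. Its rung would meet the edge
   [(i, b)], and [(i, ~~ b)] is absent, so the following edge of row [~~ b] is taken. *)
have step i b : inl (i, b) \in B -> inl (i, ~~ b) \notin B ->
    inl (ordS i, ~~ b) \in B /\ inl (ordS i, b) \notin B.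
  move=> ib inb; split; last first.
    apply/negP => Sib; have := mB _ _ (vx b (ordS i)) ib Sib.
    rewrite !mem_edge_row !eqxx orbT => /(_ isT isT) [/esym/eqP].
    by rewrite (negbTE (ordS_neq i)).
  have [[[j b']|j] xB] := cB (vx (~~ b) (ordS i)); last first.
    rewrite mem_edge_rung => /eqP ji; rewrite -ji in xB.
    have := mB _ _ (vx b (ordS i)) ib xB.
    by rewrite mem_edge_row mem_edge_rung !eqxx orbT => /(_ isT isT).
  rewrite mem_edge_row => /andP[/eqP bb' /orP[/eqP->|/eqP ij]]; first by rewrite bb'.
  by move: inb; rewrite bb' (can_inj (@ordSK n) ij) xB.
have [/forallP sameB|] := boolP [forall i, (inl (i, false) \in B) == (inl (i, true) \in B)].
  left; apply/compatibleP => x y /(fintype.subsetP AB) xB /(fintype.subsetP AB) yB.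
  have row i j b b' : inl (i, b) \in B -> inl (j, b') \in B -> j != ordS i.
    move=> ib jb; apply/eqP => jE; have jb' : inl (j, b) \in B.
      by have := sameB j; case: b b' jb {ib} => -[] -> // /eqP ->.
    have := mB _ _ (vx b j) ib jb'; rewrite !mem_edge_row !eqxx jE eqxx orbT.
    by move=> /(_ isT isT) [/esym/eqP]; rewrite (negbTE (ordS_neq i)).
  have rung i j b : inl (i, b) \in B -> inr j \in B -> ~~ ((j == i) || (j == ordS i)).
    move=> ib jB; apply/negP => ji; have := mB _ _ (vx b j) ib jB.
    by rewrite mem_edge_row mem_edge_rung !eqxx ji => /(_ isT isT).
  case: x y xB yB => [[i b]|i] [[j b']|j] //= xB yB.
  - by rewrite negb_or (row i j b b') // (row j i b' b).
  - exact: rung xB yB.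
  - exact: rung yB xB.
rewrite negb_forall => /existsP[i iB].
have {iB}[b ib inb] : exists2 b, inl (i, b) \in B & inl (i, ~~ b) \notin B.
  have [iT|iT] := boolP (inl (i, true) \in B).
    by exists true => //; move: iB; rewrite iT; case: (inl (i, false) \in B).
  by exists false => //; move: iB; rewrite (negbTE iT); case: (inl (i, false) \in B).
have iter_step k : inl (iter k (@ordS n) i, b (+) odd k) \in B /\
    inl (iter k (@ordS n) i, ~~ (b (+) odd k)) \notin B.
  elim: k => [|k [IH1 IH2]]; first by rewrite /= addbF.
  have [] := step _ _ IH1 IH2; rewrite iterS /= addbN => ? ?.
  by rewrite negbK.
(* After [n] steps one is back in column [i], and for odd [n] in the other row, whose edge there is
   absent. *)
right; have n_even : ~~ odd n.
  apply/negP => on; have := (iter_step n).1; rewrite on addbT.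
  suff -> : iter n (@ordS n) i = i by rewrite (negbTE inb).
  by apply: ord_inj; rewrite iter_ordS modnDr modn_small.
split=> //; exists (b (+) odd i); apply/fintype.subsetP => x /(fintype.subsetP AB) xB.
have odd_iter k : odd (iter k (@ordS n) i) = odd i (+) odd k.
  by elim: k => [|k IHk]; rewrite ?addbF // iterS odd_ordS // IHk /= addbN.
case: x xB => [[j b']|j] xB; have [k jE] := iter_ordS_surj i j; have [k1 k2] := iter_step k.
  rewrite alternating_row jE odd_iter.
  have -> : odd i (+) odd k (+) (b (+) odd i) = b (+) odd k.
    by case: (odd i); case: (odd k); case: (b).
  apply: contraNT k2 => bb; rewrite -jE.
  by have <- : b' = ~~ (b (+) odd k) by case: (b') (b (+) odd k) bb => -[].
rewrite -jE in k1; have := mB _ _ (vx (b (+) odd k) j) k1 xB.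
by rewrite mem_edge_row mem_edge_rung !eqxx => /(_ isT isT).
Qed.

Variable R : realType.
Local Notation "K ~~h L" := (homotopy_equivalent R (geom R K) (geom R L)) (at level 70).

Lemma label_faces_sub (A B : {set label}) : B \subset A ->
  A \in [set A : {set label} | (edge_of @: A)%SET \in pm_faces G]%SET ->
  B \in [set A : {set label} | (edge_of @: A)%SET \in pm_faces G]%SET.
Proof.
move=> BA; rewrite inE => KA; rewrite inE.
exact: (@pm_faces_sub G _ _ (finset.imsetS edge_of BA)).
Qed.

Definition PM_label : scomplex label := SComplex label_faces_sub.

Lemma in_PM_label (A : {set label}) :
  (A \in faces PM_label) = ((edge_of @: A)%SET \in pm_faces G).
Proof. by rewrite inE. Qed.

Lemma PM_labelP (A : {set label}) :
  reflect (compatible A \/ (~~ odd n /\ exists p, A \subset alternating p))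
    (A \in faces PM_label).
Proof.
rewrite in_PM_label; apply: (iffP idP) => [|[|[n_even [p Ap]]]].
- exact: pm_faces_cases.
- exact: pm_faces_compatible.
- rewrite -in_PM_label; apply: faces_sub Ap _.
  by rewrite in_PM_label; exact: pm_faces_alternating.
Qed.

Lemma PM_relabel : PM_label ~~h PM G.
Proof.
apply: (@relabel_equivalent R _ _ edge_of) => [|A|B]; first exact: edge_of_inj.
  exact: in_PM_label.
rewrite inE => /andP[/andP[/fintype.subsetP BE _] _].
by apply/fintype.subsetP => e /BE /edgesP[x ->]; exact: codom_f.
Qed.

(** * From perfect matchings to an independence complex *)

Let H := rung_graph.
Implicit Types (A : {set H}).

Definition labels (A : {set H}) : {set label} := [set x | inl x \in A]%SET.

Lemma in_labels A x : (x \in labels A) = (inl x \in A).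
Proof. by rewrite inE. Qed.

Lemma compatible_labels A : independent A -> compatible (labels A).
Proof.
move=> /independentP iA; apply/compatibleP => x y; rewrite !in_labels; exact: iA.
Qed.

Definition row_edge b (i : 'I_n) : H := inl (inl (i, b)).
Definition apex (z : bool) : H := inr z.

Definition folds : seq {set H} := [seq [set row_edge true i]%SET | i <- enum 'I_n].

(** Opposite row edges are not adjacent and have the same neighbours in [rung_graph], so the edge of
    row [false] is an apex of the link of the edge of row [true]. *)
Lemma fold_rows zs : (forall t, t \in zs -> exists z, t = [set apex z]%SET) ->
  dels (Ind H) zs ~~h dels (Ind H) (folds ++ zs).
Proof.
move=> zsE; rewrite -dels_cat.
apply: (@family_collapse _ _ _ _ _ (fun i => [set row_edge true i]%SET) (row_edge false)).
- by move=> i _; apply/finset.set0Pn; exists (row_edge true i); rewrite inE.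
- by move=> i _; rewrite inE; apply/eqP => -[].
- move=> i A _ KA; rewrite finset.sub1set => iA.
  move: KA; rewrite !in_dels !in_Ind => /andP[/independentP indA /allP zsA].
  apply/andP; split.
    apply: independent_add; first exact/independentP.
    by move=> v iv; apply: contraTN (iv) => vA; exact: (indA _ _ iA vA).
  apply/allP => t tzs; have := zsA t tzs; have [z ->] := zsE t tzs.
  by rewrite !finset.sub1set !inE /=.
- by move=> i j A _ _ _ _; rewrite !inE => /eqP[].
Qed.

Lemma PM_odd : odd n -> PM G ~~h dels (Ind H) (folds ++ [:: [set apex false]%SET; [set apex true]%SET]).
Proof.
move=> n_odd; apply: homotopy_equivalent_trans (fold_rows _); last first.
  by move=> t; rewrite !inE => /orP[] /eqP ->; [exists false|exists true].
apply: homotopy_equivalent_trans (homotopy_equivalent_sym PM_relabel) _.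
have inj : injective (@inl label bool) by move=> x y [].
apply: (@relabel_equivalent R _ _ (@inl label bool)) => // [A|B].
  rewrite in_dels (@in_Ind H) /= !finset.sub1set !andbT; apply/PM_labelP/andP.
    case=> [cA|[/negP//]]; split => //.
    by apply/andP; split; apply/imsetP => -[].
  by case=> cA _; left.
rewrite in_dels /= !finset.sub1set => /and4P[_ zf zt _].
apply/fintype.subsetP => -[x|[]] xB; first exact: codom_f.
  by rewrite xB in zt.
by rewrite xB in zf.
Qed.

Section Even.
Hypothesis n_even : ~~ odd n.

(* The perfect matching complex with a cone over each alternating matching. *)
Definition coned (A : {set H}) : bool :=
  [&& labels A \in faces PM_label,
      [forall z, (apex z \in A) ==> (labels A \subset alternating z)]
    & ~~ ((apex false \in A) && (apex true \in A))].

Lemma coned_sub (A B : {set H}) : B \subset A ->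
  A \in [set A : {set H} | coned A]%SET -> B \in [set A : {set H} | coned A]%SET.
Proof.
move=> BA; rewrite !inE /coned => /and3P[LA /forallP zA nz].
have LBA : labels B \subset labels A.
  by apply/fintype.subsetP => x; rewrite !in_labels; exact: (fintype.subsetP BA).
apply/and3P; split; first exact: faces_sub LA.
  apply/forallP => z; apply/implyP => /(fintype.subsetP BA) zA'.
  by apply: fintype.subset_trans LBA _; have := zA z; rewrite zA'.
by apply: contra nz => /andP[/(fintype.subsetP BA) -> /(fintype.subsetP BA) ->].
Qed.

Definition Coned : scomplex H := SComplex coned_sub.

Lemma conedP A : reflect [/\ labels A \in faces PM_label,
   forall z, apex z \in A -> labels A \subset alternating z
   & forall z, apex z \in A -> apex (~~ z) \notin A] (A \in faces Coned).
Proof.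
have -> : (A \in faces Coned) = coned A by rewrite inE.
rewrite /coned; apply: (iffP and3P) => -[LA zA nz]; split => //.
- by move=> z zA'; have /forallP/(_ z) := zA; rewrite zA'.
- by move=> z zA'; apply: contra nz => zA2; case: z zA' zA2 => -> ->.
- by apply/forallP => z; apply/implyP; exact: zA.
- by apply/negP => /andP[/nz] /negP.
Qed.

Let alt_row z (i : 'I_n) : bool := odd i (+) z.

Let i0 : 'I_n := Ordinal (leq_trans (ltn0Sn 2) n_gt2).

(** The link of [apex z] is the full simplex on [alternating z]; any of its vertices is a cone
    point, and the one of column 0 is chosen. *)
Lemma PM_coned : PM G ~~h Coned.
Proof.
apply: homotopy_equivalent_trans (homotopy_equivalent_sym PM_relabel) _.
apply: homotopy_equivalent_sym.
apply: homotopy_equivalent_trans (@family_collapse _ R Coned _ [:: false; true]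
  (fun z => [set apex z]%SET) (fun z => row_edge (alt_row z i0) i0) _ _ _ _) _.
- by move=> z _; apply/finset.set0Pn; exists (apex z); rewrite inE.
- by move=> z _; rewrite inE.
- move=> z A _ /conedP[LA zA nz]; rewrite finset.sub1set => zA'.
  have Lalt : labels (row_edge (alt_row z i0) i0 |: A) \subset alternating z.
    apply/fintype.subsetP => x; rewrite in_labels finset.in_setU1 => /predU1P[[->]|xA].
      by rewrite alternating_row.
    by have := fintype.subsetP (zA z zA') x; rewrite in_labels => /(_ xA).
  apply/conedP; split.
  + by apply/PM_labelP; right; split => //; exists z.
  + move=> z'; rewrite !inE /= => z'A; suff <- : z = z' by [].
    by apply/eqP; apply: contraT => zz'; have := nz z zA'; rewrite (_ : ~~ z = z') ?z'A //;
      case: (z) (z') zz' => -[].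
  + by move=> z'; rewrite !inE /=; exact: nz.
- by move=> z z' A _ _ _ _; rewrite !inE.
apply: homotopy_equivalent_sym; have inj : injective (@inl label bool) by move=> x y [].
apply: (@relabel_equivalent R _ _ (@inl label bool)) => // [A|B].
  have LA : labels (inl @: A)%SET = A.
    by apply/setP => x; rewrite in_labels (mem_imset _ _ inj).
  have zA z : apex z \in (inl @: A)%SET = false by apply/imsetP => -[].
  rewrite in_dels /= !finset.sub1set !zA !andbT; apply/idP/conedP => [KA|[]]; last by rewrite LA.
  by split => [|z|z]; rewrite ?LA ?zA.
rewrite in_dels /= !finset.sub1set => /and4P[_ zf zt _].
apply/fintype.subsetP => -[x|[]] xB; first exact: codom_f.
  by rewrite xB in zt.
by rewrite xB in zf.
Qed.

(** [Coned] and [Ind H] differ by these two kinds of pairs: an [alt_pair] lies in faces of [Coned]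
    only, its members being adjacent in [H], and an [off_pair] lies in faces of [Ind H] only.
    Deleting each kind from the complex that has it gives the same complex. *)
Definition alt_pair (zi : bool * 'I_n) : {set H} :=
  [set row_edge (alt_row zi.1 zi.2) zi.2; row_edge (alt_row zi.1 (ordS zi.2)) (ordS zi.2)]%SET.

Definition off_pair (zi : bool * 'I_n) : {set H} :=
  [set apex zi.1; row_edge (~~ alt_row zi.1 zi.2) zi.2]%SET.

Let all_zi : seq (bool * 'I_n) := enum {: bool * 'I_n}.

(** A face with two consecutive edges of [alternating z] is contained in that matching up to apices,
    hence admits [apex z]. *)
Lemma coned_collapse : Coned ~~h dels Coned (map alt_pair all_zi).
Proof.
apply: (@family_collapse _ _ _ _ _ alt_pair (fun zi => apex zi.1)).
- by move=> zi _; apply/finset.set0Pn; exists (row_edge (alt_row zi.1 zi.2) zi.2); rewrite !inE eqxx.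
- by move=> zi _; rewrite !inE.
- move=> [z i] A _ /conedP[LA zA nz]; rewrite finset.subUset !finset.sub1set /=.
  move=> /andP[iA SiA].
  have alt z' : labels A \subset alternating z' -> z' = z.
    move=> /fintype.subsetP/(_ (inl (i, alt_row z i))).
    by rewrite in_labels alternating_row => /(_ iA)/eqP/addbI.
  have Az : labels A \subset alternating z.
    case/PM_labelP: LA => [/compatibleP cA|[_ [p Ap]]]; last by rewrite -(alt p).
    have := cA (inl (i, alt_row z i)) (inl (ordS i, alt_row z (ordS i))).
    by rewrite !in_labels iA SiA /= eqxx => /(_ isT isT).
  have LzA : labels (apex z |: A) = labels A.
    by apply/setP => x; rewrite !in_labels !inE.
  apply/conedP; rewrite LzA; split => // z'; rewrite !inE => /predU1P[[->]//|z'A].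
  + exact: zA.
  + apply/norP; split; first by case: (z).
    by apply/negP => /zA/alt/esym/eqP; case: (z).
  + have z'E := alt _ (zA _ z'A); rewrite -z'E; apply/norP; split; last exact: nz.
    by case: (z').
- by move=> zi zi' A _ _ _ _; rewrite !inE.
Qed.

(** The row edge opposite the one in the pair has the same neighbours and can be added. It could
    complete only a pair at the other apex, which is adjacent to the apex present. *)
Lemma Ind_collapse : Ind H ~~h dels (Ind H) (map off_pair all_zi).
Proof.
apply: (@family_collapse _ _ _ _ _ off_pair (fun zi => row_edge (alt_row zi.1 zi.2) zi.2)).
- by move=> zi _; apply/finset.set0Pn; exists (apex zi.1); rewrite !inE eqxx.
- move=> [z i] _; rewrite !inE /=; apply/negP => /eqP[/esym/eqP].
  by case: (alt_row z i).
- move=> [z i] A _; rewrite !in_Ind finset.subUset !finset.sub1set /= => iA /andP[zA oA].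
  apply: independent_add => // v iv; apply: contraTN (iv) => vA.
  exact: (independentP _ iA _ _ oA vA).
- move=> [z i] [z' i'] A _ _; rewrite in_Ind !finset.subUset !finset.sub1set /=.
  move=> iA /andP[zA oA]; rewrite !inE /= => /eqP[ii bb] /andP[z'A _].
  have zz : z' = ~~ z.
    by move: bb; rewrite /alt_row -ii; case: (odd i) (z) (z') => -[] [].
  by have := independentP _ iA _ _ zA z'A; rewrite zz /=; case: (z).
Qed.

Lemma coned_Ind : dels Coned (map alt_pair all_zi) = dels (Ind H) (map off_pair all_zi).
Proof.
apply/scomplex_eq/setP => A; rewrite !in_dels !in_Ind.
have mem_zi zi : zi \in all_zi by rewrite mem_enum.
apply/andP/andP => -[KA /allP tA]; split.
- have [LA zA nz] := conedP _ KA.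
  have cA : compatible (labels A).
    case/PM_labelP: LA => [//|[_ [p /fintype.subsetP Ap]]].
    have rows i b : row_edge b i \in A -> b = alt_row p i.
      by move=> ib; have := Ap (inl (i, b)); rewrite in_labels alternating_row => /(_ ib)/eqP.
    have consec i b b' : row_edge b i \in A -> row_edge b' (ordS i) \in A -> False.
      move=> ib Sib; have := tA _ (map_f alt_pair (mem_zi (p, i))); rewrite finset.subUset !finset.sub1set /=.
      by rewrite -(rows i b ib) -(rows _ b' Sib) ib Sib.
    apply/compatibleP => -[[i b]|i] [[j b']|j]; rewrite !in_labels => xA yA //=.
    + by apply/norP; split; apply/eqP => E; [rewrite E in yA; apply: (consec i b b')|
        rewrite E in xA; apply: (consec j b' b)].
    + by have := Ap (inr j); rewrite in_labels alternating_rung => /(_ yA).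
    + by have := Ap (inr i); rewrite in_labels alternating_rung => /(_ xA).
  have rungA z i : apex z \in A -> inl (inr i) \notin A.
    move=> /zA/fintype.subsetP/(_ (inr i)); rewrite in_labels alternating_rung.
    by move=> niA; apply/negP => /niA.
  apply/independentP => -[x|z] [y|z'] xA yA.
  + by apply: (compatibleP _ cA); rewrite in_labels.
  + by case: x xA => [[i b]|i] //= /(negP (rungA _ _ yA)).
  + by case: y yA => [[i b]|i] //= /(negP (rungA _ _ xA)).
  + rewrite /= negbK; apply: contraT => zz; have := nz _ xA.
    by rewrite (_ : ~~ z = z') ?yA //; case: (z) (z') zz => -[].
- apply/allP => _ /mapP[[z i] _ ->]; apply/negP; rewrite finset.subUset !finset.sub1set /=.
  move=> /andP[zA oA]; have [_ /(_ z zA)/fintype.subsetP Az _] := conedP _ KA.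
  have := Az (inl (i, ~~ alt_row z i)); rewrite in_labels alternating_row => /(_ oA).
  by rewrite /alt_row; case: (odd i (+) z).
- have iA := independentP _ KA; apply/conedP; split.
  + by apply/PM_labelP; left; exact: compatible_labels.
  + move=> z zA; apply/fintype.subsetP => -[[i b]|i]; rewrite in_labels => xA; last first.
      by have := iA _ _ zA xA.
    rewrite alternating_row; apply: contraT => bz.
    have := tA _ (map_f off_pair (mem_zi (z, i))); rewrite finset.subUset !finset.sub1set zA /=.
    by rewrite (_ : ~~ alt_row z i = b) ?xA // /alt_row; case: (b) (odd i (+) z) bz => -[].
  + by move=> z zA; apply/negP => zA'; have := iA _ _ zA zA'; rewrite /=; case: (z).
- apply/allP => _ /mapP[[z i] _ ->]; apply/negP; rewrite finset.subUset !finset.sub1set /=.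
  by move=> /andP[xA yA]; have := independentP _ KA _ _ xA yA; rewrite /= eqxx.
Qed.

Lemma PM_even : PM G ~~h dels (Ind H) folds.
Proof.
rewrite -[folds]cats0; apply: homotopy_equivalent_trans (fold_rows _) => //.
rewrite dels0; apply: homotopy_equivalent_trans PM_coned _.
apply: homotopy_equivalent_trans coned_collapse _; rewrite coned_Ind.
exact: homotopy_equivalent_sym Ind_collapse.
Qed.

End Even.

End Labels.

(** * The rung graph *)

Section RungGraph.
Variables (R : realType) (n : nat).
Hypothesis n_gt2 : 2 < n.
Let H := rung_graph n_gt2.
Local Notation "K ~~h L" := (homotopy_equivalent R (geom R K) (geom R L)) (at level 70).
Implicit Types (t C : {set H}) (ts : seq {set H}) (u : H).

Let n_gt0 : 0 < n := ltn_trans (ltn0Sn 1) n_gt2.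

Definition col (c : nat) : 'I_n := Ordinal (ltn_pmod c n_gt0).
Definition hz (b : bool) (c : nat) : H := inl (inl (col c, b)).
Definition rg (c : nat) : H := inl (inr (col c)).
Definition zz (j : bool) : H := inr j.
Local Notation a := (hz false).
Local Notation folds := (folds n_gt2).

Lemma ordS_col c : ordS (col c) = col c.+1.
Proof. by apply: ord_inj; rewrite /= -addn1 modnDml addn1. Qed.

Lemma colDn c : col (c + n) = col c.
Proof. by apply: ord_inj; rewrite /= modnDr. Qed.

Lemma col_inj c c' : c <= n -> c' <= n -> col c = col c' ->
  c = c' \/ (c = 0 /\ c' = n) \/ (c = n /\ c' = 0).
Proof.
move=> cn cn' /(congr1 (@nat_of_ord n)) /=.
have mE k : k <= n -> k %% n = if k == n then 0 else k.
  by move=> kn; case: eqP => [->|?]; rewrite ?modnn ?modn_small //; lia.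
by rewrite !mE //; do 2 case: eqP; lia.
Qed.

Lemma col_val (i : 'I_n) : col i = i.
Proof. by apply: ord_inj; rewrite /= modn_small. Qed.

Lemma hzDn b c : hz b (c + n) = hz b c. Proof. by rewrite /hz colDn. Qed.
Lemma rgDn c : rg (c + n) = rg c. Proof. by rewrite /rg colDn. Qed.

Lemma vertexP u : [\/ exists b c, c < n /\ u = hz b c, exists2 c, c < n & u = rg c
  | exists j, u = zz j].
Proof.
case: u => [[[i b]|i]|j]; [constructor 1|constructor 2|constructor 3].
- by exists b, i; rewrite /hz col_val.
- by exists i; rewrite // /rg col_val.
- by exists j.
Qed.

Lemma hz_nbr b c u : @sadj H (hz b c.+1) u ->
  (exists b', u = hz b' c \/ u = hz b' c.+2) \/ (u = rg c.+1 \/ u = rg c.+2).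
Proof.
case: u => [[[i b']|i]|j] //=; rewrite ordS_col.
  case/orP=> [/eqP->|]; first by left; exists b'; right.
  by rewrite -ordS_col => /eqP/(can_inj (@ordSK n)) <-; left; exists b'; left.
by case/orP=> /eqP ->; right; [left|right].
Qed.

Lemma rg_nbr c u : @sadj H (rg c.+1) u ->
  (exists b, u = hz b c \/ u = hz b c.+1) \/ exists j, u = zz j.
Proof.
case: u => [[[i b']|i]|j] //=; last by right; exists j.
case/orP=> [/eqP<-|]; first by left; exists b'; right.
by rewrite -ordS_col => /eqP/(can_inj (@ordSK n)) <-; left; exists b'; left.
Qed.

Lemma adj_next b b' c : @sadj H (hz b c) (hz b' c.+1).
Proof. by rewrite /= ordS_col eqxx. Qed.

Lemma adj_prev b b' c : @sadj H (hz b c.+1) (hz b' c).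
Proof. by rewrite sadj_sym; exact: adj_next. Qed.

Lemma adj_rg b c : @sadj H (hz b c) (rg c).
Proof. by rewrite /= eqxx. Qed.

Lemma adj_rgS b c : @sadj H (hz b c) (rg c.+1).
Proof. by rewrite /= ordS_col eqxx orbT. Qed.

Lemma adj_zz j : @sadj H (zz j) (zz (~~ j)).
Proof. by case: j. Qed.

Lemma hz_true_excluded ts C c : {subset folds <= ts} -> excluded ts C (hz true c).
Proof.
move=> fts; apply: excluded1; apply: fts; apply/mapP; exists (col c) => //.
by rewrite mem_enum.
Qed.

Lemma in_foldsP t : t \in folds -> exists c, t = [set hz true c]%SET.
Proof. by case/mapP=> i _ ->; exists i; rewrite /hz col_val. Qed.

(* The row edges of the remaining row, read in the direction given by [d] from
   column [0] in both cases. *)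
Definition wr (d : bool) (c : nat) : H := if d then a c else a (n - c).

Lemma wr0 d : wr d 0 = a 0.
Proof. by case: d => //=; rewrite subn0; exact: (hzDn _ 0). Qed.

Lemma wr_n d : wr d n = a 0.
Proof. by case: d => /=; rewrite ?subnn //; exact: (hzDn _ 0). Qed.

Lemma wr_inj d c c' : c <= n -> c' <= n -> wr d c = wr d c' ->
  c = c' \/ (c = 0 /\ c' = n) \/ (c = n /\ c' = 0).
Proof.
move=> cn cn'; have inj k k' : k <= n -> k' <= n -> a k = a k' ->
    k = k' \/ (k = 0 /\ k' = n) \/ (k = n /\ k' = 0).
  by move=> kn kn' [kk]; apply: col_inj => //; exact: ord_inj.
by case: d => /= /inj; lia.
Qed.

Lemma wr_flip d c : c <= n -> wr (~~ d) c = wr d (n - c).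
Proof. by case: d => //= cn; rewrite subKn. Qed.

Lemma wr_next d c : c < n -> @sadj H (wr d c) (wr d c.+1).
Proof.
case: d => cn; first exact: adj_next.
by rewrite /wr (_ : n - c = (n - c.+1).+1); [exact: adj_prev|lia].
Qed.

Lemma wr_prev d c : c < n -> @sadj H (wr d c.+1) (wr d c).
Proof. by move=> cn; rewrite sadj_sym; exact: wr_next. Qed.

Lemma wr_nbr d c u : c.+2 <= n -> @sadj H (wr d c.+1) u ->
  [\/ u = wr d c, u = wr d c.+2, exists c', u = hz true c' | exists c', u = rg c'].
Proof.
case: d => cn; rewrite /wr.
  move/hz_nbr=> [[[] [->|->]]|[->|->]].
  - by constructor 3; exists c.
  - by constructor 3; exists c.+2.
  - by constructor 1.
  - by constructor 2.
  - by constructor 4; exists c.+1.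
  - by constructor 4; exists c.+2.
rewrite (_ : n - c.+1 = (n - c.+2).+1); last by lia.
rewrite (_ : n - c = (n - c.+2).+2); last by lia.
move/hz_nbr=> [[[] [->|->]]|[->|->]].
- by constructor 3; exists (n - c.+2).
- by constructor 3; exists (n - c.+2).+2.
- by constructor 2.
- by constructor 1.
- by constructor 4; exists (n - c.+2).+1.
- by constructor 4; exists (n - c.+2).+2.
Qed.

Lemma wr_surj d c : exists2 k, k < n & a c = wr d k.
Proof.
case: d; first by exists (col c) => //; rewrite /wr /hz col_val.
have cn := ltn_ord (col c); have [c0|c0] := posnP (col c).
  by exists 0; rewrite // wr0 /hz; congr (inl (inl (_, _))); apply: ord_inj; rewrite c0 /= mod0n.
exists (n - col c); first by lia.
rewrite /wr /hz; congr (inl (inl (_, _))); apply: ord_inj.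
by rewrite /= subKn ?modn_mod // ltnW // ltn_pmod.
Qed.

(** Next to an apex no rung can occur, and what remains is the cycle of row edges. The edge
    [zy d i], in column [3 i + 3], has two row neighbours: one adjacent to [zx d i], and [zx d i.+1]
    itself. *)
Definition zx d (i : nat) : H := wr d (i * 3).+1.
Definition zy d (i : nat) : H := wr d (i * 3).+3.
Definition zcell d j m : {set H} := [set zz j]%SET :|: prefix_set (zx d) m.

Lemma zxS d i : zx d i.+1 = wr d (i * 3).+4.
Proof. by rewrite /zx mulSn addnC !addnS addn0. Qed.

Lemma in_zcell d j m i : i < m -> zx d i \in zcell d j m.
Proof. by move=> im; rewrite !inE; apply/orP; right; apply/prefix_setP; exists i. Qed.

Lemma zz_in_zcell d j m : zz j \in zcell d j m.
Proof. by rewrite !inE eqxx. Qed.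

Lemma zcellP d j m u : u \in zcell d j m -> u = zz j \/ exists2 i, i < m & u = zx d i.
Proof. by rewrite !inE => /orP[/eqP|/prefix_setP]; [left|right]. Qed.

(** The chain based on [B = [set zz j]]. Forbidden sets with a rung or the other apex are harmless,
    since these vertices are adjacent to [zz j]. *)
Lemma zchain d j l ts : {subset folds <= ts} -> l * 3 + 4 <= n ->
  excluded ts (zcell d j l.+1) (zx d l.+1) ->
  (forall t, t \in ts -> [\/ t \in folds, exists c, rg c \in t, zz (~~ j) \in t
     | (forall i, i <= l -> zy d i \notin t) \/
       exists u, [/\ u \in t, (forall i, i <= l -> zy d i != u) &
         excluded ts [set zx d 0; zz j]%SET u]] \/ t = zcell d j l.+2) ->
  dels (Ind H) ts ~~h dels (Ind H) ((zx d 0 |: [set zz j])%SET :: ts).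
Proof.
move=> fts ln xl tT; apply: (@graph_chain _ _ _ _ _ (zy d) l).
- move=> i il; apply/negP => /zcellP[//|[k ki]].
    by rewrite /zy /wr; case: (d).
  by move=> /wr_inj[|||]; lia.
- by move=> i il; rewrite zxS; apply/eqP => /wr_inj[|||]; lia.
- move=> i u il /wr_nbr[|->|->|[c ->]|[c ->]].
  + by lia.
  + right; right; exists (zx d i); first exact: in_zcell.
    by apply: wr_next; lia.
  + by left; rewrite zxS.
  + by right; exact: hz_true_excluded.
  + by right; right; exists (zz j); rewrite ?zz_in_zcell.
- exact: xl.
- move=> i t il tts yt; case: (tT t tts) => [[tf|[c ct]|zt|[/(_ _ il)|[u [ut uy uex]]]]|tE].
  + have [c tE] := in_foldsP tf; move: yt; rewrite tE inE => /eqP.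
    by rewrite /zy /wr; case: (d).
  + exists (rg c) => //; split; first by rewrite /zy /wr; case: (d).
    by right; right; exists (zz j); rewrite ?zz_in_zcell.
  + exists (zz (~~ j)) => //; split; first by rewrite /zy /wr; case: (d).
    by right; right; exists (zz j); [exact: zz_in_zcell|exact: adj_zz].
  + by rewrite yt.
  + exists u => //; split; first by rewrite eq_sym uy.
    right; apply: excluded_sub uex; rewrite finset.subUset !finset.sub1set.
    by rewrite in_zcell // zz_in_zcell.
  + exists (zx d i.+1); first by rewrite tE in_zcell.
    by split; [rewrite zxS; apply/eqP => /wr_inj[|||]; lia|left].
Qed.

Lemma card_zcell d j m : m.-1 * 3 < n.-1 -> #|zcell d j m| = m.+1.
Proof.
move=> mn; rewrite cardsU1 card_imset ?card_ord => [|i k].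
  rewrite (_ : _ \in _ = false) //; apply/negP => /prefix_setP[i _].
  by rewrite /zx /wr; case: (d).
have il := ltn_ord i; have kl := ltn_ord k.
by move=> /wr_inj ik; apply: ord_inj; have := ik _ _; lia.
Qed.

(** Every third edge dominates the cycle, except for column [m * 3] when [n = m * 3 + 1]; that edge
    is the corner to be excluded separately. *)
Lemma zcell_critical d j m ts : 0 < m -> n <= m * 3 + 1 -> m * 3 <= n.+1 ->
  {subset folds <= ts} ->
  (forall t, t \in ts -> [\/ t \in folds, exists c, rg c \in t, zz (~~ j) \in t
     | exists2 c, c <= n & wr d c \in t /\ forall i, i < m -> wr d c != zx d i]) ->
  (n = m * 3 + 1 -> excluded ts (zcell d j m) (wr d (m * 3))) ->
  critical ts (zcell d j m).
Proof.
move=> m0 nm mn fts tT corner; split.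
- by apply/finset.set0Pn; exists (zz j); exact: zz_in_zcell.
- have zzx i : ~~ @sadj H (zz j) (zx d i) by rewrite /zx /wr; case: (d).
  have xx i k : i < m -> k < m -> i <= k -> ~~ @sadj H (zx d i) (zx d k).
    move=> im km; rewrite leq_eqVlt => /predU1P[->|ik]; first by rewrite sadj_irrefl.
    apply/negP; rewrite /zx; case iE : (i * 3).+1 => [|c]; first by lia.
    rewrite -iE; move=> /wr_nbr[|/wr_inj[|||]|/wr_inj[|||]|[c'']|[c'']]; try lia.
    + by rewrite /wr; case: (d).
    + by rewrite /wr; case: (d).
  apply/independentP => u v /zcellP[->|[i im ->]] /zcellP[->|[k km ->]] //.
  + by rewrite sadj_irrefl.
  + by rewrite sadj_sym.
  + by case/orP: (leq_total i k) => ik; [|rewrite sadj_sym]; exact: xx.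
- move=> t /tT[tf|[c ct]|zt|[c cn [ct cx]]]; apply/negP => /fintype.subsetP tz.
  + have [c tE] := in_foldsP tf; have := tz (hz true c); rewrite tE inE eqxx => /(_ isT).
    by case/zcellP=> [//|[i _]]; rewrite /zx /wr; case: (d).
  + by have /zcellP[//|[i _]] := tz _ ct; rewrite /zx /wr; case: (d).
  + have /zcellP[|[i _]] := tz _ zt; first by case: (j).
    by rewrite /zx /wr; case: (d).
  + have /zcellP[|[i im ci]] := tz _ ct; first by rewrite /wr; case: (d).
    by have := cx i im; rewrite ci eqxx.
move=> u uz; suff : excluded ts (zcell d j m) u by case; [right|left].
have adj i : i < m -> @sadj H (zx d i) u -> excluded ts (zcell d j m) u.
  by move=> im xu; right; exists (zx d i) => //; exact: in_zcell.
case: (vertexP u) => [[[] [c [cn uE]]]|[c cn uE]|[k uE]].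
- by rewrite uE; exact: hz_true_excluded.
- have [k kn wE] := wr_surj d c; rewrite {}wE in uE.
  have [k0|k0] := posnP k.
    by apply: (adj 0) => //; rewrite uE k0; apply: wr_prev; lia.
  pose i := (k - 1) %/ 3; have := divn_eq (k - 1) 3; rewrite -/i => kE.
  have r3 : (k - 1) %% 3 < 3 by rewrite ltn_mod.
  case rE : ((k - 1) %% 3) r3 kE => [|[|[|//]]] _ kE.
  + by move: uz; rewrite uE (_ : k = (i * 3).+1) ?in_zcell //; lia.
  + apply: (adj i); first by lia.
    rewrite uE (_ : k = (i * 3).+2); last by lia.
    by apply: wr_next; lia.
  + have [im|im] := ltnP i.+1 m.
      apply: (adj i.+1) => //; rewrite uE zxS (_ : k = (i * 3).+3); last by lia.
      by apply: wr_prev; lia.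
    by rewrite uE (_ : k = m * 3); [apply: corner|]; lia.
- by right; exists (zz j); rewrite ?zz_in_zcell ?uE.
- right; exists (zz j); first exact: zz_in_zcell.
  move: uz; rewrite uE; case: (eqVneq j k) => [->|jk _]; first by rewrite zz_in_zcell.
  by [].
Qed.

(** The row neighbours of [a 0] are the edges of column 1 in the two directions. When neither of
    them occurs with [zz j], [a 0] is an apex of the link of [zz j]. *)
Lemma zremove j ts : {subset folds <= ts} ->
  (wr true 1 |: [set zz j])%SET \in ts -> (wr false 1 |: [set zz j])%SET \in ts ->
  (forall t, t \in ts -> (exists c, rg c \in t) \/ a 0 \notin t) ->
  dels (Ind H) ts ~~h dels (Ind H) ([set zz j]%SET :: ts).
Proof.
move=> fts w1 w2 tT; rewrite -[[set zz j]%SET]finset.setU0.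
have zin : zz j \in finset.set0 :|: prefix_set (fun i => if i is 0 then zz j else rg 0) 1.
  by rewrite finset.set0U; apply/prefix_setP; exists 0.
(* A chain of length one; [rg 0] merely fills the place of the next vertex, and is excluded because
   it is adjacent to [zz j]. *)
apply: (@graph_chain _ _ _ _ (fun i => if i is 0 then zz j else rg 0) (fun=> a 0) 0).
- move=> i; rewrite leqn0 => /eqP ->; rewrite finset.set0U.
  by apply/prefix_setP => -[[|k]].
- by [].
- move=> i u; rewrite leqn0 => /eqP -> a0u; right.
  have : (u = rg 0 \/ u = rg 1) \/ exists b, u = hz b 1 \/ u = hz b n.-1.
    move: a0u; rewrite -(hzDn _ 0) (_ : 0 + n = n.-1.+1); last by lia.
    move/hz_nbr=> [[b [->|->]]|[->|->]].
    + by right; exists b; right.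
    + by right; exists b; left; rewrite (_ : n.-1.+2 = 1 + n) ?hzDn //; lia.
    + by left; left; rewrite (_ : n.-1.+1 = 0 + n) ?rgDn //; lia.
    + by left; right; rewrite (_ : n.-1.+2 = 1 + n) ?rgDn //; lia.
  case=> [[] ->|[[] [->|->]]].
  + by right; exists (zz j).
  + by right; exists (zz j).
  + exact: hz_true_excluded.
  + exact: hz_true_excluded.
  + left; exists (wr true 1 |: [set zz j])%SET => //.
    by apply: finset.setUS; rewrite finset.sub1set.
  + left; exists (wr false 1 |: [set zz j])%SET => //.
    by rewrite /wr subn1; apply: finset.setUS; rewrite finset.sub1set.
- by right; exists (zz j).
- move=> i t _ tts ta; case: (tT t tts) => [[c ct]|]; last by rewrite ta.
  exists (rg c) => //; split => //; right; right; exists (zz j) => //.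
  by rewrite finset.set0U; apply/prefix_setP; exists 0.
Qed.

Lemma sadj_hz b b' c c' : @sadj H (hz b c) (hz b' c') =
  (col c' == col c.+1) || (col c == col c'.+1).
Proof. by rewrite /= !ordS_col. Qed.

Lemma hz_inj b b' c c' : hz b c = hz b' c' -> b = b' /\ col c = col c'.
Proof. by case=> kk ->; split=> //; exact: ord_inj. Qed.

Lemma rg_inj c c' : rg c = rg c' -> col c = col c'.
Proof. by case=> kk; exact: ord_inj. Qed.

(** The rung of column 1 is the apex: its neighbours are the row edges of columns 0 and 1 and the
    two [zz], all forbidden. *)
Lemma rung_cone ts : {subset folds <= ts} -> (forall j, [set zz j]%SET \in ts) ->
  [set a 0]%SET \in ts -> [set a 1]%SET \in ts ->
  (forall t, t \in ts -> t != finset.set0) ->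
  (forall t, t \in ts -> [\/ rg 1 \notin t, a 0 \in t, a 1 \in t | exists j, zz j \in t]) ->
  contractible R (geom R (dels (Ind H) ts)).
Proof.
move=> fts zts a0 a1 t0 tT; apply: (@graph_cone _ _ _ (rg 1)) => //.
  move=> u /rg_nbr[[b [->|->]]|[j ->]] //.
    by case: b => //; apply: fts; apply/mapP; exists (col 0); rewrite ?mem_enum.
  by case: b => //; apply: fts; apply/mapP; exists (col 1); rewrite ?mem_enum.
move=> t /tT[|at0|at1|[j zt]] rt; first by rewrite (negbTE rt).
- by exists (a 0).
- by exists (a 1).
- by exists (zz j).
Qed.

(** The rung [s + 2 i + 2] meets [x i.+1] and an edge adjacent to [x i], so rungs play the part of
    [y]. For odd [n] the sequence of every other edge closes up onto a neighbour of its start, and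
    the start is deleted for free. *)
Lemma odd_chain h s ts : n = h.*2.+1 -> s <= 1 -> {subset folds <= ts} ->
  (forall j, [set zz j]%SET \in ts) ->
  (forall t, t \in ts -> forall c, rg c \notin t) ->
  dels (Ind H) ts ~~h dels (Ind H) ([set a s]%SET :: ts).
Proof.
move=> nh s1 fts zts tT; rewrite -[[set a s]%SET]finset.setU0.
pose x i := a (s + i.*2); rewrite (_ : a s = x 0); last by rewrite /x addn0.
have xin i k : i < k -> x i \in finset.set0 :|: prefix_set x k.
  by move=> ik; rewrite finset.set0U; apply/prefix_setP; exists i.
apply: (@graph_chain _ _ _ _ _ (fun i => rg (s + i.*2).+2) h.-1) => //.
- by move=> i _; rewrite finset.set0U; apply/prefix_setP => -[k].
- move=> i u ih /rg_nbr[[b [->|->]]|[j ->]].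
  + by right; right; exists (x i); [exact: xin|exact: adj_next].
  + case: b; first by right; exact: hz_true_excluded.
    by left; rewrite /x doubleS !addnS.
  + by right; apply: excluded1.
- right; exists (x 0); first exact: xin.
  rewrite /x addn0 -(hzDn _ s) (_ : s + n = (s + h.-1.+1.*2).+1); first exact: adj_prev.
  by lia.
- by move=> i t _ /tT/(_ (s + i.*2).+2)/negbTE ->.
Qed.

(** * Even n: a rung together with every other row edge *)

Section Even.
Variable h : nat.
Hypotheses (nh : n = h.*2) (h_ge2 : 2 <= h).

Definition bx (s i : nat) : H := a (s + i.*2).
Definition bset s : {set H} := prefix_set (bx s) h.-1.
(** [bset s] leaves out one edge of an alternating row, the edge in column [s + n - 2]. [tau s] and
    [cc s] add the rung at one of its two ends. *)
Definition tau s : {set H} := (rg (s + n.-1) |: bset s)%SET.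
Definition cc s : {set H} := (rg (s + n.-2) |: bset s)%SET.

Lemma in_bset s i : i < h.-1 -> bx s i \in bset s.
Proof. by move=> ih; apply/prefix_setP; exists i. Qed.

Lemma rg_bset s c : rg c \in bset s = false.
Proof. by apply/prefix_setP => -[]. Qed.

Lemma zz_bset s j : zz j \in bset s = false.
Proof. by apply/prefix_setP => -[]. Qed.

Lemma hz_true_bset s c : hz true c \in bset s = false.
Proof. by apply/prefix_setP => -[]. Qed.

Lemma rg_neq s : s <= 1 -> rg (s + n.-1) != rg (s + n.-2).
Proof. by move=> s1; apply/eqP => /rg_inj/col_inj; lia. Qed.

(** The other rung, that of [cc s], is an apex of the link of [tau s]. This deletion makes [cc s]
    maximal. *)
Lemma tau_collapse s ts : s <= 1 -> {subset folds <= ts} ->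
  (forall t, t \in ts -> t \in folds \/ a (1 - s) \in t) ->
  dels (Ind H) ts ~~h dels (Ind H) (tau s :: ts).
Proof.
move=> s1 fts tT; pose x i := if i is 0 then rg (s + n.-1) else a (s + n.-2).
have x0 : x 0 \in bset s :|: prefix_set x 1.
  by rewrite inE; apply/orP; right; apply/prefix_setP; exists 0.
have nE : s + n.-2 = (s + (n - 3)).+1 by lia.
apply: (@graph_chain _ _ _ _ x (fun=> rg (s + n.-2)) 0) => //.
- move=> i; rewrite leqn0 => /eqP ->; rewrite inE rg_bset /=; apply/prefix_setP => -[[|k] // _].
  by apply/eqP; rewrite eq_sym; exact: rg_neq.
- move=> i u; rewrite leqn0 => /eqP ->; rewrite nE => /rg_nbr[[b [->|->]]|[j ->]].
  + right; right; exists (bx s (h - 2)).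
      by rewrite inE in_bset //; lia.
    rewrite /bx (_ : s + (n - 3) = (s + (h - 2).*2).+1); last by lia.
    exact: adj_next.
  + case: b; first by right; exact: hz_true_excluded.
    by left; rewrite /x nE.
  + by right; right; exists (x 0).
- right; exists (x 0) => //; rewrite sadj_sym /x.
  rewrite (_ : s + n.-1 = (s + n.-2).+1); last by lia.
  exact: adj_rgS.
- move=> i t _ /tT[tf|ats _]; first by have [c ->] := in_foldsP tf; rewrite inE.
  exists (a (1 - s)) => //; split => //; right; right; exists (bx s 0).
    by rewrite inE in_bset //; lia.
  by rewrite /bx addn0; case: (s) s1 => [|[|//]] _; [exact: adj_next|exact: adj_prev].
Qed.

Lemma card_cc s : s <= 1 -> #|cc s| = h.
Proof.
move=> s1; rewrite cardsU1 rg_bset card_imset ?card_ord; first by lia.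
move=> i j; have il := ltn_ord i; have jl := ltn_ord j.
by move=> /hz_inj[_ /col_inj ij]; apply: ord_inj; have := ij _ _; lia.
Qed.

(** Apart from the folded edges, the rung of [tau s] is the only outside vertex not adjacent to the
    cell, and adding it would complete the forbidden set [tau s]. *)
Lemma cc_critical s ts : s <= 1 -> {subset folds <= ts} -> tau s \in ts ->
  (forall t, t \in ts -> [\/ t \in folds, t = tau s, a (1 - s) \in t | exists j, zz j \in t]) ->
  critical ts (cc s).
Proof.
move=> s1 fts tts tT; have nE : s + n.-2 = (s + (n - 3)).+1 by lia.
have rcc : rg (s + n.-2) \in cc s by rewrite inE finset.in_set1 eqxx.
have bcc i : i < h.-1 -> bx s i \in cc s.
  by move=> ih; apply/setU1P; right; exact: in_bset.
split.
- by apply/finset.set0Pn; exists (rg (s + n.-2)).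
- have rb i : i < h.-1 -> ~~ @sadj H (rg (s + n.-2)) (bx s i).
    move=> ih; rewrite nE; apply/negP => /rg_nbr[[b [/hz_inj[_]|/hz_inj[_]]]|[j //]].
      by move=> /col_inj; lia.
    by move=> /col_inj; lia.
  have bb i k : i < h.-1 -> k < h.-1 -> ~~ @sadj H (bx s i) (bx s k).
    by move=> ih kh; rewrite sadj_hz; apply/norP; split; apply/eqP => /col_inj; lia.
  apply/independentP => u v /setU1P[->|/prefix_setP[i ih ->]] /setU1P[->|/prefix_setP[k kh ->]].
  + by rewrite sadj_irrefl.
  + exact: rb.
  + by rewrite sadj_sym; exact: rb.
  + exact: bb.
- move=> t /tT[tf|->|ats|[j zt]]; apply/negP => /fintype.subsetP tc.
  + have [c tE] := in_foldsP tf; have := tc (hz true c); rewrite tE inE eqxx => /(_ isT).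
    by move=> /setU1P[//|]; rewrite hz_true_bset.
  + have /setU1P[|] := tc _ (setU11 _ _); last by rewrite rg_bset.
    by apply/eqP; exact: rg_neq.
  + have /setU1P[//|/prefix_setP[i ih /hz_inj[_ /col_inj]]] := tc _ ats.
    by lia.
  + by have /setU1P[//|] := tc _ zt; rewrite zz_bset.
move=> u uc; suff : excluded ts (cc s) u by case; [right|left].
have adj i : i < h.-1 -> @sadj H (bx s i) u -> excluded ts (cc s) u.
  by move=> ih bu; right; exists (bx s i) => //; exact: bcc.
have radj : @sadj H (rg (s + n.-2)) u -> excluded ts (cc s) u.
  by move=> ru; right; exists (rg (s + n.-2)).
have tauE : u = rg (s + n.-1) -> excluded ts (cc s) u.
  move=> ->; left; exists (tau s) => //; apply: finset.setUS.
  exact: finset.subsetUr.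
case: (vertexP u) => [[[] [c [cn uE]]]|[c cn uE]|[j uE]].
- by rewrite uE; exact: hz_true_excluded.
- have [cs|sc] := ltnP c s.
    apply: (adj 0); first by lia.
    have [c0 s0] : c = 0 /\ s + 0.*2 = 1 by split; lia.
    by rewrite uE /bx c0 s0; exact: adj_prev.
  have [ke|ko] := boolP (odd (c - s)); last first.
    have [ih|ih] := ltnP (c - s)./2 h.-1.
      by move: uc; rewrite uE (_ : c = s + ((c - s)./2).*2) ?bcc //; lia.
    apply: radj; rewrite sadj_sym uE (_ : c = s + n.-2); [exact: adj_rg|lia].
  have [ih|ih] := ltnP (c - s)./2 h.-1.
    apply: (adj (c - s)./2) => //.
    rewrite uE /bx {2}(_ : c = (s + ((c - s)./2).*2).+1); [exact: adj_next|lia].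
  apply: (adj 0); first by lia.
  rewrite uE /bx (_ : s + 0.*2 = 0) -?(hzDn _ 0); last by lia.
  by rewrite (_ : 0 + n = c.+1); [exact: adj_prev|lia].
- have [cs|sc] := ltnP c s.
    apply: tauE; rewrite uE -[c]/(c) -(rgDn c); congr rg; lia.
  have [ih|ih] := ltnP (c - s)./2 h.-1.
    apply: (adj (c - s)./2) => //; rewrite uE /bx.
    have [ke|ko] := boolP (odd (c - s)).
      rewrite {2}(_ : c = (s + ((c - s)./2).*2).+1); [exact: adj_rgS|lia].
    rewrite {2}(_ : c = s + ((c - s)./2).*2); [exact: adj_rg|lia].
  have [ke|ko] := boolP (odd (c - s)).
    by apply: tauE; rewrite uE; congr rg; lia.
  by move: uc; rewrite uE (_ : c = s + n.-2) ?rcc //; lia.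
- by apply: radj; rewrite uE.
Qed.

(** As for odd [n], except that in the last step rung and edge change roles: [x] ends in the rung of
    [cc s] and [y] in the omitted edge. The chain thus stops at the kept cell [cc s], and [tau s]
    excludes the remaining rung at that edge. *)
Lemma even_chain s ts : s <= 1 -> {subset folds <= ts} ->
  (forall j, [set zz j]%SET \in ts) -> tau s \in ts -> cc s \in ts ->
  (forall t, t \in ts -> [\/ t \in folds, exists j, zz j \in t, t = [set a (1 - s)]%SET
     | exists2 s', s' <= 1 & t = tau s' \/ t = cc s']) ->
  dels (Ind H) ts ~~h dels (Ind H) ([set a s]%SET :: ts).
Proof.
move=> s1 fts zts tts cts tT; rewrite -[[set a s]%SET]finset.setU0.
pose x i := if i <= h - 2 then bx s i else rg (s + n.-2).
pose y i := if i < h - 2 then rg (s + i.*2).+2 else a (s + n.-2).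
rewrite (_ : a s = x 0); last by rewrite /x /bx addn0.
have xin i k : i < k -> x i \in finset.set0 :|: prefix_set x k.
  by move=> ik; rewrite finset.set0U; apply/prefix_setP; exists i.
have xb i : i <= h - 2 -> x i = bx s i by move=> ih; rewrite /x ih.
have xlast : x (h - 2).+1 = rg (s + n.-2) by rewrite /x ltnn.
have bx_sub : bset s \subset prefix_set x (h - 2).+1.
  apply/fintype.subsetP => v /prefix_setP[i ih ->]; apply/prefix_setP.
  by exists i; [lia|rewrite xb //; lia].
have ylast : y (h - 2) = a (s + n.-2) by rewrite /y ltnn.
have yb i : i < h - 2 -> y i = rg (s + i.*2).+2 by move=> ih; rewrite /y ih.
apply: (@graph_chain _ _ _ _ x y (h - 2)).
- move=> i ih; rewrite finset.set0U; apply/prefix_setP => -[k ki].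
  rewrite xb; last by lia.
  move: ih; rewrite leq_eqVlt => /predU1P[iE|ih]; last by rewrite yb.
  by rewrite iE ylast => /hz_inj[_ /col_inj]; lia.
- move=> i; rewrite leq_eqVlt => /predU1P[->|ih]; first by rewrite ylast xlast.
  by rewrite yb // xb.
- move=> i u; rewrite leq_eqVlt => /predU1P[->|ih].
    rewrite ylast (_ : s + n.-2 = (s + (n - 3)).+1); last by lia.
    move=> /hz_nbr[[b [->|->]]|[->|->]].
    + right; right; exists (x (h - 2)); first exact: xin.
      rewrite xb // /bx (_ : s + (n - 3) = (s + (h - 2).*2).+1); last by lia.
      exact: adj_next.
    + right; right; exists (x 0); first exact: xin.
      rewrite xb // /bx addn0 -(hzDn _ s) (_ : s + n = (s + (n - 3)).+3); last by lia.
      exact: adj_prev.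
    + by left; rewrite xlast; congr rg; lia.
    + right; left; exists (tau s) => //; rewrite /tau finset.set0U.
      rewrite (_ : s + n.-1 = (s + (n - 3)).+2); last by lia.
      exact: finset.setUS.
  rewrite yb // => /rg_nbr[[b [->|->]]|[j ->]].
  + right; right; exists (x i); first exact: xin.
    by rewrite xb; [exact: adj_next|exact: ltnW].
  + case: b; first by right; exact: hz_true_excluded.
    by left; rewrite xb // /bx doubleS !addnS.
  + by right; exact: excluded1.
- rewrite xlast; left; exists (cc s) => //; rewrite finset.set0U.
  exact: finset.setUS.
- move=> i t ih tts' yt; case: (tT t tts') => [tf|[j zt]|tE|[s' s1' tE]].
  + have [c tE] := in_foldsP tf; move: yt; rewrite tE inE => /eqP; rewrite /y.
    by case: ifP.
  + exists (zz j) => //; split; first by rewrite /y; case: ifP.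
    by right; exact: excluded1.
  + exfalso; move: yt; rewrite tE inE => /eqP; rewrite /y; case: ifP => // _.
    by move=> /hz_inj[_ /col_inj]; lia.
  + exfalso; have yT : y i \in tau s' \/ y i \in cc s'.
      by case: tE yt => -> ?; [left|right].
    move: ih; rewrite leq_eqVlt => /predU1P[iE|ih].
      have /prefix_setP[k kh /hz_inj[_ /col_inj]] : a (s + n.-2) \in bset s'.
        by case: yT; rewrite iE ylast => /setU1P[].
      by lia.
    move: yT; rewrite yb // => -[] /setU1P[/rg_inj/col_inj|]; rewrite ?rg_bset //; lia.
Qed.

End Even.
End RungGraph.

(** * Deleting the apices and assembling the cells *)

Section PMLadder.
Variables (R : realType) (n : nat).
Hypothesis n_gt2 : 2 < n.
Let H := rung_graph n_gt2.
Local Notation "K ~~h L" := (homotopy_equivalent R (geom R K) (geom R L)) (at level 70).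
Implicit Types (t C : {set H}) (ts : seq {set H}) (u : H).
Local Notation hz := (hz n_gt2).
Local Notation rg := (rg n_gt2).
Local Notation zz := (zz n_gt2).
Local Notation wr := (wr n_gt2).
Local Notation zx := (zx n_gt2).
Local Notation zy := (zy n_gt2).
Local Notation zcell := (zcell n_gt2).
Local Notation folds := (folds n_gt2).
Local Notation a := (hz false).
Local Notation pr d j := (wr d 1 |: [set zz j])%SET.

Lemma contractible_equivalent (X Y : topologicalType) :
  homotopy_equivalent R X Y -> contractible R Y -> contractible R X.
Proof. exact: homotopy_equivalent_trans. Qed.

Lemma PM_ladder_odd h : n = h.*2.+1 -> contractible R (geom R (PM (circular_ladder n))).
Proof.
move=> nh; have no : odd n by lia.
apply: contractible_equivalent (PM_odd n_gt2 R no) _.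
set ts := _ ++ _; have fts : {subset folds <= ts} by move=> t tf; rewrite mem_cat tf.
have zts j : [set zz j]%SET \in ts.
  by rewrite mem_cat !inE /apex /zz; case: j; rewrite eqxx ?orbT.
have tsP t : t \in ts -> t != finset.set0 /\ forall c, rg c \notin t.
  rewrite mem_cat !inE => /or3P[/in_foldsP[c ->]|/eqP ->|/eqP ->]; split => [|c'];
    by [apply/finset.set0Pn; eexists; rewrite inE|rewrite inE].
apply: contractible_equivalent (odd_chain R nh (leqnn 1) fts zts _) _.
  by move=> t /tsP[].
set ts1 := _ :: ts.
have sub1 : {subset ts <= ts1} by move=> t tt; rewrite inE tt orbT.
have ts1P t : t \in ts1 -> t != finset.set0 /\ forall c, rg c \notin t.
  rewrite inE => /predU1P[->|/tsP//]; split => [|c]; last by rewrite inE.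
  by apply/finset.set0Pn; eexists; rewrite inE.
apply: contractible_equivalent (odd_chain R nh (leq0n 1) _ _ _) _.
- by move=> t /fts/sub1.
- by move=> j; exact: sub1.
- by move=> t /ts1P[].
have sub2 : {subset ts1 <= [set a 0]%SET :: ts1} by move=> t tt; rewrite inE tt orbT.
apply: rung_cone.
- by move=> t /fts/sub1/sub2.
- by move=> j; apply/sub2/sub1.
- by rewrite mem_head.
- by apply: sub2; rewrite mem_head.
- move=> t; rewrite inE => /predU1P[->|/ts1P[]//].
  by apply/finset.set0Pn; eexists; rewrite inE.
- move=> t; rewrite inE => /predU1P[->|/ts1P[_ /(_ 1)]]; first by constructor 2; rewrite inE.
  by constructor 1.
Qed.

(** What [zremove] asks of a forbidden set, so that adding [a 0] does not complete it. *)
Definition clear t : Prop := (exists c, rg c \in t) \/ a 0 \notin t.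

(** Forbidden sets that no chain based on [zz j] can complete. *)
Definition quiet (j : bool) t : Prop :=
  [\/ t \in folds, exists c, rg c \in t | zz (~~ j) \in t].

Lemma pr_zcell d j : pr d j = zcell d j 1.
Proof.
apply/setP => u; rewrite !inE orbC; congr (_ || _).
by apply/eqP/prefix_setP => [->|[[|//] _ ->]] //; exists 0.
Qed.

Lemma clear_zcell d j m : m.-1 * 3 < n.-1 -> clear (zcell d j m).
Proof.
move=> mn; right; apply/negP => /zcellP[//|[i im]].
by rewrite -(wr_n n_gt2 d) => /wr_inj[|||]; lia.
Qed.

Lemma clear_cons d j ts : (forall t, t \in ts -> clear t) ->
  forall t, t \in pr d j :: ts -> clear t.
Proof.
move=> tT t; rewrite inE => /predU1P[->|/tT//]; rewrite pr_zcell.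
by apply: clear_zcell; lia.
Qed.

(** The vertex [zz j] is deleted after its pairs with the two row neighbours of [a 0]. The list [X]
    holds the forbidden sets that are not [quiet]; how the pairs are deleted depends on [n] modulo 3
    and is left to the last two hypotheses. *)
Lemma phase j ts X :
  {subset folds <= ts} -> (forall t, t \in ts -> clear t) ->
  (forall t, t \in ts -> quiet j t \/ t \in X) ->
  (forall ts1, {subset ts <= ts1} -> (forall t, t \in ts1 -> quiet j t \/ t \in X) ->
     dels (Ind H) ts1 ~~h dels (Ind H) (pr true j :: ts1)) ->
  (forall ts1, {subset ts <= ts1} -> (forall t, t \in ts1 -> quiet j t \/ t \in pr true j :: X) ->
     pr true j \in ts1 ->
     dels (Ind H) ts1 ~~h dels (Ind H) (pr false j :: ts1)) ->
  dels (Ind H) ts ~~h dels (Ind H) [:: [set zz j]%SET, pr false j, pr true j & ts].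
Proof.
move=> fts cts tX addT addF; apply: homotopy_equivalent_trans (addT ts _ tX) _ => //.
apply: homotopy_equivalent_trans (addF _ _ _ _) _.
- by move=> t tts; rewrite inE tts orbT.
- move=> t; rewrite inE => /predU1P[->|/tX[]]; first by right; rewrite mem_head.
    by left.
  by move=> tX'; right; rewrite inE tX' orbT.
- by rewrite mem_head.
apply: zremove.
- by move=> t /fts tts; rewrite !inE tts !orbT.
- by rewrite inE mem_head orbT.
- by rewrite mem_head.
- by apply: clear_cons; exact: clear_cons.
Qed.

Lemma zcell_next d j m : zcell d j m.+1 \subset zx d m |: zcell d j m.
Proof.
apply/fintype.subsetP => u /zcellP[->|[i im ->]].
  by apply/setU1P; right; exact: zz_in_zcell.
move: im; rewrite ltnS leq_eqVlt => /predU1P[->|im]; first exact: setU11.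
by apply/setU1P; right; exact: in_zcell.
Qed.

(** Read in direction [d], the two sides live in columns congruent to [0] and to [n - 1] modulo
    3. *)
Lemma zy_notin_zcell d j m l : m.-1 * 3 < n -> l * 3 + 3 < n -> n %% 3 != 1 ->
  forall i, i <= l -> zy d i \notin zcell (~~ d) j m.
Proof.
move=> mn ln n3 i il; apply/negP => /zcellP[|[k km]].
  by rewrite /zy /wr; case: (d).
by rewrite /zx wr_flip; [move=> /wr_inj[|||]; lia|lia].
Qed.

Lemma zy_notin_pr d j l : l * 3 + 4 < n ->
  forall i, i <= l -> zy d i \notin pr (~~ d) j.
Proof.
move=> ln i il; rewrite pr_zcell; apply/negP => /zcellP[|[k]].
  by rewrite /zy /wr; case: (d).
rewrite ltnS leqn0 => /eqP ->; rewrite /zx wr_flip; last by lia.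
by move=> /wr_inj[|||]; lia.
Qed.

Lemma phase0 m j ts : n = m * 3 -> 2 <= m -> {subset folds <= ts} ->
  (forall t, t \in ts -> clear t) ->
  zcell true j m \in ts -> zcell false j m \in ts ->
  (forall t, t \in ts -> quiet j t \/ t \in [:: zcell true j m; zcell false j m]) ->
  dels (Ind H) ts ~~h dels (Ind H) [:: [set zz j]%SET, pr false j, pr true j & ts].
Proof.
move=> nm m2 fts cts zT zF tX; have mE : m = (m - 2).+2 by lia.
have step d ts1 : {subset ts <= ts1} ->
    (forall t, t \in ts1 -> quiet j t \/ t \in [:: pr (~~ d) j; zcell d j m; zcell (~~ d) j m]) ->
    dels (Ind H) ts1 ~~h dels (Ind H) (pr d j :: ts1).
  move=> sub1 t1X; have zd : zcell d j m \in ts1 by apply: sub1; case: (d).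
  apply: (@zchain _ _ _ d j (m - 2)).
  - by move=> t /fts/sub1.
  - by lia.
  - by left; exists (zcell d j m) => //; rewrite {1}mE; exact: zcell_next.
  move=> t /t1X[[tf|tr|tz]|]; [left; exact: Or41|left; exact: Or42|left; exact: Or43|].
  rewrite !inE => /or3P[/eqP->|/eqP->|/eqP->]; last 1 first.
  (* The last edge of the cell in the opposite direction is in column 2 when read in direction [d],
     next to [zx d 0]; it keeps that cell from being completed. *)
  - left; constructor 4; right; exists (zx (~~ d) (m - 1)); split.
    + by apply: in_zcell; lia.
    + by move=> i il; rewrite /zx wr_flip; [apply/eqP => /wr_inj[|||]; lia|lia].
    + right; exists (zx d 0); first by rewrite !inE eqxx.
      rewrite /zx wr_flip; last by lia.
      rewrite (_ : n - ((m - 1) * 3).+1 = 2); last by lia.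
      by apply: wr_next; lia.
  - by left; constructor 4; left; apply: zy_notin_pr; lia.
  - by right; rewrite -mE.
apply: (phase fts cts tX) => ts1 sub1 t1X.
  apply: step => // t /t1X[]; first by left.
  by right; rewrite inE (_ : t \in _) ?orbT.
move=> _; apply: step => // t /t1X[]; first by left.
by rewrite !inE => /or3P[]/eqP->; right; rewrite ?eqxx ?orbT.
Qed.

(** The chain in direction [true] stops at the kept cell. The one in direction [false] ends in
    column [n - 1], which is column 1 the other way, where the pair [pr true j] is already
    forbidden. *)
Lemma phase2 m j ts : n = m * 3 + 2 -> 2 <= m -> {subset folds <= ts} ->
  (forall t, t \in ts -> clear t) -> zcell true j m.+1 \in ts ->
  (forall t, t \in ts -> quiet j t \/ t \in [:: zcell true j m.+1]) ->
  dels (Ind H) ts ~~h dels (Ind H) [:: [set zz j]%SET, pr false j, pr true j & ts].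
Proof.
move=> nm m2 fts cts zT tX; have mE : m = (m - 1).+1 by lia.
apply: (phase fts cts tX) => ts1 sub1 t1X; last move=> prT.
  apply: (@zchain _ _ _ true j (m - 1)); rewrite -?mE.
  - by move=> t /fts/sub1.
  - by lia.
  - left; exists (zcell true j m.+1); [exact: sub1|exact: zcell_next].
  move=> t /t1X[[tf|tr|tz]|]; [left; exact: Or41|left; exact: Or42|left; exact: Or43|].
  by rewrite inE => /eqP ->; right.
apply: (@zchain _ _ _ false j (m - 1)); rewrite -?mE.
- by move=> t /fts/sub1.
- by lia.
- left; exists (pr true j) => //; apply/fintype.subsetP => u.
  rewrite !inE => /orP[/eqP->|/eqP->]; last by rewrite eqxx orbT.
  have -> : zx false m = wr true 1; last by rewrite eqxx.
  rewrite /zx (@wr_flip _ _ true); last by lia.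
  by congr (wr true _); lia.
move=> t /t1X[[tf|tr|tz]|]; [left; exact: Or41|left; exact: Or42|left; exact: Or43|].
rewrite !inE => /orP[/eqP->|/eqP->]; left; constructor 4; left.
- by apply: zy_notin_pr; lia.
- by apply: (@zy_notin_zcell false); lia.
Qed.

(** For [n = m * 3 + 1] the chain returns to column 0, next to its start, so the pair goes for free.
    This comes before the choice of critical cells, since the missing pair is what excludes the
    corner of [zcell false j m]. *)
Lemma prephase1 m j ts : n = m * 3 + 1 -> 1 <= m -> {subset folds <= ts} ->
  (forall t, t \in ts -> quiet j t) ->
  dels (Ind H) ts ~~h dels (Ind H) (pr true j :: ts).
Proof.
move=> nm m1 fts tX; have mE : m = (m - 1).+1 by lia.
apply: (@zchain _ _ _ true j (m - 1)); rewrite -?mE //.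
- by lia.
- right; exists (zx true 0); first exact: in_zcell.
  rewrite /zx (_ : (m * 3).+1 = n); last by lia.
  by rewrite wr_n -(wr0 n_gt2 true); apply: wr_prev; lia.
- by move=> t /tX[tf|tr|tz]; left; [exact: Or41|exact: Or42|exact: Or43].
Qed.

Lemma phase1 m j ts : n = m * 3 + 1 -> 1 <= m -> {subset folds <= ts} ->
  (forall t, t \in ts -> clear t) -> zcell false j m \in ts -> pr true j \in ts ->
  (forall t, t \in ts -> quiet j t \/ t \in [:: pr true j; zcell false j m]) ->
  dels (Ind H) ts ~~h dels (Ind H) [:: [set zz j]%SET, pr false j, pr true j & ts].
Proof.
move=> nm m1 fts cts zF prT tX.
have triv t ts1 : t \in ts1 -> dels (Ind H) ts1 ~~h dels (Ind H) (t :: ts1).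
  move=> tts; rewrite (@dels_perm _ _ _ (t :: ts1)); first exact: homotopy_equivalent_refl.
  by move=> u; rewrite [RHS]inE; case: eqVneq => [->|].
apply: (phase fts cts tX) => ts1 sub1 t1X; first exact/triv/sub1.
move=> _; case: (ltngtP m 1) => m2; first by lia.
  have mE : m = (m - 2).+2 by lia.
  apply: (@zchain _ _ _ false j (m - 2)); rewrite -?mE.
  - by move=> t /fts/sub1.
  - by lia.
  - left; exists (zcell false j m); first exact: sub1.
    by rewrite {1}mE; exact: zcell_next.
  move=> t /t1X[[tf|tr|tz]|]; [left; exact: Or41|left; exact: Or42|left; exact: Or43|].
  rewrite !inE orbA orbb => /orP[/eqP->|/eqP->]; last by right.
  by left; constructor 4; left; apply: (@zy_notin_pr false); lia.
(* For [n = 4] the pair in direction [false] is itself the kept cell. *)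
by apply/triv/sub1; rewrite pr_zcell -m2.
Qed.

Section Even.
Variable h : nat.
Hypotheses (nh : n = h.*2) (h_ge2 : 2 <= h).
Local Notation tau := (tau n_gt2 h).
Local Notation cc := (cc n_gt2 h).

(** Without the apices, the chains through [cc 1] and [cc 0] delete [a 1] and [a 0], after which the
    rung between them is a cone point. *)
Lemma even_end ts : {subset folds <= ts} -> (forall j, [set zz j]%SET \in ts) ->
  (forall s, s <= 1 -> tau s \in ts /\ cc s \in ts) ->
  (forall t, t \in ts -> [\/ t \in folds, exists j, zz j \in t
     | exists2 s, s <= 1 & t = tau s \/ t = cc s]) ->
  contractible R (geom R (dels (Ind H) ts)).
Proof.
move=> fts zts tcts tsP; have [tau1 cc1] := tcts 1 isT; have [tau0 cc0] := tcts 0 isT.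
apply: contractible_equivalent (even_chain R nh h_ge2 (leqnn 1) fts zts tau1 cc1 _) _.
  by move=> t /tsP[]; [constructor 1|constructor 2|constructor 4].
set ts1 := _ :: ts.
have sub1 : {subset ts <= ts1} by move=> t tt; rewrite inE tt orbT.
apply: contractible_equivalent (even_chain R nh h_ge2 (leq0n 1) _ _ _ _ _) _.
- by move=> t /fts/sub1.
- by move=> j; exact: sub1.
- exact: sub1.
- exact: sub1.
- move=> t; rewrite inE => /predU1P[->|/tsP[]]; first by constructor 3.
  + by constructor 1.
  + by constructor 2.
  + by constructor 4.
have sub2 : {subset ts1 <= [set a 0]%SET :: ts1} by move=> t tt; rewrite inE tt orbT.
have tcP s : s <= 1 -> forall t, t = tau s \/ t = cc s ->
    t != finset.set0 /\ rg 1 \notin t.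
  move=> s1 t tE; split.
    by apply/finset.set0Pn; case: tE => ->; eexists; exact: setU11.
  by case: tE => ->; rewrite finset.in_setU finset.in_set1 rg_bset orbF;
    apply/eqP => /rg_inj/col_inj; lia.
apply: rung_cone.
- by move=> t /fts/sub1/sub2.
- by move=> j; apply/sub2/sub1.
- by rewrite mem_head.
- by apply: sub2; rewrite mem_head.
- move=> t; rewrite 2!inE => /or3P[/eqP->|/eqP->|/tsP[/in_foldsP[c ->]|[j zt]|[s s1 /(tcP s s1)[]//]]].
  + by apply/finset.set0Pn; eexists; rewrite inE.
  + by apply/finset.set0Pn; eexists; rewrite inE.
  + by apply/finset.set0Pn; eexists; rewrite inE.
  + by apply/finset.set0Pn; exists (zz j).
- move=> t; rewrite 2!inE => /or3P[/eqP->|/eqP->|/tsP[/in_foldsP[c ->]|[j zt]|[s s1 /(tcP s s1)[]//]]].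
  + by constructor 2; rewrite inE.
  + by constructor 3; rewrite inE.
  + by constructor 1; rewrite inE.
  + by constructor 4; exists j.
  + by constructor 1.
Qed.

Lemma PM_even_taus :
  PM (circular_ladder n) ~~h dels (Ind H) [:: tau 1, tau 0 & folds].
Proof.
have ne : ~~ odd n by lia.
apply: homotopy_equivalent_trans (PM_even n_gt2 R ne) _.
apply: homotopy_equivalent_trans (tau_collapse R nh h_ge2 (leq0n 1) _ _) _; rewrite -?/folds.
- by [].
- by left.
apply: (tau_collapse R nh h_ge2 (leqnn 1)).
- by move=> t; rewrite inE orbC => ->.
- move=> t; rewrite inE => /predU1P[->|]; [right|by left].
  apply/setU1P; right; have h0 : 0 < h.-1 by lia.
  exact: (in_bset n_gt2 0 h0).
Qed.

Local Notation taus := [:: tau 1, tau 0 & folds].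

Lemma tausP t : t \in taus -> t \in folds \/ exists2 s, s <= 1 & t = tau s.
Proof.
by rewrite !inE => /or3P[/eqP->|/eqP->|]; [right; exists 1|right; exists 0|left].
Qed.

Lemma clear_folds t : t \in folds -> clear t.
Proof. by case/in_foldsP=> c ->; right; rewrite inE; apply/eqP => -[]. Qed.

Lemma rg_tau s : exists c, rg c \in tau s.
Proof. by eexists; exact: setU11. Qed.

Lemma rg_cc s : exists c, rg c \in cc s.
Proof. by eexists; exact: setU11. Qed.

Lemma zz_cc j s : zz j \notin cc s.
Proof. by apply/negP => /setU1P[//|]; rewrite zz_bset. Qed.

(** The part common to all residues of [n] modulo 3. Cells at one apex are [quiet] for the other, so
    the two apices can be deleted by the same argument, one after the other. The two entries [h.-1]
    belong to [cc 0] and [cc 1]. *)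
Lemma bouquet_of_cells m ts (cells X : bool -> seq {set H}) : m.-1 * 3 < n.-1 ->
  {subset taus <= ts} ->
  (forall t, t \in ts -> t \in taus \/ exists j, t = pr true j) ->
  (forall j t, t \in ts -> quiet j t \/ t \in X j) ->
  (forall j, {subset cells j <= X j}) ->
  (forall j t, t \in cells j -> exists d, t = zcell d j m) ->
  (forall j, uniq (cells j)) ->
  (forall j t, t \in cells j -> critical ts t) ->
  (forall j ts1, {subset ts <= ts1} -> {subset cells j <= ts1} ->
     (forall t, t \in ts1 -> clear t) -> (forall t, t \in ts1 -> quiet j t \/ t \in X j) ->
     dels (Ind H) ts1 ~~h dels (Ind H) [:: [set zz j]%SET, pr false j, pr true j & ts1]) ->
  homotopy_equivalent R (geom R (dels (Ind H) ts))
    (sphere_wedge R ([:: h.-1; h.-1] ++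
       nseq (size (cells false)) m ++ nseq (size (cells true)) m)).
Proof.
move=> mn sub tsT tsX cX cE cU cC phase.
have cellz j t : t \in cells j -> zz j \in t /\ zz (~~ j) \notin t.
  move=> /cE[d ->]; rewrite zz_in_zcell; split=> //; apply/negP => /zcellP[|[i _]].
    by case: (j).
  by rewrite /zx /wr; case: (d).
have fts : {subset folds <= ts} by move=> t tf; apply: sub; rewrite !inE tf !orbT.
have taus_ts s : s <= 1 -> tau s \in ts.
  by case: s => [|[|//]] _; apply: sub; rewrite !inE eqxx ?orbT.
have clear_cells j t : t \in cells j -> clear t by move=> /cE[d ->]; exact: clear_zcell.
have clear_ts t : t \in ts -> clear t.
  move=> /tsT[/tausP[/clear_folds//|[s _ ->]]|[j ->]]; first by left; exact: rg_tau.
  by rewrite pr_zcell; apply: clear_zcell; lia.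
set ss := [:: cc 0, cc 1 & cells false ++ cells true].
have ssE t : t \in ss -> (exists2 s, s <= 1 & t = cc s) \/ exists j, t \in cells j.
  rewrite !inE mem_cat => /or4P[/eqP->|/eqP->|tc|tc].
  - by left; exists 0.
  - by left; exists 1.
  - by right; exists false.
  - by right; exists true.
have cells_ss j : {subset cells j <= ss}.
  by case: j => t tc; rewrite !inE mem_cat tc ?orbT.
apply: (@graph_bouquet _ _ ts ss).
- have ncc s j : cc s \notin cells j.
    by apply/negP => /cellz[zc _]; move: zc; rewrite (negbTE (zz_cc j s)).
  rewrite /= !inE !mem_cat !negb_or !ncc cat_uniq !cU /= !andbT; apply/andP; split.
    apply/eqP => /setP/(_ (rg (0 + n.-2))); rewrite setU11 !inE rg_bset orbF.
    by move/esym/eqP/rg_inj/col_inj; lia.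
  apply/hasPn => t tt; apply/negP => tf.
  by have [zt _] := cellz _ _ tt; have [_] := cellz _ _ tf; rewrite zt.
- by [].
- move=> t /ssE[[s s1 ->]|[j]]; last exact: cC.
  apply: (cc_critical nh h_ge2 s1 fts (taus_ts s s1)) => t' /tsT[/tausP[tf|[s' s1' ->]]|[j ->]].
  + exact: Or41.
  + have [->|ss'] := eqVneq s' s; first exact: Or42.
    constructor 3; apply/setU1P; right; rewrite (_ : 1 - s = s'); last by lia.
    have h0 : 0 < h.-1 by lia.
    by have := in_bset n_gt2 s' h0; rewrite /bx addn0.
  + by constructor 4; exists j; rewrite !inE eqxx orbT.
- have cardC j : [seq #|t| | t : {set H} <- cells j] = nseq (size (cells j)) m.+1.
    rewrite -(size_map (fun t => #|t|)); apply/all_pred1P/allP => _ /mapP[t /cE[d ->] ->].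
    by apply/eqP; exact: card_zcell.
  rewrite /= !(card_cc n_gt2 nh h_ge2) // !map_cat !cardC !map_nseq.
  by rewrite (_ : h = h.-1.+1) //; lia.
have sub1 : {subset ts <= ss ++ ts} by move=> t tt; rewrite mem_cat tt orbT.
have clear1 t : t \in ss ++ ts -> clear t.
  rewrite mem_cat => /orP[/ssE[[s _ ->]|[j /clear_cells//]]|/clear_ts//].
  by left; exact: rg_cc.
have quiet1 j t : t \in ss ++ ts -> quiet j t \/ t \in X j.
  rewrite mem_cat => /orP[/ssE[[s _ ->]|[j' tc]]|/tsX//].
    by left; constructor 2; exact: rg_cc.
  have [jj|jj] := eqVneq j' j; first by right; apply: cX; rewrite -jj.
  left; constructor 3; rewrite (_ : ~~ j = j'); first by have [] := cellz _ _ tc.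
  by case: (j) (j') jj => -[].
have sub_ss t : t \in ss -> t \in ss ++ ts by move=> tt; rewrite mem_cat tt.
apply: contractible_equivalent (phase false _ sub1 _ clear1 (quiet1 false)) _.
  by move=> t /cells_ss/sub_ss.
set ts2 := [:: _, _, _ & _].
have sub2 : {subset ss ++ ts <= ts2} by move=> t tt; rewrite 3!inE tt !orbT.
have ts2P t : t \in ts2 -> [\/ t = [set zz false]%SET, exists d, t = pr d false | t \in ss ++ ts].
  rewrite !inE => /or4P[/eqP->|/eqP->|/eqP->|tt]; [exact: Or31| | |exact: Or33].
    by constructor 2; exists false.
  by constructor 2; exists true.
apply: contractible_equivalent (phase true _ _ _ _ _) _.
- by move=> t /sub1/sub2.
- by move=> t /cells_ss/sub_ss/sub2.
- move=> t /ts2P[->|[d ->]|/clear1//]; first by right; rewrite inE.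
  by rewrite pr_zcell; apply: clear_zcell; lia.
- move=> t /ts2P[->|[d ->]|/quiet1//]; left; constructor 3; first by rewrite inE.
  by rewrite !inE eqxx orbT.
set ts3 := [:: _, _, _ & _].
have sub3 : {subset ts2 <= ts3} by move=> t tt; rewrite 3!inE tt !orbT.
apply: even_end.
- by move=> t /fts/sub1/sub2/sub3.
- by case; [|apply: sub3]; rewrite mem_head.
- move=> s s1; split; first exact/sub3/sub2/sub1/taus_ts.
  by apply/sub3/sub2/sub_ss; case: s s1 => [|[|//]] _; rewrite !inE eqxx ?orbT.
- have zpr d j : exists j', zz j' \in pr d j by exists j; rewrite !inE eqxx orbT.
  move=> t; rewrite 3!inE => /or4P[/eqP->|/eqP->|/eqP->|/ts2P[->|[d ->]|]].
  + by constructor 2; exists true; rewrite inE.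
  + exact: Or32.
  + exact: Or32.
  + by constructor 2; exists false; rewrite inE.
  + exact: Or32.
  rewrite mem_cat => /orP[/ssE[[s s1 ->]|[j /cellz[zt _]]]|/tsT[/tausP[tf|[s s1 ->]]|[j ->]]].
  + by constructor 3; exists s; [|right].
  + by constructor 2; exists j.
  + exact: Or31.
  + by constructor 3; exists s; [|left].
  + exact: Or32.
Qed.

Lemma quiet_taus j t : t \in taus -> quiet j t.
Proof.
move=> /tausP[tf|[s _ ->]]; first exact: Or31.
by constructor 2; exact: rg_tau.
Qed.

Lemma folds_taus : {subset folds <= taus}.
Proof. by move=> t tf; rewrite !inE tf !orbT. Qed.

Lemma zcell_critical_taus d j m : 0 < m -> n <= m * 3 -> m * 3 <= n.+1 ->
  critical taus (zcell d j m).
Proof.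
move=> m0 nm mn; apply: zcell_critical => //; [lia|exact: folds_taus| |lia].
by move=> t /(@quiet_taus j)[tf|tr|tz]; [exact: Or41|exact: Or42|exact: Or43].
Qed.

(** The two directions give different maximal cells, in columns congruent to 1 and to 2 modulo 3;
    with two apices this makes four. *)
Lemma PM_ladder_0mod3 m : n = m * 3 ->
  homotopy_equivalent R (geom R (PM (circular_ladder n)))
    (sphere_wedge R ([:: h.-1; h.-1] ++ nseq 4 m)).
Proof.
move=> nm; have m2 : 2 <= m by lia.
apply: homotopy_equivalent_trans PM_even_taus _.
pose cells j := [:: zcell true j m; zcell false j m].
apply: (@bouquet_of_cells m taus cells cells) => //.
- by lia.
- by left.
- by left; exact: quiet_taus.
- by move=> j t.
- by move=> j t; rewrite !inE => /orP[/eqP->|/eqP->]; eexists.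
- move=> j; rewrite /= inE andbT; apply/eqP => /setP/(_ (zx true 0)).
  rewrite in_zcell; last by lia.
  move/esym/zcellP => [//|[i im]]; rewrite /zx (@wr_flip _ _ true); last by lia.
  by move=> /wr_inj[|||]; lia.
- by move=> j t; rewrite !inE => /orP[] /eqP ->; apply: zcell_critical_taus; lia.
move=> j ts1 sub1 cs1 clear1 quiet1; apply: (phase0 nm m2 _ clear1 _ _ quiet1).
- by move=> t /folds_taus/sub1.
- by apply: cs1; rewrite mem_head.
- by apply: cs1; rewrite inE mem_head orbT.
Qed.

(** Reversal maps columns congruent to 1 modulo 3 to themselves, so both directions give the same
    cell and there is one per apex. *)
Lemma PM_ladder_2mod3 m : n = m * 3 + 2 ->
  homotopy_equivalent R (geom R (PM (circular_ladder n)))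
    (sphere_wedge R ([:: h.-1; h.-1] ++ nseq 2 m.+1)).
Proof.
move=> nm; have m2 : 2 <= m by lia.
apply: homotopy_equivalent_trans PM_even_taus _.
pose cells j := [:: zcell true j m.+1].
apply: (@bouquet_of_cells m.+1 taus cells cells) => //.
- by lia.
- by left.
- by left; exact: quiet_taus.
- by move=> j t.
- by move=> j t; rewrite inE => /eqP ->; eexists.
- by move=> j t; rewrite inE => /eqP ->; apply: zcell_critical_taus; lia.
move=> j ts1 sub1 cs1 clear1 quiet1; apply: (phase2 nm m2 _ clear1 _ quiet1).
- by move=> t /folds_taus/sub1.
- by apply: cs1; rewrite mem_head.
Qed.

(** At each apex the pair in direction [true] is deleted beforehand, which leaves one critical cell,
    in direction [false]. *)
Lemma PM_ladder_1mod3 m : n = m * 3 + 1 ->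
  homotopy_equivalent R (geom R (PM (circular_ladder n)))
    (sphere_wedge R ([:: h.-1; h.-1] ++ nseq 2 m)).
Proof.
move=> nm; have m1 : 1 <= m by lia.
apply: homotopy_equivalent_trans PM_even_taus _.
apply: homotopy_equivalent_trans (prephase1 (j := false) nm m1 folds_taus _) _.
  by move=> t; exact: quiet_taus.
apply: homotopy_equivalent_trans (prephase1 (j := true) nm m1 _ _) _.
- by move=> t /folds_taus tt; rewrite inE tt orbT.
- move=> t; rewrite inE => /predU1P[->|]; last exact: quiet_taus.
  by constructor 3; rewrite !inE eqxx orbT.
set ts := [:: _, _ & _]; pose cells j := [:: zcell false j m].
have pr_ts j : pr true j \in ts by rewrite /ts; case: j; rewrite !inE eqxx ?orbT.
have tsP t : t \in ts -> t \in taus \/ exists j, t = pr true j.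
  by rewrite /ts 2!inE => /or3P[/eqP->|/eqP->|]; [right; eexists|right; eexists|left].
have sub : {subset taus <= ts} by move=> t tt; rewrite /ts 2!inE tt !orbT.
have tsX j t : t \in ts -> quiet j t \/ t = pr true j.
  move=> /tsP[/quiet_taus|[j' ->]]; first by left.
  have [->|jj] := eqVneq j' j; [by right|left; constructor 3].
  by rewrite !inE (_ : ~~ j = j') ?eqxx ?orbT //; case: (j) (j') jj => -[].
apply: (@bouquet_of_cells m ts cells (fun j => [:: pr true j; zcell false j m])) => //.
- by lia.
- by move=> j t /(tsX j)[|->]; [left|right; rewrite mem_head].
- by move=> j t; rewrite inE => /eqP ->; rewrite inE mem_head orbT.
- by move=> j t; rewrite inE => /eqP ->; eexists.
- move=> j t; rewrite inE => /eqP ->; apply: zcell_critical; [lia|lia|lia| | |].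
  + by move=> u /folds_taus/sub.
  + move=> u /(tsX j)[[tf|tr|tz]|->]; [exact: Or41|exact: Or42|exact: Or43|].
    constructor 4; exists (m * 3); first by lia.
    have wE : wr false (m * 3) = wr true 1 by congr (wr true _); lia.
    split; first by rewrite wE setU11.
    by move=> i im; apply/eqP => /wr_inj[|||]; lia.
  + move=> _; left; exists (pr true j) => //.
    have -> : wr false (m * 3) = wr true 1 by congr (wr true _); lia.
    by apply: finset.setUS; rewrite finset.sub1set zz_in_zcell.
move=> j ts1 sub1 cs1 clear1 quiet1; apply: (phase1 nm m1 _ clear1 _ _ quiet1).
- by move=> t /folds_taus/sub/sub1.
- by apply: cs1; rewrite mem_head.
- exact/sub1/pr_ts.
Qed.

End Even.
End PMLadder.

(* In (c), n = 2 is excluded: there the perfect matching complex has two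
   components and the asserted wedge has three. *)
Theorem theorem2 (R : realType) (n : nat) (hn : (2 <= n)%N) :
  (* (a) *)
  (forall k : nat,
     [/\ n = (4 * k)%N ->
           homotopy_equivalent R (geom R (Ind (circular_ladder n)))
             (sphere_wedge R (nseq 3 (2 * k - 1)%N)),
         n = (4 * k + 1)%N ->
           homotopy_equivalent R (geom R (Ind (circular_ladder n)))
             (sphere R (2 * k - 1)%N),
         n = (4 * k + 2)%N ->
           homotopy_equivalent R (geom R (Ind (circular_ladder n)))
             (sphere R (2 * k)%N)
       & n = (4 * k + 3)%N ->
           homotopy_equivalent R (geom R (Ind (circular_ladder n)))
             (sphere R (2 * k + 1)%N)]) /\
  (* (b) *)
  (forall k : nat, n = (2 * k + 1)%N ->
     contractible R (geom R (PM (circular_ladder n)))) /\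
  (* (c) *)
  (forall k : nat,
     (n = (3 * (2 * k))%N ->
        homotopy_equivalent R (geom R (PM (circular_ladder n)))
          (sphere_wedge R
             ([:: (n - 2) %/ 2; (n - 2) %/ 2] ++ nseq 4 (2 * k))%N)) /\
     (n = (3 * (2 * k + 1) + 1)%N \/ n = (3 * (2 * k + 1) - 1)%N ->
        n <> 2%N ->
        homotopy_equivalent R (geom R (PM (circular_ladder n)))
          (sphere_wedge R
             ([:: (n - 2) %/ 2; (n - 2) %/ 2] ++ nseq 2 (2 * k + 1))%N))).
Proof.
split=> [k|]; first split; [exact: ladder_4k|exact: ladder_4k1|exact: ladder_4k2|exact: ladder_4k3|].
split=> [k nk|k].
  have n_gt2 : (2 < n)%N by lia.
  by apply: (PM_ladder_odd R n_gt2 (h := k)); lia.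
have wedgeE h : n = h.*2 -> ((n - 2) %/ 2)%N = h.-1 by lia.
split=> [nk|nk n2].
  have n_gt2 : (2 < n)%N by lia.
  have nh : n = (3 * k).*2 by lia.
  by rewrite (wedgeE _ nh); apply: (PM_ladder_0mod3 R n_gt2 nh); lia.
case: nk => nk.
  have n_gt2 : (2 < n)%N by lia.
  have nh : n = (3 * k + 2).*2 by lia.
  by rewrite (wedgeE _ nh); apply: (PM_ladder_1mod3 R n_gt2 nh); lia.
have n_gt2 : (2 < n)%N by lia.
have nh : n = (3 * k + 1).*2 by lia.
(* Here [n = 3 * (2 * k) + 2], so the residue is 2 with [m = 2 * k], and the spheres have dimension
   [m.+1]. *)
rewrite (wedgeE _ nh) (_ : (2 * k + 1)%N = (2 * k).+1); last by rewrite addn1.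
by apply: (PM_ladder_2mod3 R n_gt2 nh); lia.
Qed.
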